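(* Let $m>1$ be an integer with $m\not\equiv 2\pmod 4$, and let $r$ be the number of distinct prime factors of $m$. Let $J=\{1,c\}$ be the group of order two acting on $U_m$ and $\mathcal{O}_m$ by $c[a]=[-a]$. Then $J$ acts trivially on the cohomology groups $H^i(J,\mathcal{O}_m)$ and $H^i(J,U_m)$ for $i=1,2$; moreover $$H^1(J,\mathcal{O}_m)\cong H^2(J,\mathcal{O}_m)\cong\begin{cases}\mathbb{Z}/2\mathbb{Z},& \text{if } m=2^k \text{ for some } k,\\ 0,&\text{otherwise,}\end{cases}$$ and $$H^1(J,U_m)\cong H^2(J,U_m)\cong(\mathbb{Z}/2\mathbb{Z})^{2^{r-1}}.$$
   Context: Let $\mathbf{A}_m$ be the free abelian group on symbols $[a]$, $a\in\frac1m\mathbb{Z}/\mathbb{Z}$. The universal distribution of level $m$ (rank 1) is $$U_m=\mathbf{A}_m\Big/\Big\langle [a]-\sum_{nb=a}[b] : n\mid m,\ a\in\tfrac{n}{m}\mathbb{Z}/\mathbb{Z}\Big\rangle ,$$ and the universal predistribution of level $m$ is $$\mathcal{O}_m=\mathbf{A}_m\Big/\Big\langle \sum_{nb=a}[b] : n\mid m,\ n>1,\ a\in\tfrac{n}{m}\mathbb{Z}/\mathbb{Z}\Big\rangle .$$ The sums run over all $b\in\mathbb{Q}/\mathbb{Z}$ with $nb=a$. $H^i(J,\cdot)$ is ordinary group cohomology. *)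

(* Defs.v *)
From HB Require Import structures.
From mathcomp Require Import all_boot all_order all_fingroup all_algebra.
From mathcomp Require Import boolp.

Set Implicit Arguments.
Unset Strict Implicit.
Unset Printing Implicit Defensive.
Import GRing.Theory.
Local Open Scope ring_scope.
Local Open Scope quotient_scope.

Definition zmod_iso (A B : zmodType) : Prop :=
  exists f : {additive A -> B}, bijective f.

Section Span.
Variables (V : zmodType) (S : V -> Prop).

Definition zspan : {pred V} := fun x =>
  `[< exists2 s : seq (int * V), (forall p, p \in s -> S p.2)
        & x = \sum_(p <- s) p.2 *~ p.1 >].

Fact zspan_zmod_closed : zmod_closed zspan.
Proof.
split=> [|x y /asboolP[s Ss ->] /asboolP[t St ->]]; apply/asboolP.
  by exists [::]; rewrite ?big_nil.
exists (s ++ [seq (- p.1, p.2) | p <- t]).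
  move=> p; rewrite mem_cat => /orP[/Ss //|/mapP[q /St Sq ->]//].
rewrite big_cat big_map /=; congr (_ + _).
by rewrite -sumrN; apply: eq_bigr => p _; rewrite mulrNz.
Qed.
HB.instance Definition _ := GRing.isZmodClosed.Build V zspan zspan_zmod_closed.

Lemma mem_zspan x : S x -> x \in zspan.
Proof.
move=> Sx; apply/asboolP; exists [:: (1, x)].
  by move=> p; rewrite inE => /eqP->.
by rewrite big_seq1 mulr1z.
Qed.

Lemma zspan_stable (f : {additive V -> V}) x :
  (forall y, S y -> S (f y)) -> x \in zspan -> f x \in zspan.
Proof.
move=> Sf /asboolP[s Ss ->]; rewrite raddf_sum big_seq.
apply: rpred_sum => p ps.
by rewrite raddfMz rpredMz // mem_zspan //; apply/Sf/Ss.
Qed.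

End Span.

Record gmodule (G : finGroupType) := GModule {
  gm_sort :> zmodType;
  gm_act : G -> gm_sort -> gm_sort;
  gm_actD : forall g x y, gm_act g (x + y) = gm_act g x + gm_act g y;
  gm_act1 : forall x, gm_act 1%g x = x;
  gm_actM : forall g h x, gm_act (g * h)%g x = gm_act g (gm_act h x)
}.

(* Group cohomology from inhomogeneous cochains. *)
Section Cohomology.
Variables (G : finGroupType) (M : gmodule G).

Fact gm_act_is_nmod_morphism (g : G) : nmod_morphism (@gm_act G M g).
Proof.
by split; [apply: (@addrI _ (gm_act g 0)); rewrite -gm_actD !addr0
          | exact: gm_actD].
Qed.
HB.instance Definition _ (g : G) :=
  GRing.isNmodMorphism.Build M M (@gm_act G M g) (gm_act_is_nmod_morphism g).

Definition cochain (n : nat) : zmodType := {ffun n.-tuple G -> M}.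

Section Faces.
Variables (n : nat) (t : n.+1.-tuple G).

Definition face_first : n.-tuple G := [tuple tnth t (lift ord0 j) | j < n].
Definition face_last : n.-tuple G :=
  [tuple tnth t (widen_ord (leqnSn n) j) | j < n].
(* (g_0, ..., g_i * g_(i+1), ..., g_n) *)
Definition face_mul (i : 'I_n) : n.-tuple G :=
  [tuple if (j < i)%N then tnth t (widen_ord (leqnSn n) j)
         else if j == i
         then (tnth t (widen_ord (leqnSn n) j) * tnth t (lift ord0 j))%g
         else tnth t (lift ord0 j) | j < n].
End Faces.

Definition cobound n (f : cochain n) : cochain n.+1 :=
  [ffun t : n.+1.-tuple G =>
     gm_act (thead t) (f (face_first t))
     + \sum_(i < n) f (face_mul t i) *~ (-1) ^+ i.+1
     + f (face_last t) *~ (-1) ^+ n.+1].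

Fact cobound_is_zmod_morphism n : zmod_morphism (@cobound n).
Proof.
move=> f h; apply/ffunP=> t; rewrite !ffunE raddfB mulrzBl.
have -> : \sum_(i < n) (f - h) (face_mul t i) *~ (-1) ^+ i.+1 =
  \sum_(i < n) f (face_mul t i) *~ (-1) ^+ i.+1
  - \sum_(i < n) h (face_mul t i) *~ (-1) ^+ i.+1.
  by rewrite -sumrB; apply: eq_bigr => i _; rewrite !ffunE mulrzBl.
rewrite [X in X + _]addrACA [LHS]addrACA -!opprD.
by rewrite ?ffunE ?mulrzBl.
Qed.
HB.instance Definition _ n :=
  GRing.isZmodMorphism.Build (cochain n) (cochain n.+1) (@cobound n)
    (@cobound_is_zmod_morphism n).

Definition cocycle n : {pred cochain n} := fun f => cobound f == 0.
Fact cocycle_zmod_closed n : zmod_closed (@cocycle n).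
Proof.
split=> [|f h /eqP df /eqP dh]; rewrite unfold_in; first by rewrite raddf0.
by rewrite raddfB /= df dh subr0.
Qed.
HB.instance Definition _ n :=
  GRing.isZmodClosed.Build (cochain n) (@cocycle n) (@cocycle_zmod_closed n).

Definition is_coboundary n : cochain n -> Prop :=
  match n with
  | 0 => fun f => f = 0
  | n'.+1 => fun f => exists h : cochain n', f = cobound h
  end.

Record cocycles n := Cocycle { cocycle_val :> cochain n;
                               _ : cocycle_val \in @cocycle n }.
HB.instance Definition _ n := [isSub for @cocycle_val n].
HB.instance Definition _ n := [Choice of cocycles n by <:].
HB.instance Definition _ n := [SubChoice_isSubZmodule of cocycles n by <:].

Definition coboundary n : {pred cocycles n} :=
  fun z => `[< is_coboundary (val z) >].
Fact coboundary_zmod_closed n : zmod_closed (@coboundary n).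
Proof.
case: n => [|n]; split.
- by apply/asboolP; rewrite /is_coboundary raddf0.
- move=> x y /asboolP /= x0 /asboolP /= y0; apply/asboolP.
  by rewrite /is_coboundary raddfB /= x0 y0 subr0.
- by apply/asboolP; exists 0; rewrite !raddf0.
- move=> x y /asboolP[f xf] /asboolP[h yh]; apply/asboolP.
  by exists (f - h); rewrite [LHS]raddfB [RHS]raddfB /= -xf -yh.
Qed.
HB.instance Definition _ n :=
  GRing.isZmodClosed.Build (cocycles n) (@coboundary n)
    (@coboundary_zmod_closed n).

Definition cohomology n : zmodType := Quotient.quot (@coboundary n).

(* The action of G on its own cohomology: (g f)(x_1, ..., x_n) is
   g f(g^-1 x_1 g, ..., g^-1 x_n g), that is g f(x_1, ..., x_n) when G is
   commutative. *)
Definition conj_tuple n (g : G) (t : n.-tuple G) : n.-tuple G :=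
  [tuple (tnth t j ^ g)%g | j < n].

Definition cochain_act n (g : G) (f : cochain n) : cochain n :=
  [ffun t : n.-tuple G => gm_act g (f (conj_tuple g t))].

Fact cochain_act_is_zmod_morphism n g : zmod_morphism (@cochain_act n g).
Proof. by move=> f h; apply/ffunP=> t; rewrite !ffunE raddfB. Qed.
HB.instance Definition _ n g :=
  GRing.isZmodMorphism.Build (cochain n) (cochain n) (@cochain_act n g)
    (@cochain_act_is_zmod_morphism n g).

Lemma cobound_act n g (f : cochain n) :
  cobound (cochain_act g f) = cochain_act g (cobound f).
Proof.
apply/ffunP=> t; rewrite !ffunE !raddfD raddfMz raddf_sum -gm_actM.
congr (_ + _ + _ *~ _).
- have -> : thead (conj_tuple g t) = (thead t ^ g)%g.
    by rewrite /thead tnth_mktuple.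
  rewrite [RHS]/= -gm_actM -conjgC; congr (gm_act _ (f _)).
  by apply: eq_from_tnth => j; rewrite !tnth_mktuple.
- apply: eq_bigr => i _; rewrite ffunE raddfMz; congr (gm_act _ (f _) *~ _).
  apply: eq_from_tnth => j; rewrite !tnth_mktuple.
  by case: ifP => // _; case: ifP => // _; rewrite conjMg.
- congr (gm_act _ (f _)).
  by apply: eq_from_tnth => j; rewrite !tnth_mktuple.
Qed.

Fact cocycle_act_subproof n g (z : cocycles n) :
  cochain_act g (val z) \in @cocycle n.
Proof.
by rewrite unfold_in cobound_act; case: z => z /= /eqP->; rewrite raddf0.
Qed.
Definition cocycle_act n g (z : cocycles n) : cocycles n :=
  Cocycle (cocycle_act_subproof g z).

Definition coh_class n (z : cocycles n) : cohomology n :=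
  \pi_(Quotient.quot (@coboundary n)) z.

Definition coh_act n (g : G) (x : cohomology n) : cohomology n :=
  coh_class (cocycle_act g (generic_quotient.repr x)).

Lemma coh_actE n g (z : cocycles n) :
  coh_act g (coh_class z) = coh_class (cocycle_act g z).
Proof.
apply/eqP; rewrite -Quotient.idealrBE; apply/asboolP.
have : generic_quotient.repr (coh_class z) - z \in @coboundary n.
  by rewrite Quotient.idealrBE reprK.
move/asboolP; rewrite !raddfB /= -raddfB.
move: (_ - _) => f {z}; case: n f => [|n] f /=.
  by move->; rewrite raddf0.
by case=> h ->; exists (cochain_act g h); rewrite cobound_act.
Qed.

End Cohomology.

(* The residue k : 'Z_m stands for the element k/m of (1/m)Z/Z, so that
   (n/m)Z/Z is the set of multiples of n, for n dividing m.  This requires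
   1 < m.  If n divides m and a lies in (1/m)Z/Z with a in (n/m)Z/Z, every b in
   Q/Z such that nb = a already lies in (1/m)Z/Z. *)
Section Distributions.
Variable m : nat.

Definition symbols : zmodType := {ffun 'Z_m -> int}.
Definition symbol (a : 'Z_m) : symbols := [ffun x => (x == a)%:R].

Definition distribution_rel (x : symbols) : Prop :=
  exists (n : nat) (a : 'Z_m),
    [/\ (n %| m)%N, exists k : 'Z_m, a = k *+ n
      & x = symbol a - \sum_(b : 'Z_m | b *+ n == a) symbol b].

Definition predistribution_rel (x : symbols) : Prop :=
  exists (n : nat) (a : 'Z_m),
    [/\ (n %| m)%N, (1 < n)%N, exists k : 'Z_m, a = k *+ n
      & x = \sum_(b : 'Z_m | b *+ n == a) symbol b].

(* The additive endomorphism [a] |-> [-a]. *)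
Definition symbols_opp (x : symbols) : symbols := [ffun a => x (- a)].
Fact symbols_opp_is_zmod_morphism : zmod_morphism symbols_opp.
Proof. by move=> x y; apply/ffunP=> a; rewrite !ffunE. Qed.
HB.instance Definition _ :=
  GRing.isZmodMorphism.Build symbols symbols symbols_opp
    symbols_opp_is_zmod_morphism.

Lemma symbols_oppK : involutive symbols_opp.
Proof. by move=> x; apply/ffunP=> a; rewrite !ffunE opprK. Qed.

Lemma symbols_oppE a : symbols_opp (symbol a) = symbol (- a).
Proof. by apply/ffunP=> x; rewrite !ffunE eqr_oppLR. Qed.

Lemma symbols_opp_fiber n a :
  symbols_opp (\sum_(b : 'Z_m | b *+ n == a) symbol b)
  = \sum_(b : 'Z_m | b *+ n == - a) symbol b.
Proof.
rewrite raddf_sum /= [RHS](reindex_inj (@oppr_inj _)) /=.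
by apply: eq_big => [b|b _]; rewrite ?symbols_oppE // mulNrn eqr_opp.
Qed.

Lemma distribution_rel_opp x :
  distribution_rel x -> distribution_rel (symbols_opp x).
Proof.
case=> n [a [nm [k ak] ->]]; exists n, (- a); split=> //.
  by exists (- k); rewrite ak mulNrn.
by rewrite raddfB /= symbols_oppE symbols_opp_fiber.
Qed.

Lemma predistribution_rel_opp x :
  predistribution_rel x -> predistribution_rel (symbols_opp x).
Proof.
case=> n [a [nm n1 [k ak] ->]]; exists n, (- a); split=> //.
  by exists (- k); rewrite ak mulNrn.
by rewrite symbols_opp_fiber.
Qed.

(* J is 'Z_2 viewed as a multiplicative group, with 1%g = 0 and c = 1%R. *)
Section Quotient.
Variables (S : symbols -> Prop).
Hypothesis S_opp : forall x, S x -> S (symbols_opp x).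

Let Q : zmodType := Quotient.quot (zspan S).

Let proj (x : symbols) : Q := \pi_(Quotient.quot (zspan S)) x.

Definition quot_opp (x : Q) : Q :=
  proj (symbols_opp (generic_quotient.repr x)).

Lemma quot_oppE x : quot_opp (proj x) = proj (symbols_opp x).
Proof.
apply/eqP; rewrite -Quotient.idealrBE -raddfB.
by apply: (zspan_stable S_opp); rewrite Quotient.idealrBE reprK.
Qed.

Definition quot_act (g : 'Z_2) (x : Q) : Q := if g == 0 then x else quot_opp x.

Lemma projD x y : proj (x + y) = proj x + proj y.
Proof. exact: Quotient.pi_add. Qed.

Fact quot_actD g x y : quot_act g (x + y) = quot_act g x + quot_act g y.
Proof.
rewrite /quot_act; case: ifP => // _.
elim/quotW: x => x; elim/quotW: y => y.
rewrite -[LHS]/(quot_opp (proj x + proj y)) -projD !quot_oppE raddfD.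
exact: projD.
Qed.

Fact quot_act1 x : quot_act 1%g x = x. Proof. by []. Qed.

Fact quot_actM (g h : 'Z_2) x :
  quot_act (g * h)%g x = quot_act g (quot_act h x).
Proof.
case: g => [[|[|//]] ?]; case: h => [[|[|//]] ?]; rewrite /quot_act //=.
elim/quotW: x => x; rewrite -[X in quot_opp (quot_opp X)]/(proj x).
by rewrite !quot_oppE symbols_oppK.
Qed.

Definition quot_gmodule : gmodule 'Z_2 :=
  GModule quot_actD quot_act1 quot_actM.
End Quotient.

Definition univ_distribution : gmodule 'Z_2 :=
  quot_gmodule distribution_rel_opp.
Definition univ_predistribution : gmodule 'Z_2 :=
  quot_gmodule predistribution_rel_opp.
End Distributions.

(* Main.v *)
Require Import Defs.
From HB Require Import structures.
From mathcomp Require Import all_boot all_order all_fingroup all_algebra.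
From mathcomp Require Import cyclic boolp ring zify.

(* The relations of U_m and O_m for prime n imply the others.

   For U_m, let G = (Z/m)^* be the product of the groups G_p of units with
   component 1 away from p, and N_p the sum of the elements of G_p.  As in the
   work of Sinnott, U_m is isomorphic to the ideal of Z[G] that is the product
   over the primes p | m of the ideals (n_p N_p, n_p - N_p + h_p N_p), where
   n_p = #G_p and h_p = Fr_p^e - Fr_p^(e-1) comes from the difference of the
   relations for p^e and p^(e-1), p^e being the p-part of m.  Such products are
   induced modules for the subgroups K of G that meet trivially the product of
   the groups G_p of the primes already used; in particular J acts on them with
   trivial cohomology as long as one prime is unused.  Adding the prime p to a
   product L gives an extension of L / N_p L by N_p L.  The connecting map of
   its cohomology is multiplication by h_p, and it vanishes because G acts
   trivially on the cohomology of N_p L: for t in G_q and a used prime q, the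
   endomorphism t - 1 of a product factors through the acyclic module obtained
   by omitting q.  Hence both cohomology groups of the new product have the
   total dimension of those of N_p L, and each further prime doubles it.

   For O_m, an odd prime p | m gives an additive h with h + c h c = 1, a choice
   of half of the symbols; for m = 2^k the same choice fails exactly on [0] and
   [1/4], on which c acts by 1 and -1. *)

(** The idempotent N_p / n_p is not integral, so the factor at p is scaled by n_p; the second
    generator b_p = n_p - N_p + h_p N_p then acts on N_p L as n_p h_p. For the new product D,
    multiplication by b_p identifies L / N_p L with D / n_p N_p L. As L is acyclic, a class y of L /
    N_p L is seen through y - c y in N_p L, with the degree shifted by one; hence both parities are
    carried through the induction. It starts from the product of all norms, a copy of Z with trivial
    action, of ranks 1 and 0; the first full factor gives 1 and 1, whence the exponent r - 1. The
    embedding of U_m is a Stickelberger map, defined on symbols prime by prime. Symbols with each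
    component 0 or a unit span U_m, and exactness of the norm on induced modules turns every linear
    relation among their images into distribution relations. All of this takes place in the monoid
    ring of Z/m, which holds symbols, units and idempotents at once. *)

Set Implicit Arguments.
Unset Strict Implicit.
Unset Printing Implicit Defensive.
Import GRing.Theory.
Local Open Scope ring_scope.

(** * Cohomology of the group of order two *)

(* Used with s the action of c for H^2 and its opposite for H^1. *)
Definition tate_basis (V : zmodType) (s : V -> V) (L : V -> Prop)
    (I : finType) : Prop :=
  exists v : I -> V,
    [/\ forall i, L (v i) /\ s (v i) = v i,
        forall z, L z -> s z = z ->
          exists (A : {set I}) (x : V), L x /\ z = \sum_(i in A) v i + (x + s x)
      & forall (A : {set I}) (x : V), L x ->
          \sum_(i in A) v i = x + s x -> A = set0].

Lemma zmod_iso_sym (A B : zmodType) : zmod_iso A B -> zmod_iso B A.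
Proof.
case=> f [g fK gK].
have gB : zmod_morphism g.
  by move=> x y; apply: (can_inj fK); rewrite raddfB !gK.
pose gA := GRing.isZmodMorphism.Build _ _ g gB.
pose G : {additive B -> A} := HB.pack g gA.
by exists G; exists f.
Qed.

Lemma zmod_iso_trans (A B C : zmodType) :
  zmod_iso A B -> zmod_iso B C -> zmod_iso A C.
Proof.
case=> f bf [g bg]; exists (g \o f : {additive A -> C}).
exact: bij_comp bg bf.
Qed.

Lemma F2_cases (x : 'Z_2) : x = 0 \/ x = 1.
Proof.
by case: x => [[|[|//]] ?]; [left|right]; apply: val_inj.
Qed.

(** Subsets of [I] play the role of coefficient vectors over F_2, so independence is asked only of
    sums equal to 0: additivity of the map from rows reduces injectivity to its kernel. *)
Lemma zmod_iso_rV (H : zmodType) (I : finType) (w : I -> H) :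
    (forall i, w i *+ 2 = 0) ->
    (forall x, exists A : {set I}, x = \sum_(i in A) w i) ->
    (forall A : {set I}, \sum_(i in A) w i = 0 -> A = set0) ->
  zmod_iso H 'rV['Z_2]_#|I|.
Proof.
move=> w2 gen ind; apply: zmod_iso_sym.
pose f (a : 'rV['Z_2]_#|I|) := \sum_i w i *+ (a 0 (enum_rank i) : nat).
have fB : zmod_morphism f.
  move=> a b; rewrite /f -sumrB; apply: eq_bigr => i _; rewrite !mxE.
  have [-> | ->] := F2_cases (a 0 (enum_rank i));
    have [-> | ->] := F2_cases (b 0 (enum_rank i));
    rewrite ?subr0 ?subrr //=.
  by rewrite !mulr0n sub0r -[RHS]addr0 -[in RHS](w2 i) mulr2n addrA addNr add0r.
have fE a : f a = \sum_(i in [set i | a 0 (enum_rank i) == 1]) w i.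
  rewrite /f big_mkcond [RHS]big_mkcond; apply: eq_bigr => i _; rewrite inE /=.
  by have [-> | ->] := F2_cases (a 0 (enum_rank i)).
pose fA := GRing.isZmodMorphism.Build _ _ f fB.
pose F : {additive 'rV['Z_2]_#|I| -> H} := HB.pack f fA.
have Finj : injective F.
  apply: raddf_inj => a /=; rewrite fE => /ind /setP a0.
  apply/rowP => i; rewrite mxE.
  have := a0 (enum_val i); rewrite !inE enum_valK.
  by have [-> | ->] := F2_cases (a 0 i).
have Fsur x : exists a, F a == x.
  have [A ->] := gen x.
  exists (\row_j (enum_val j \in A)%:R); apply/eqP; rewrite /= fE.
  apply: eq_bigl => i; rewrite inE mxE enum_rankK.
  by case: (i \in A).
exists F; exists (fun x => xchoose (Fsur x)) => [a | x].
  by apply: Finj; apply/eqP/(xchooseP (Fsur (F a))).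
by apply/eqP/(xchooseP (Fsur x)).
Qed.

Lemma zmod_iso_Z2 (H : zmodType) : zmod_iso H 'rV['Z_2]_1 -> zmod_iso H 'Z_2.
Proof.
move=> iH; apply: (zmod_iso_trans iH).
pose f (a : 'rV['Z_2]_1) := a 0 0.
have fB : zmod_morphism f by move=> a b; rewrite /f !mxE.
pose fA := GRing.isZmodMorphism.Build _ _ f fB.
pose F : {additive 'rV['Z_2]_1 -> 'Z_2} := HB.pack f fA.
exists F; exists (fun x => const_mx x) => [a | x] /=; last by rewrite /f mxE.
by apply/rowP=> i; rewrite mxE ord1.
Qed.

Section Z2Cohomology.
Variable M : gmodule 'Z_2.
Notation c := (@gm_act 'Z_2 M 1%R).

Let c0 x : gm_act (0%R : 'Z_2) x = x :> M.
Proof. exact: gm_act1. Qed.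
Let cc x : c (c x) = x.
Proof. by rewrite -gm_actM -[RHS]gm_act1; congr (gm_act _ _); apply: val_inj. Qed.
Let cD x y : c (x + y) = c x + c y. Proof. exact: gm_actD. Qed.
Let cN x : c (- x) = - c x. Proof. exact: (raddfN (gm_act (1%R : 'Z_2))). Qed.
Let c_0 : c 0 = 0. Proof. exact: (raddf0 (gm_act (1%R : 'Z_2))). Qed.
Let cB x y : c (x - y) = c x - c y. Proof. by rewrite cD cN. Qed.

Lemma cobound0E (f : cochain M 0) (g : 'Z_2) :
  cobound f [tuple g] = gm_act g (f [tuple]) - f [tuple].
Proof.
rewrite ffunE big_ord0 addr0 expr1 mulrN1z.
by congr (gm_act _ (f _) - f _); apply: eq_from_tnth => -[].
Qed.

Lemma cobound1E (f : cochain M 1) (g h : 'Z_2) :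
  cobound f [tuple g; h] =
  gm_act g (f [tuple h]) - f [tuple g + h] + f [tuple g].
Proof.
rewrite ffunE big_ord_recl big_ord0 addr0.
rewrite expr1 mulrN1z expr2 mulrNN mulr1 mulr1z.
by congr (gm_act _ (f _) - f _ + f _);
  apply: eq_from_tnth => j; rewrite tnth_mktuple ord1.
Qed.

Lemma cobound2E (f : cochain M 2) (g h k : 'Z_2) :
  cobound f [tuple g; h; k] =
  gm_act g (f [tuple h; k]) - f [tuple g + h; k] + f [tuple g; h + k]
    - f [tuple g; h].
Proof.
rewrite ffunE !big_ord_recl big_ord0 addr0.
rewrite !exprS expr0 !mulr1 !mulN1r !opprK mulrN1z mulr1z mulrN1z !addrA.
by congr (gm_act _ (f _) - f _ + f _ - f _);
  apply: eq_from_tnth => -[[|[|//]] ?]; rewrite tnth_mktuple.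
Qed.

Lemma tuple1E (t : 1.-tuple 'Z_2) : t = [tuple tnth t 0].
Proof. by apply: eq_from_tnth => j; rewrite ord1. Qed.
Lemma tuple2E (t : 2.-tuple 'Z_2) : t = [tuple tnth t 0; tnth t 1].
Proof.
by apply: eq_from_tnth => -[[|[|//]] ?]; rewrite (tnth_nth 0) (tnth_nth 0) /=
  (tnth_nth 0).
Qed.
Lemma tuple3E (t : 3.-tuple 'Z_2) : t = [tuple tnth t 0; tnth t 1; tnth t 2].
Proof.
by apply: eq_from_tnth => -[[|[|[|//]]] ?]; rewrite (tnth_nth 0) (tnth_nth 0) /=
  (tnth_nth 0).
Qed.

Definition cochain1 (x : M) : cochain M 1 :=
  [ffun t : 1.-tuple 'Z_2 => if tnth t 0 == 0 then 0 else x].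

Lemma cochain1_is_zmod_morphism : zmod_morphism cochain1.
Proof.
by move=> x y; apply/ffunP=> /= t; rewrite !ffunE; case: ifP; rewrite ?subr0.
Qed.
HB.instance Definition _ :=
  GRing.isZmodMorphism.Build M (cochain M 1) cochain1 cochain1_is_zmod_morphism.

Lemma cobound_cochain1 x : cobound (cochain1 x) = 0 <-> x + c x = 0.
Proof.
split=> [/ffunP/(_ [tuple 1; 1]) | xc].
  by rewrite cobound1E !ffunE /= subr0 addrC.
apply/ffunP=> /= t; rewrite (tuple2E t) cobound1E !ffunE /=.
have [-> | ->] := F2_cases (tnth t 0); have [-> | ->] := F2_cases (tnth t 1);
  rewrite ?c0 ?c_0 /= ?subr0 ?addr0 ?subrr ?sub0r ?addNr //.
by rewrite addrC.
Qed.

(** The identity at (0, 0) forces the value at the neutral element to vanish, so only the value at c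
    is left. *)
Lemma cocycle1E (f : cochain M 1) :
  cobound f = 0 -> f = cochain1 (f [tuple 1]).
Proof.
move/ffunP/(_ [tuple 0; 0]); rewrite cobound1E ffunE c0 addr0 subrr add0r => f0.
apply/ffunP=> /= t; rewrite (tuple1E t) ffunE /=.
by have [-> | ->] := F2_cases (tnth t 0).
Qed.

Lemma coboundary1P x : is_coboundary (cochain1 x) <-> exists y, x = c y - y.
Proof.
split=> [[h /ffunP/(_ [tuple 1])] | [y ->]].
  by rewrite cobound0E ffunE /= => ->; exists (h [tuple]).
exists [ffun _ => y]; apply/ffunP=> /= t; rewrite (tuple1E t) cobound0E !ffunE /=.
by have [-> | ->] := F2_cases (tnth t 0); rewrite /= ?c0 ?subrr.
Qed.

Definition cochain2 (x : M) : cochain M 2 :=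
  [ffun t : 2.-tuple 'Z_2 => if (tnth t 0 == 0) || (tnth t 1 == 0) then 0
                            else x].

Lemma cochain2_is_zmod_morphism : zmod_morphism cochain2.
Proof.
by move=> x y; apply/ffunP=> /= t; rewrite !ffunE; case: ifP; rewrite ?subr0.
Qed.
HB.instance Definition _ :=
  GRing.isZmodMorphism.Build M (cochain M 2) cochain2 cochain2_is_zmod_morphism.

Lemma cobound_cochain2 x : cobound (cochain2 x) = 0 <-> c x = x.
Proof.
split=> [/ffunP/(_ [tuple 1; 1; 1]) | cx].
  rewrite cobound2E !ffunE /= subr0 addr0 => /eqP.
  by rewrite subr_eq0 => /eqP.
apply/ffunP=> /= t; rewrite (tuple3E t) cobound2E !ffunE /=.
have [-> | ->] := F2_cases (tnth t 0); have [-> | ->] := F2_cases (tnth t 1);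
 have [-> | ->] := F2_cases (tnth t 2);
  rewrite /= ?c0 ?c_0 ?cx /= ?oppr0 ?addr0 ?add0r ?subrr ?addNr //=.
Qed.

(** Normalisation: the constant 1-cochain [u], with [u] the value at (0, 0), has coboundary [g u] at
    (g, k). Subtracting it clears every value with a neutral argument. *)
Lemma cocycle2E (f : cochain M 2) :
  cobound f = 0 -> exists x (h : cochain M 1), f = cochain2 x + cobound h.
Proof.
move=> fz; pose u := f [tuple 0; 0]; pose h : cochain M 1 := [ffun _ => u].
have hE g k : cobound h [tuple g; k] = gm_act g u.
  by rewrite cobound1E !ffunE subrK.
exists ((f - cobound h) [tuple 1; 1]), h; apply/eqP; rewrite -subr_eq; apply/eqP.
have /ffunP dE : cobound f = 0 := fz.
have f01 : f [tuple 0; 1] = u.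
  have /ffunP/(_ [tuple 0; 0; 1]) := fz.
  rewrite cobound2E ffunE c0 !add0r subrr add0r => /eqP.
  by rewrite subr_eq0 => /eqP.
have f10 : f [tuple 1; 0] = c u.
  have /ffunP/(_ [tuple 1; 0; 0]) := fz.
  rewrite cobound2E ffunE !addr0 subrK => /eqP.
  by rewrite subr_eq0 => /eqP.
have fBE g k : (f - cobound h) [tuple g; k] = f [tuple g; k] - gm_act g u.
  by rewrite -(hE g k) [LHS]ffunE; congr (_ + _); rewrite [LHS]ffunE.
apply/ffunP=> /= t; rewrite (tuple2E t) [RHS]ffunE !fBE.
have [-> | ->] := F2_cases (tnth t 0); have [-> | ->] := F2_cases (tnth t 1);
  by rewrite /= ?c0 ?f01 ?f10 ?subrr.
Qed.

Lemma cobound_cobound1 (h : cochain M 1) : cobound (cobound h) = 0.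
Proof.
apply/ffunP=> /= t; rewrite (tuple3E t) cobound2E !cobound1E ffunE.
have actE x : gm_act (tnth t 0) (gm_act (tnth t 1) x) =
    gm_act (tnth t 0 + tnth t 1) x :> M by rewrite -gm_actM.
rewrite !raddfD !raddfN /= addrA.
rewrite actE !opprK !addrA.
rewrite [LHS](ACl (1*4*(2*7)*(3*10)*(5*8)*(6*11)*(9*12))%AC) /=.
by rewrite !subrr !addNr !addr0.
Qed.

Lemma coboundary2P x :
  is_coboundary (cochain2 x) <-> exists y, x = y + c y.
Proof.
split=> [[h /ffunP hx] | [y ->]].
  (* The 1-cochain [h] vanishes at the neutral element, so its coboundary at (c, c) is the norm of
     its value at c. *)
  have := hx [tuple 0; 0]; rewrite cobound1E ffunE c0 /= addr0 subrr add0r => h0.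
  have := hx [tuple 1; 1]; rewrite cobound1E ffunE /=.
  have -> : 1 + 1 = 0 :> 'Z_2 by apply: val_inj.
  by rewrite -h0 subr0 addrC => ->; exists (h [tuple 1]).
exists (cochain1 y); apply/ffunP=> /= t; rewrite (tuple2E t) cobound1E !ffunE /=.
have [-> | ->] := F2_cases (tnth t 0); have [-> | ->] := F2_cases (tnth t 1);
  rewrite ?c0 ?c_0 /= ?subr0 ?addr0 ?subrr ?sub0r ?addNr //.
by rewrite addrC.
Qed.

Lemma coh_classD n (x y : cocycles M n) :
  coh_class (x + y) = coh_class x + coh_class y.
Proof. exact: Quotient.pi_add. Qed.

Lemma eq_coh_class n (x y : cocycles M n) :
  coh_class x = coh_class y <-> is_coboundary (val x - val y).
Proof.
rewrite -[_ - _]raddfB; split=> [/eqP | b].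
  by rewrite -Quotient.idealrBE => /asboolP.
by apply/eqP; rewrite -Quotient.idealrBE; apply/asboolP.
Qed.

Lemma coh_classW n (P : cohomology M n -> Prop) :
  (forall z, P (coh_class z)) -> forall x, P x.
Proof. by move=> Pz x; elim/quotW: x. Qed.

Lemma coh_class0 n : coh_class (0 : cocycles M n) = 0.
Proof. by apply: (@addrI _ (coh_class 0)); rewrite -coh_classD !addr0. Qed.

Lemma coh_class_sum n (I : finType) (A : {set I}) (z : I -> cocycles M n) :
  coh_class (\sum_(i in A) z i) = \sum_(i in A) coh_class (z i).
Proof. exact: (big_morph _ (@coh_classD n) (coh_class0 n)). Qed.

Lemma is_coboundaryB n (f h : cochain M n) :
  is_coboundary f -> is_coboundary h -> is_coboundary (f - h).
Proof.
case: n f h => [|n] f h /=; first by move=> -> ->; rewrite subrr.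
by case=> f' -> [h' ->]; exists (f' - h'); rewrite raddfB.
Qed.

(** Both degrees at once, by periodicity: with [s] equal to c in degree 2 and to -c in degree 1,
    cohomology is the fixed elements of [s] modulo the elements [y + s y], and [k] makes a
    normalised cocycle out of a fixed element. *)
Lemma cohomology_iso n (s : M -> M) (k : {additive M -> cochain M n})
    (I : finType) :
    (forall x, s (- x) = - s x) ->
    (forall x, s x = x -> cobound (k x) = 0) ->
    (forall f : cochain M n, cobound f = 0 ->
       exists2 x, s x = x & is_coboundary (f - k x)) ->
    (forall x, is_coboundary (k x) <-> exists y, x = y + s y) ->
    tate_basis s (fun _ => True) I ->
  zmod_iso (cohomology M n) 'rV['Z_2]_#|I|.
Proof.
move=> sN kz zk bk [v [/(fun sv i => proj2 (sv i)) sv gen ind]].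
have vP i : k (v i) \in @cocycle _ M n by rewrite unfold_in; apply/eqP/kz.
pose z i : cocycles M n := Cocycle (vP i).
have sumE (A : {set I}) : val (\sum_(i in A) z i) = k (\sum_(i in A) v i).
  by rewrite !raddf_sum; apply: eq_bigr.
apply: (@zmod_iso_rV _ _ (fun i => coh_class (z i))) => [i | x | A].
- rewrite mulr2n -coh_classD -coh_class0; apply/eq_coh_class.
  rewrite [val 0]raddf0 subr0 [val _]raddfD /= -raddfD; apply/bk; exists (v i).
  by rewrite sv.
- elim/coh_classW: x => -[f fP].
  have /zk[x sx bx] : cobound f = 0 by apply/eqP.
  have [A [y [_ xE]]] := gen x Logic.I sx; exists A.
  rewrite -coh_class_sum; apply/eq_coh_class; rewrite sumE /=.
  have -> : k (\sum_(i in A) v i) = k x - k (y + s y).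
    by rewrite xE [k (_ + (y + _))]raddfD addrK.
  rewrite opprB [_ - k x]addrC addrA -[k (y + s y)]opprK.
  by apply: is_coboundaryB => //; rewrite -raddfN; apply/bk; exists (- y);
     rewrite sN opprD.
rewrite -coh_class_sum -coh_class0 => /eq_coh_class.
by rewrite [val 0]raddf0 subr0 sumE => /bk[y yE]; apply: (ind A y).
Qed.

Lemma cohomology1_iso (I : finType) :
  tate_basis (fun x => - c x) (fun _ => True) I ->
  zmod_iso (cohomology M 1) 'rV['Z_2]_#|I|.
Proof.
apply: (@cohomology_iso 1 _ cochain1) => [x | x xE | f fz | x].
- by rewrite cN.
- by apply/cobound_cochain1; rewrite -[X in X + _]xE addNr.
- exists (f [tuple 1]).
    have /eqP : f [tuple 1] + c (f [tuple 1]) = 0.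
      by apply/cobound_cochain1; rewrite -cocycle1E.
    by rewrite addr_eq0 => /eqP {2}->.
  by exists 0; rewrite raddf0 {1}(cocycle1E fz) subrr.
split=> [/coboundary1P[y ->] | [y ->]].
  by exists (- y); rewrite cN opprK addrC.
by apply/coboundary1P; exists (- y); rewrite cN opprK addrC.
Qed.

Lemma cohomology2_iso (I : finType) :
  tate_basis c (fun _ => True) I ->
  zmod_iso (cohomology M 2) 'rV['Z_2]_#|I|.
Proof.
apply: (@cohomology_iso 2 _ cochain2) => [x | x xE | f fz | x].
- exact: cN.
- by apply/cobound_cochain2.
- have [x [h fE]] := cocycle2E fz; exists x.
    apply/cobound_cochain2; rewrite -fz fE raddfD /=.
    by rewrite cobound_cobound1 addr0.
  by exists h; rewrite fE addrC addKr.
exact: coboundary2P.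
Qed.

Lemma cochain_actE n (g : 'Z_2) (f : cochain M n) t :
  cochain_act g f t = gm_act g (f t).
Proof.
rewrite ffunE; congr (gm_act g (f _)); apply: eq_from_tnth => j.
rewrite tnth_mktuple; case: (F2_cases g) => ->; first exact: conjg1.
by case: (F2_cases (tnth t j)) => ->; apply: val_inj.
Qed.

(** J is commutative, so it acts through the coefficients alone. In degree 1 the cocycle with value
    x changes by [c x - x], a coboundary; in degree 2 the value x is fixed by c and the remaining
    coboundary goes to a coboundary. *)
Lemma coh_act_trivial i : i = 1%N \/ i = 2%N ->
  forall (g : 'Z_2) (x : cohomology M i), coh_act g x = x.
Proof.
move=> i12 g; elim/coh_classW => -[f fP]; rewrite coh_actE.
apply/eq_coh_class => /=.
have {fP} /eqP fz := fP.
have [-> | ->] := F2_cases g.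
  have -> : cochain_act (0%R : 'Z_2) f = f.
    by apply/ffunP => t; rewrite cochain_actE c0.
  by rewrite subrr; case: i12 f {fz} => -> f; exists 0; rewrite raddf0.
case: i12 f fz => -> f fz.
  have := fz; rewrite (cocycle1E fz); set x := f _.
  move/cobound_cochain1/eqP; rewrite addr_eq0 => /eqP xE.
  rewrite (_ : cochain_act _ _ = cochain1 (c x)); last first.
    by apply/ffunP=> t; rewrite cochain_actE !ffunE; case: ifP.
  by rewrite -raddfB; apply/coboundary1P; exists x.
have [x [h fE]] := cocycle2E fz; rewrite fE raddfD /= -cobound_act.
have cx : c x = x.
  by apply/cobound_cochain2; rewrite -fz fE raddfD /= cobound_cobound1 addr0.
rewrite (_ : cochain_act _ _ = cochain2 x); last first.
  by apply/ffunP=> t; rewrite cochain_actE !ffunE; case: ifP.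
exists (cochain_act (1%R : 'Z_2) h - h).
by rewrite [RHS]raddfB opprD addrACA subrr add0r.
Qed.

End Z2Cohomology.

(** * Lattices in a commutative ring with a finite group of units *)

Section Lattices.
Variables (R : comNzRingType) (gT : finGroupType) (tau : gT -> R).
Hypothesis tfR : forall (x : R) n, (0 < n)%N -> x *+ n = 0 -> x = 0.
Hypothesis cgT : forall g h : gT, commute g h.
Hypothesis tau1 : tau 1%g = 1.
Hypothesis tauM : forall g h, tau (g * h)%g = tau g * tau h.

Definition lattice (L : R -> Prop) : Prop :=
  [/\ L 0, forall x y, L x -> L y -> L (x - y)
    & forall g x, L x -> L (tau g * x)].

Definition subgroup_pred (L : R -> Prop) : Prop :=
  L 0 /\ forall x y, L x -> L y -> L (x - y).

Lemma lattice_subgroup L : lattice L -> subgroup_pred L.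
Proof. by case. Qed.

Lemma subgroup_predN L x : subgroup_pred L -> L x -> L (- x).
Proof. by case=> L0 LB Lx; rewrite -sub0r; apply: LB. Qed.

Lemma subgroup_predD L x y : subgroup_pred L -> L x -> L y -> L (x + y).
Proof.
move=> sL Lx Ly; rewrite -[y]opprK.
by case: (sL) => _; apply => //; apply: subgroup_predN.
Qed.

Lemma subgroup_predB L x y : subgroup_pred L -> L x -> L y -> L (x - y).
Proof. by case=> _; apply. Qed.

Lemma subgroup_pred_sum L (I : finType) (P : pred I) (F : I -> R) :
  subgroup_pred L -> (forall i, P i -> L (F i)) -> L (\sum_(i | P i) F i).
Proof.
move=> sL LF; elim/big_ind: _ => //; first by case: sL.
by move=> x y; apply: subgroup_predD.
Qed.

Lemma subgroup_predMz L x n : subgroup_pred L -> L x -> L (x *~ n).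
Proof.
move=> sL Lx; have Ln k : L (x *+ k).
  elim: k => [|k IH]; first by rewrite mulr0n; case: sL.
  by rewrite mulrS; apply: subgroup_predD.
by case: n => n; rewrite ?NegzE ?mulrNz -pmulrn //; apply: subgroup_predN.
Qed.

Definition orbsum (H : {group gT}) : R := \sum_(t in H) tau t.

Lemma tau_orbsum (H : {group gT}) t : t \in H -> tau t * orbsum H = orbsum H.
Proof.
move=> tH; rewrite /orbsum big_distrr /=.
rewrite [RHS](reindex_inj (mulgI t)) /=; apply: eq_big => [g | g _].
  by rewrite groupMl.
by rewrite tauM.
Qed.

Lemma orbsum_sqr (H : {group gT}) : orbsum H * orbsum H = orbsum H * #|H|%:R.
Proof.
rewrite mulr_natr {1}/orbsum big_distrl /= -sumr_const.
by apply: eq_bigr => t /tau_orbsum.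
Qed.

(** L is the direct sum of the translates of [L1] by K, that is, an induced Z[K]-module. Coefficient
    functions live on all of [gT] to avoid a subtype for K; only their values on K count. *)
Definition induced (K : {group gT}) (L : R -> Prop) : Prop :=
  exists L1 : R -> Prop,
    [/\ subgroup_pred L1, forall x, L1 x -> L x,
        forall y, L y -> exists a : gT -> R,
          (forall k, L1 (a k)) /\ y = \sum_(k in K) tau k * a k
      & forall a : gT -> R, (forall k, L1 (a k)) ->
          \sum_(k in K) tau k * a k = 0 -> forall k, k \in K -> a k = 0].

(** By uniqueness: the translate of the sum by the inverse of s has the coefficients [a (s k)], and
    invariance equates the two expansions. *)
Lemma induced_coef_inv (K : {group gT}) (L1 : R -> Prop) (a : gT -> R) s :
    subgroup_pred L1 ->
    (forall a : gT -> R, (forall k, L1 (a k)) ->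
          \sum_(k in K) tau k * a k = 0 -> forall k, k \in K -> a k = 0) ->
    (forall k, L1 (a k)) -> s \in K ->
    tau s * \sum_(k in K) tau k * a k = \sum_(k in K) tau k * a k ->
  forall k, k \in K -> a (s * k)%g = a k.
Proof.
move=> [L0 LB] ind aL sK sy k kK; apply/eqP; rewrite -subr_eq0; apply/eqP.
apply: (ind (fun g => a (s * g)%g - a g)) => // [g|]; first exact: LB.
under eq_bigr do rewrite mulrBr.
rewrite sumrB; apply/eqP; rewrite subr_eq0; apply/eqP.
have tauK x : tau s^-1%g * (tau s * x) = x by rewrite mulrA -tauM mulVg tau1 mul1r.
apply: (can_inj tauK); rewrite sy.
rewrite big_distrr /= [RHS](reindex_inj (mulgI s)) /=.
apply: eq_big => [g | g _]; first by rewrite groupMl.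
by rewrite mulrA -tauM.
Qed.

Lemma sum_join (K H : {group gT}) (F : gT -> R) : (K :&: H = 1)%g ->
  \sum_(u in (K <*> H)%g) F u = \sum_(k in K) \sum_(t in H) F (k * t)%g.
Proof.
move=> tiKH; have nHK : K \subset 'N(H)%g.
  apply/subsetP => k _; rewrite inE; apply/subsetP => _ /imsetP[t tH ->].
  by rewrite conjgE (cgT t k) mulKg.
rewrite norm_joinEl // pair_big_dep /=.
rewrite (reindex_onto (fun p : gT * gT => (p.1 * p.2)%g)
  (fun u => (divgr K H u, remgr K H u))) /= => [|u uKH]; last first.
  by rewrite -divgr_eq.
apply: eq_bigl => -[k t] /=; apply/andP/andP => [[ktKH /eqP] | [kK tH]].
  case=> dk dt; split; first by rewrite -dk mem_divgr.
  by rewrite -dt mem_remgr.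
split; first exact: mem_mulg.
by rewrite divgrMid // remgrMid.
Qed.

Definition norm_lattice (H : {group gT}) (L : R -> Prop) : R -> Prop :=
  fun z => exists2 x, L x & z = orbsum H * x.

(* With N the norm of H and e = N / #|H|, this is #|H| (N L + (1 - e + e h) L);
   the scaling keeps it inside L. *)
Definition dist_lattice (H : {group gT}) (h : R) (L : R -> Prop) : R -> Prop :=
  fun z => exists x y, [/\ L x, L y
    & z = orbsum H * #|H|%:R * x + (#|H|%:R - orbsum H + h * orbsum H) * y].

Lemma norm_lattice_lattice H L : lattice L -> lattice (norm_lattice H L).
Proof.
case=> L0 LB Lt; split; first by exists 0; rewrite ?mulr0.
  move=> _ _ [x Lx ->] [y Ly ->]; exists (x - y); first exact: LB.
  by rewrite mulrBr.
by move=> g _ [x Lx ->]; exists (tau g * x); [exact: Lt | rewrite mulrCA].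
Qed.

Lemma dist_lattice_lattice H h L : lattice L -> lattice (dist_lattice H h L).
Proof.
case=> L0 LB Lt; split; first by exists 0, 0; rewrite ?mulr0 ?addr0.
  move=> _ _ [x [y [Lx Ly ->]]] [x' [y' [Lx' Ly' ->]]].
  by exists (x - x'), (y - y'); split; [exact: LB | exact: LB | ring].
move=> g _ [x [y [Lx Ly ->]]]; exists (tau g * x), (tau g * y).
by split; [exact: Lt | exact: Lt | ring].
Qed.

(** Tate cohomology of an induced module vanishes in degree 0: the coefficients of an invariant are
    constant, and their common value is [v]. *)
Lemma induced_inv H L y : induced H L -> L y ->
  (forall t, t \in H -> tau t * y = y) -> exists2 v, L v & y = orbsum H * v.
Proof.
case=> L1 [sL1 L1L gen ind] Ly yH; have [a [aL1 yE]] := gen y Ly.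
exists (a 1%g); first exact/L1L/aL1.
rewrite /orbsum big_distrl /= yE; apply: eq_bigr => t tH; congr (_ * _).
rewrite -[in LHS](mulg1 t); apply: (induced_coef_inv sL1 ind aL1) => //.
by rewrite -yE yH.
Qed.

(** Both [t y] and y become [N y] when multiplied by the order of H, and there is no torsion. *)
Lemma orbsum_inv H y : orbsum H * y = #|H|%:R * y ->
  forall t, t \in H -> tau t * y = y.
Proof.
move=> Ny t tH; apply/eqP; rewrite -subr_eq0; apply/eqP.
apply: (@tfR _ #|H|); first exact: cardG_gt0.
by rewrite mulrnBl -mulrnAr -[y *+ _]mulr_natl -Ny mulrA tau_orbsum // subrr.
Qed.

(** Vanishing of Tate cohomology in degree -1: the norm of y is N applied to the total of the
    coefficients, so independence makes this total 0, and [tau t] may be replaced by [tau t - 1] in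
    the expansion of y. *)
Lemma induced_ker H L y : induced H L -> L y -> orbsum H * y = 0 ->
  exists x : gT -> R, (forall t, L (x t)) /\ y = \sum_(t in H) (tau t - 1) * x t.
Proof.
case=> L1 [sL1 L1L gen ind] Ly Ny; have [a [aL1 yE]] := gen y Ly.
exists a; split=> [t|]; first exact/L1L/aL1.
under eq_bigr do rewrite mulrBl mul1r.
rewrite sumrB -yE (ind (fun _ => \sum_(t in H) a t) _ _ 1%g) ?subr0 //.
  by move=> _; apply: subgroup_pred_sum.
rewrite -big_distrl -/(orbsum H) big_distrr /= -[RHS]Ny yE big_distrr /=.
by apply: eq_bigr => t tH; rewrite mulrA [_ * tau t]mulrC tau_orbsum.
Qed.

(** The translates of N L1 by K make up N L: expanded over K H, an element [N x] has coefficients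
    constant along H, so independence over K H gives independence over K. *)
Lemma induced_norm (K H : {group gT}) L : (K :&: H = 1)%g ->
  induced (K <*> H)%G L -> induced K (norm_lattice H L).
Proof.
move=> tiKH [L1 [sL1 L1L gen ind]]; have [L10 L1B] := sL1.
exists (norm_lattice H L1); split.
- split; first by exists 0; rewrite ?mulr0.
  move=> _ _ [x Lx ->] [y Ly ->]; exists (x - y); first exact: L1B.
  by rewrite mulrBr.
- by move=> _ [x Lx ->]; exists x => //; apply: L1L.
- move=> _ [z Lz ->]; have [a [aL1 ->]] := gen z Lz.
  exists (fun k => orbsum H * \sum_(t in H) a (k * t)%g); split=> [k|].
    by exists (\sum_(t in H) a (k * t)%g) => //; apply: subgroup_pred_sum.
  rewrite sum_join // big_distrr /=; apply: eq_bigr => k kK.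
  rewrite !big_distrr /=; apply: eq_bigr => t tH.
  by rewrite tauM -[in RHS](tau_orbsum tH); ring.
move=> c cL; have /choice[x xP] : forall k, exists x, L1 x /\ c k = orbsum H * x.
  by move=> k; have [x L1x ->] := cL k; exists x.
move=> c0 k kK; rewrite (proj2 (xP k)).
suff -> : x k = 0 by rewrite mulr0.
have := ind (fun u => x (divgr K H u)) (fun u => proj1 (xP _)) _ k.
rewrite -[k in divgr _ _ k]mulg1 divgrMid //; apply; last first.
  by rewrite (subsetP (joing_subl _ _)).
rewrite sum_join // -[RHS]c0; apply: eq_bigr => g gK.
rewrite (proj2 (xP g)) /orbsum big_distrl big_distrr /=.
by apply: eq_bigr => t tH; rewrite divgrMid // tauM mulrA.
Qed.

Lemma tfR_natl (x : R) n : (0 < n)%N -> n%:R * x = 0 -> x = 0.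
Proof. by rewrite mulr_natl; apply: tfR. Qed.

(** The lattice is an extension of L / N L by N L, and Z[H] / N is free on the t other than 1. Hence
    the basis [L1']: a part [N n x] from N L and, for each t different from 1, one coefficient [y t]
    in L1. *)
Lemma induced_dist (K H : {group gT}) h L : (K :&: H = 1)%g ->
    lattice L -> (forall x, L x -> L (h * x)) ->
  induced (K <*> H)%G L -> induced K (dist_lattice H h L).
Proof.
move=> tiKH lL hL [L1 [sL1 L1L gen ind]]; have [L10 L1B] := sL1.
have sL := lattice_subgroup lL.
set N := orbsum H; set n : R := #|H|%:R.
have NN : N * N = N * n by exact: orbsum_sqr.
have tN t : t \in H -> tau t * N = N by exact: tau_orbsum.
pose L1' z := exists x y, [/\ L1 x, forall g, L1 (y g)
  & z = N * n * x + (n - N + h * N) * \sum_(t in H | t != 1%g) tau t * y t].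
have H1 : 1%g \in H by exact: group1.
have sK k : k \in K -> k \in (K <*> H)%g by apply/subsetP/joing_subl.
exists L1'; split.
- split.
    exists 0, (fun _ => 0); split=> //.
    by rewrite big1 ?mulr0 ?addr0 // => t _; rewrite mulr0.
  move=> _ _ [x [y [Lx Ly ->]]] [x' [y' [Lx' Ly' ->]]].
  exists (x - x'), (fun t => y t - y' t).
  split=> [|g|]; [exact: L1B | exact: L1B |].
  have -> : \sum_(t in H | t != 1%g) tau t * (y t - y' t) =
      \sum_(t in H | t != 1%g) tau t * y t - \sum_(t in H | t != 1%g) tau t * y' t.
    by rewrite -sumrB; apply: eq_bigr => t _; rewrite mulrBr.
  by ring.
- move=> _ [x [y [Lx Ly ->]]]; exists x, (\sum_(t in H | t != 1%g) tau t * y t).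
  split=> //; first exact: L1L.
  by apply: subgroup_pred_sum => // t _; case: lL => _ _; apply; apply: L1L.
- move=> _ [x [y [Lx Ly ->]]]; have [a [aL1 yE]] := gen y Ly.
  (* Replacing [a (k t)] by [a (k t) - a k] clears t = 1 and removes from y the norm of the sum of
     the [tau k] times [a k]. The factor [n - N + h N] acts on norms as [n h], so the removed part
     is absorbed into x through h. *)
  pose x' := x + h * \sum_(k in K) tau k * a k.
  have Lx' : L x'.
    apply: subgroup_predD => //; apply: hL; apply: subgroup_pred_sum => // k _.
    by case: lL => _ _; apply; apply: L1L.
  have [a' [a'L1 x'E]] := gen x' Lx'.
  exists (fun k => N * n * (\sum_(t in H) a' (k * t)%g) + (n - N + h * N) *
     \sum_(t in H | t != 1%g) tau t * (a (k * t)%g - a k)); split=> [k|].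
    exists (\sum_(t in H) a' (k * t)%g), (fun t => a (k * t)%g - a k).
    by split=> // [|g]; [exact: subgroup_pred_sum | exact: L1B].
  have yE' : (n - N + h * N) * y = N * n * (h * \sum_(k in K) tau k * a k) +
     \sum_(k in K) tau k * ((n - N + h * N) *
        \sum_(t in H | t != 1%g) tau t * (a (k * t)%g - a k)).
    rewrite yE sum_join // [LHS]big_distrr [h * \sum_(k in K) _]big_distrr /=.
    rewrite [N * n * _]big_distrr -big_split /=; apply: eq_bigr => k kK.
    under [in RHS]eq_bigr do rewrite mulrBr.
    rewrite sumrB -[\sum_(t in H | _) _ * a k]big_distrl /=.
    have -> : \sum_(t in H | t != 1%g) tau t = N - 1.
      by rewrite /N /orbsum [in RHS](bigD1 1%g) //= tau1 [1 + _]addrC addrK.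
    under eq_bigr do rewrite tauM -mulrA.
    rewrite -big_distrr /= (bigD1 1%g) //= mulg1 tau1 mul1r.
    set S := \sum_(t in H | _) _.
    transitivity (tau k * (n - N + h * N) * (a k + S)); first by ring.
    apply/eqP; rewrite -subr_eq0; apply/eqP.
    transitivity (tau k * a k * (n * N - N * N + h * (N * N - N * n))).
      by ring.
    by rewrite NN; ring.
  rewrite yE' addrA -mulrDr -/x' {1}x'E sum_join // big_distrr /= -big_split /=.
  apply: eq_bigr => k kK; rewrite mulrDr; congr (_ + _).
  transitivity (\sum_(t in H) tau k * (N * n * a' (k * t)%g)); last first.
    by rewrite -!big_distrr.
  rewrite [LHS]big_distrr /=; apply: eq_bigr => t tH.
  by rewrite tauM -[in RHS](tN t tH) -/N -/n; ring.
move=> c cL; have /choice[xy xyP] : forall k, exists xy : R * (gT -> R),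
    [/\ L1 xy.1, forall g, L1 (xy.2 g)
  & c k = N * n * xy.1 + (n - N + h * N) * \sum_(t in H | t != 1%g) tau t * xy.2 t].
  by move=> k; have [x [y xyP]] := cL k; exists (x, y).
pose x k := (xy k).1; pose y k := (xy k).2.
have xL k : L1 (x k) by case: (xyP k).
have yL k g : L1 (y k g) by case: (xyP k) => _ /(_ g).
have cE k : c k = N * n * x k +
    (n - N + h * N) * \sum_(t in H | t != 1%g) tau t * y k t.
  by case: (xyP k).
(* [A] is 0 where the H-component is 1. Once w is known to be H-invariant, [A] is constant along H,
   hence 0. *)
move=> c0; pose A u := if remgr K H u == 1%g then 0
                       else y (divgr K H u) (remgr K H u).
have AL u : L1 (A u) by rewrite /A; case: ifP.
pose w := \sum_(u in (K <*> H)%g) tau u * A u.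
have wE : w = \sum_(k in K) tau k * \sum_(t in H | t != 1%g) tau t * y k t.
  rewrite /w sum_join //; apply: eq_bigr => k kK; rewrite big_distrr /=.
  rewrite (bigD1 1%g) //= /A remgrMid // eqxx mulr0 add0r.
  apply: eq_bigr => t /andP[tH t1].
  by rewrite remgrMid // divgrMid // (negbTE t1) tauM mulrA.
have xyE : N * n * (\sum_(k in K) tau k * x k) + (n - N + h * N) * w = 0.
  rewrite -[RHS]c0 wE [N * n * _]big_distrr [(n - N + _) * _]big_distrr /=.
  rewrite -big_split /=; apply: eq_bigr => k _.
  by rewrite cE; ring.
have n_gt0 : (0 < #|H|)%N by exact: cardG_gt0.
(* Multiplying [xyE] by [n - N] kills the first term and leaves n times [n w - N w]. *)
have Nw : N * w = n * w.
  apply/eqP; rewrite eq_sym -subr_eq0; apply/eqP; apply: (tfR_natl n_gt0).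
  rewrite -/n -[RHS](mulr0 (n - N)) -xyE.
  set s := \sum_(k in K) _.
  apply/eqP; rewrite -subr_eq0; apply/eqP.
  transitivity ((N * n - N * N) * (w - n * s - h * w)); first by ring.
  by rewrite NN; ring.
have yk0 k t : k \in K -> t \in H -> t != 1%g -> y k t = 0.
  move=> kK tH t1.
  have tKH : t \in (K <*> H)%g by rewrite (subsetP (joing_subr _ _)).
  have := induced_coef_inv sL1 ind AL tKH (orbsum_inv Nw tH) (sK k kK).
  rewrite cgT /A remgrMid // (negbTE t1) divgrMid // => ->.
  by rewrite -[k]mulg1 remgrMid // eqxx.
have w0 : w = 0.
  rewrite wE big1 // => k kK; rewrite big1 ?mulr0 // => t /andP[tH t1].
  by rewrite yk0 // mulr0.
have x0 k : k \in K -> x k = 0.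
  have := ind (fun u => x (divgr K H u)) (fun u => xL _) _ k.
  move=> xi kK; rewrite -[in LHS](_ : divgr K H k = k); last first.
    by rewrite -[in LHS](mulg1 k) divgrMid.
  apply: xi; last exact: sK.
  apply: (tfR_natl n_gt0); rewrite -/n -[RHS]xyE w0 mulr0 addr0 sum_join //.
  rewrite !big_distrr /=; apply: eq_bigr => g gK.
  transitivity (n * (N * (tau g * x g))); last by ring.
  congr (_ * _); rewrite /N /orbsum big_distrl /=; apply: eq_bigr => t tH.
  by rewrite divgrMid // tauM; ring.
move=> k kK; rewrite cE x0 // mulr0 add0r big1 ?mulr0 // => t /andP[tH t1].
by rewrite yk0 // mulr0.
Qed.

(** Both parities together: comparing coefficients in [e tau(c) y = y] shows that the coefficient at
    c is e times the one at 1, so y is the norm of the latter. *)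
Lemma induced_cyc_acyclic (c : gT) (e : R) L y :
    c != 1%g -> (c * c = 1)%g -> (e = 1) \/ (e = -1) ->
    induced <[c]> L -> L y -> e * tau c * y = y ->
  exists2 x, L x & y = x + e * tau c * x.
Proof.
move=> c1 cc e1 [L1 [sL1 L1L gen ind]] Ly cy; have [a [aL1 yE]] := gen y Ly.
have sumE F : \sum_(k in <[c]>%g) F k = F 1%g + F c :> R.
  rewrite (bigD1 1%g) ?group1 //= (bigD1 c) ?c1 ?cycle_id //= big1 ?addr0 //.
  have ord2 : #[c]%g = 2.
    have d2 : (#[c]%g %| 2)%N by rewrite order_dvdn expgS expg1 cc.
    case/primeP: (isT : prime 2) => _ /(_ _ d2) /orP[|/eqP //].
    by rewrite order_eq1 (negbTE c1).
  move=> k /andP[/andP[/cycleP[i ->] k1] kc]; move: k1 kc.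
  rewrite -(expg_mod_order c i) ord2 modn2.
  by case: (odd i); rewrite ?expg1 ?eqxx.
have eL1 x : L1 x -> L1 (e * x).
  by case: e1 => ->; rewrite ?mul1r // mulN1r; apply: subgroup_predN.
have ee : e * e = 1 by case: e1 => ->; rewrite ?mulr1 ?mulrNN ?mulr1.
have tt : tau c * tau c = 1 by rewrite -tauM cc tau1.
have yE' : y = a 1%g + tau c * a c by rewrite yE sumE tau1 mul1r.
have ac : e * a 1%g = a c.
  apply/eqP; rewrite -subr_eq0; apply/eqP.
  have := ind (fun k => if k == c then e * a 1%g - a c else e * a c - a 1%g) _ _
    c (cycle_id c); rewrite eqxx; apply=> [k|].
    by case: ifP => _; (case: sL1 => _; apply=> //; apply: eL1).
  rewrite sumE eqxx eq_sym (negbTE c1) tau1 mul1r.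
  have := cy; rewrite {1}yE' => cy'.
  transitivity (e * tau c * (a 1%g + tau c * a c) - y); last by rewrite cy' subrr.
  apply/eqP; rewrite yE' -subr_eq0; apply/eqP.
  transitivity (e * a c * (1 - tau c * tau c)); first by ring.
  by rewrite tt subrr mulr0.
exists (a 1%g); first exact: L1L.
by rewrite yE' -ac; ring.
Qed.

Lemma sum_set_sum (I J : finType) (A : {set I + J}) (F : I + J -> R) :
  \sum_(i in A) F i = \sum_(i in [set i | inl i \in A]) F (inl i)
                     + \sum_(j in [set j | inr j \in A]) F (inr j).
Proof.
by rewrite big_sumType; congr (_ + _); apply: eq_bigl => i; rewrite inE.
Qed.

(** The long exact sequence of the extension of L / N L by N L, written on elements. A class of L /
    N L is seen through [y - g y] in N L, where g acts by -1. The two hypotheses on [h z] make the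
    connecting maps zero: each [v'] lifts to the extension and the [v] stay independent in it. *)
Lemma tate_basis_dist (H : {group gT}) (h g : R) (L : R -> Prop) (I J : finType) :
    lattice L -> (forall x, L x -> L (h * x)) -> (forall x, L x -> L (g * x)) ->
    g * g = 1 -> induced H L ->
    (forall y, L y -> g * y = y -> exists2 x, L x & y = x + g * x) ->
    (forall y, L y -> - g * y = y -> exists2 x, L x & y = x + - g * x) ->
    (forall z, norm_lattice H L z -> g * z = z ->
       exists2 x, norm_lattice H L x & h * z = x + g * x) ->
    (forall z, norm_lattice H L z -> - g * z = z ->
       exists2 x, norm_lattice H L x & h * z = x + - g * x) ->
    tate_basis (fun x => g * x) (norm_lattice H L) I ->
    tate_basis (fun x => - g * x) (norm_lattice H L) J ->
  tate_basis (fun x => g * x) (dist_lattice H h L) (I + J)%type.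
Proof.
move=> lL hL gL gg iL ac ac' hz hz' [v [vP vgen vind]] [v' [v'P v'gen v'ind]].
have sL := lattice_subgroup lL.
set N := orbsum H; set n : R := #|H|%:R; set b := n - N + h * N.
have n_gt0 : (0 < #|H|)%N by exact: cardG_gt0.
have NN : N * N = N * n by exact: orbsum_sqr.
pose M0 := norm_lattice H L.
have sM : subgroup_pred M0 by apply/lattice_subgroup/norm_lattice_lattice.
have hM z : M0 z -> M0 (h * z).
  by move=> [x Lx ->]; exists (h * x); [exact: hL | rewrite mulrCA].
have gM z : M0 z -> M0 (g * z).
  by move=> [x Lx ->]; exists (g * x); [exact: gL | rewrite mulrCA].
have tauL t x : L x -> L (tau t * x) by case: lL => _ _; apply.
have NL x : L x -> L (N * x).
  move=> Lx; rewrite /N /orbsum big_distrl /=.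
  by apply: subgroup_pred_sum => // t _; apply: tauL.
have ML z : M0 z -> L z by move=> [x Lx ->]; exact: NL.
have NM z : M0 z -> N * z = n * z.
  by move=> [x Lx ->]; rewrite -/N !mulrA NN [N * n]mulrC.
have bM z : M0 z -> b * z = n * (h * z).
  by move=> /NM Nz; rewrite /b !mulrDl mulNr -[h * N * z]mulrA Nz; ring.
have nD z : M0 z -> dist_lattice H h L (n * z).
  by move=> [x Lx ->]; exists x, 0; split=> //; [case: sL | rewrite -/N -/n; ring].
have bD y : L y -> dist_lattice H h L (b * y).
  by move=> Ly; exists 0, y; split=> //; [case: sL | rewrite -/N -/n -/b; ring].
have M0inv y : L y -> N * y = n * y -> M0 y.
  by move=> Ly Ny; apply: induced_inv => //; apply: orbsum_inv.
have nNb y : (n - N) * (b * y) = n * ((n - N) * y).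
  apply/eqP; rewrite -subr_eq0; apply/eqP.
  transitivity (y * (N * n - N * N) * (h - 1)); first by rewrite /b; ring.
  by rewrite NN; ring.
have nNM z : M0 z -> (n - N) * (n * z) = 0.
  by move=> /NM Nz; transitivity (n * (n * z - N * z)); [ring | rewrite Nz subrr mulr0].
have /choice[w wP] : forall j, exists w, L w /\ v' j = w + - g * w.
  move=> j; have [[/ML Lv' gv'] ] := (v'P j, tt).
  by have [w Lw ->] := ac' _ Lv' gv'; exists w.
have /choice[x xP] : forall j, exists x, M0 x /\ h * v' j = x + - g * x.
  move=> j; have [Mv' gv'] := v'P j.
  by have [x Mx ->] := hz' _ Mv' gv'; exists x.
(* [b w] represents the class attached to [v'], but [b w - g b w = b v' = n h v']; the term [n x]
   compensates, since [h v' = x - g x]. *)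
pose u j := b * w j - n * x j.
have wL j : L (w j) := proj1 (wP j).
have xM j : M0 (x j) := proj1 (xP j).
have dD := dist_lattice_lattice H h lL.
have sD := lattice_subgroup dD.
have uD j : dist_lattice H h L (u j).
  by case: (sD) => _; apply; [exact: bD | exact: nD].
have guE j : g * u j = u j.
  have := bM _ (proj1 (v'P j)); rewrite {1}(proj2 (wP j)) (proj2 (xP j)) => E.
  apply/eqP; rewrite -subr_eq0; apply/eqP.
  transitivity (n * (x j + - g * x j) - b * (w j + - g * w j)).
    by rewrite /u; ring.
  by rewrite E subrr.
exists (fun ij => match ij with inl i => n * v i | inr j => u j end); split.
- case=> [i | j]; last by [].
  by have [Mv gv] := vP i; split; [exact: nD | rewrite mulrCA gv].
- move=> z [m' [y [Lm' Ly zE]]] gz.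
  pose m := N * m'; have Mm : M0 m by exists m'.
  have {}zE : z = n * m + b * y by rewrite zE -/N -/n -/b /m; ring.
  (* As z is fixed by g, y is fixed modulo N L; d is its class in the opposite parity. *)
  pose d := y + - g * y.
  have Ld : L d.
    apply: subgroup_predD => //; rewrite mulNr; apply: subgroup_predN => //; exact: gL.
  have Md : M0 d.
    apply: M0inv => //; apply/eqP; rewrite eq_sym -subr_eq0 -mulrBl; apply/eqP.
    apply: (tfR_natl n_gt0); rewrite -/n -nNb.
    transitivity ((n - N) * (z - g * z) - (n - N) * (n * (m + - g * m))).
      by rewrite zE /d; ring.
    rewrite gz subrr mulr0 sub0r nNM ?oppr0 // mulNr.
    by case: (sM) => _; apply => //; apply: gM.
  have gd : - g * d = d.
    transitivity (g * g * y - g * y); first by rewrite /d; ring.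
    by rewrite gg /d; ring.
  have [B [s [Ms dE]]] := v'gen d Md gd.
  (* Once the lifts [w] and a correction in N L are removed, y becomes a fixed element of the
     acyclic L, hence a norm. *)
  pose y1 := y - \sum_(j in B) w j - s.
  have Ly1 : L y1.
    apply: subgroup_predB => //; last exact: ML.
    by apply: subgroup_predB => //; apply: subgroup_pred_sum.
  have gy1 : g * y1 = y1.
    apply/eqP; rewrite eq_sym -subr_eq0; apply/eqP.
    transitivity (d - (\sum_(j in B) w j - g * \sum_(j in B) w j) - (s + - g * s)).
      by rewrite /y1 /d; ring.
    rewrite dE; have -> : \sum_(j in B) v' j =
        \sum_(j in B) w j - g * \sum_(j in B) w j.
      rewrite big_distrr -sumrB /=; apply: eq_bigr => j _.
      by rewrite (proj2 (wP j)) mulNr.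
    by ring.
  have [t Lt y1E] := ac _ Ly1 gy1.
  (* What remains of z, without the [u] and the norm of [b t], is n times k, with k a fixed element
     of N L. *)
  pose k := m + \sum_(j in B) x j + h * s.
  have Mk : M0 k.
    apply: subgroup_predD => //; last exact: hM.
    by apply: subgroup_predD => //; apply: subgroup_pred_sum.
  have zE' : z - \sum_(j in B) u j - (b * t + g * (b * t)) = n * k.
    have yE : y = t + g * t + \sum_(j in B) w j + s by rewrite -y1E /y1; ring.
    rewrite zE yE !mulrDr (bM _ Ms) /u sumrB -!big_distrr /= /k.
    by ring.
  have gk : g * k = k.
    apply/eqP; rewrite -subr_eq0; apply/eqP; apply: (tfR_natl n_gt0).
    rewrite -/n; transitivity (g * (n * k) - n * k); first by ring.
    rewrite -zE'.
    have gu : g * \sum_(j in B) u j = \sum_(j in B) u j.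
      by rewrite big_distrr /=; apply: eq_bigr.
    transitivity (g * z - z - (g * \sum_(j in B) u j - \sum_(j in B) u j)
                  - (g * g - 1) * (b * t)); first by ring.
    by rewrite gz gu gg; ring.
  have [A [q [Mq kE]]] := vgen k Mk gk.
  exists [set ij | match ij with inl i => i \in A | inr j => j \in B end].
  exists (n * q + b * t); split.
    by apply: subgroup_predD => //; [exact: nD | exact: bD].
  rewrite sum_set_sum.
  under eq_bigl do rewrite !inE.
  under [X in _ + X + _]eq_bigl do rewrite !inE.
  rewrite -big_distrr /=.
  apply/eqP; rewrite -subr_eq0; apply/eqP.
  transitivity (z - \sum_(j in B) u j - (b * t + g * (b * t))
    - n * (\sum_(i in A) v i + (q + g * q))); first by ring.
  by rewrite zE' -kE subrr.
move=> C z [m' [y [Lm' Ly zE]]]; rewrite sum_set_sum.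
set A := [set i | _]; set B := [set j | _] => E.
pose m := N * m'; have Mm : M0 m by exists m'.
have {}zE : z = n * m + b * y by rewrite zE -/N -/n -/b /m; ring.
(* [q - g q] is the sum of the [v'] over B, so as soon as q is known to lie in N L, independence of
   the [v'] empties B. *)
pose q := \sum_(j in B) w j - y - g * y.
have Lq : L q.
  apply: subgroup_predB => //; last exact: gL.
  by apply: subgroup_predB => //; apply: subgroup_pred_sum.
have {}E : n * \sum_(i in A) v i + b * \sum_(j in B) w j - n * \sum_(j in B) x j
    = n * (m + g * m) + b * (y + g * y).
  transitivity (z + g * z); last by rewrite zE; ring.
  by rewrite -E /u sumrB -!big_distrr /=; ring.
have Mq : M0 q.
  apply: M0inv => //; apply/eqP; rewrite eq_sym -subr_eq0 -mulrBl; apply/eqP.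
  apply: (tfR_natl n_gt0); rewrite -/n -nNb.
  transitivity ((n - N) * (n * (m + g * m + \sum_(j in B) x j -
                                \sum_(i in A) v i))).
    rewrite /q; transitivity ((n - N) * (n * \sum_(i in A) v i +
      b * \sum_(j in B) w j - n * \sum_(j in B) x j + n * \sum_(j in B) x j
      - n * \sum_(i in A) v i - b * (y + g * y))); first by ring.
    by rewrite E; ring.
  apply: nNM; apply: subgroup_predB => //.
    apply: subgroup_predD => //; last exact: subgroup_pred_sum.
    by apply: subgroup_predD => //; apply: gM.
  by apply: subgroup_pred_sum => // i _; case: (vP i).
have B0 : B = set0.
  apply: (v'ind B q) => //; rewrite /q.
  have -> : \sum_(j in B) v' j = \sum_(j in B) w j - g * \sum_(j in B) w j.
    rewrite big_distrr -sumrB /=; apply: eq_bigr => j _.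
    by rewrite (proj2 (wP j)) mulNr.
  apply/eqP; rewrite -subr_eq0; apply/eqP.
  transitivity ((1 - g * g) * y); first by ring.
  by rewrite gg subrr mul0r.
(* With B empty, [- q = y + g y] is a fixed element of N L, so [h (- q)] is a norm, and the part of
   z coming from y only adds a norm to the sum of the [v]. *)
have [s Ms hq] : exists2 s, M0 s & h * - q = s + g * s.
  apply: hz; first exact: subgroup_predN.
  rewrite /q B0 big_set0.
  transitivity (g * y + g * g * y); first by ring.
  by rewrite gg; ring.
have A0 : A = set0.
  apply: (vind A (m + s)); first exact: subgroup_predD.
  apply/eqP; rewrite -subr_eq0; apply/eqP; apply: (tfR_natl n_gt0).
  rewrite -/n; transitivity (n * \sum_(i in A) v i - n * (m + g * m)
    - n * (s + g * s)); first by ring.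
  rewrite -hq; have := bM _ Mq; move: E; rewrite /q B0 !big_set0 => E bq.
  transitivity (n * \sum_(i in A) v i + b * 0 - n * 0 - n * (m + g * m)
    - b * (y + g * y) + (n * (h * (0 - y - g * y)) - b * (0 - y - g * y))).
    by ring.
  by rewrite E bq; ring.
apply/setP=> -[i | j]; rewrite in_set0.
  by have /setP/(_ i) := A0; rewrite !inE.
by have /setP/(_ j) := B0; rewrite !inE.
Qed.

End Lattices.

(** * Products over primes *)

Section Levels.
Variables (R : comNzRingType) (gT : finGroupType) (tau : gT -> R).
Hypothesis tfR : forall (x : R) n, (0 < n)%N -> x *+ n = 0 -> x = 0.
Hypothesis cgT : forall g h : gT, commute g h.
Hypothesis tau1 : tau 1%g = 1.
Hypothesis tauM : forall g h, tau (g * h)%g = tau g * tau h.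
Variables (T : eqType) (P : seq T) (H Q : T -> {group gT}) (f f' : T -> gT).
Hypothesis uniqP : uniq P.
Hypothesis HQ : forall p q, p \in P -> q \in P -> q != p -> H p \subset Q q.
Hypothesis tiHQ : forall p, p \in P -> (H p :&: Q p = 1)%g.
Hypothesis genH : forall g, exists2 u : T -> gT,
  forall p, p \in P -> u p \in H p & g = (\prod_(p <- P) u p)%g.
Variable L0 : R -> Prop.
Hypothesis lattice_L0 : lattice tau L0.
Hypothesis induced_L0 : forall K : {group gT}, induced tau K L0.
Variable c : gT.
Hypothesis cc : (c * c = 1)%g.
Hypothesis cQ : forall p, p \in P -> c \notin Q p.

Let h p : R := tau (f p) - tau (f' p).

(** The flag [true] stands for the full factor at a prime, [false] for the norm ideal alone, which
    occurs as the submodule in the extension for that prime. *)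
Definition level_step (pb : T * bool) (L : R -> Prop) : R -> Prop :=
  if pb.2 then dist_lattice tau (H pb.1) (h pb.1) L
  else norm_lattice tau (H pb.1) L.

Definition level (s : seq (T * bool)) : R -> Prop := foldr level_step L0 s.

Lemma level_lattice s : lattice tau (level s).
Proof.
elim: s => //= -[p []] s IH; rewrite /level_step /=.
  exact: dist_lattice_lattice.
exact: norm_lattice_lattice.
Qed.

Lemma lattice_stable L p x : lattice tau L -> L x -> L (h p * x).
Proof.
move=> [L0' LB Lt] Lx; rewrite /h mulrBl.
by apply: LB; apply: Lt.
Qed.

(** Membership in [Q q] means component 1 at q, so this says that K meets trivially the product of
    the groups [H p] for the primes p used in s. *)
Definition independent (K : {group gT}) (s : seq (T * bool)) : Prop :=
  forall k, k \in K ->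
    (forall q, q \in P -> q \notin unzip1 s -> k \in Q q) -> k = 1%g.

(** Each factor costs its group: the product over p :: s is induced for K once the one over s is
    induced for the join of K and [H p], and independence passes to this larger group. The empty
    product is induced for every subgroup. *)
Lemma level_induced (K : {group gT}) s :
    uniq (unzip1 s) -> {subset unzip1 s <= P} -> independent K s ->
  induced tau K (level s).
Proof.
elim: s K => [|[p b] s IH] K //= /andP[ps us] sP ind.
have pP : p \in P by apply: sP; rewrite inE eqxx.
have tiKH : (K :&: H p = 1)%g.
  apply/trivgP/subsetP => k /setIP[kK kH]; rewrite inE; apply/eqP.
  apply: ind => // q qP; rewrite inE negb_or => /andP[qp _].
  by apply: (subsetP (HQ pP qP qp)).
have iL : induced tau (K <*> H p)%G (level s).
  apply: IH => // [q qs | x]; first by apply: sP; rewrite inE qs orbT.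
  have nHK : K \subset 'N(H p)%g.
    apply/subsetP => k _; rewrite inE; apply/subsetP => _ /imsetP[t tH ->].
    by rewrite conjgE (cgT t k) mulKg.
  rewrite /= norm_joinEl // => /mulsgP[k t kK tH ->] kt.
  have k1 : k = 1%g.
    apply: ind => // q qP; rewrite inE negb_or => /andP[qp qs].
    rewrite -(groupMr _ (subsetP (HQ pP qP qp) _ tH)).
    exact: kt.
  move: (kt p pP ps); rewrite k1 mul1g => tQ.
  by apply/eqP; rewrite -in_set1 -[[set 1%g]](tiHQ pP) inE tH.
rewrite /level_step; case: b {ind} => /=.
  apply: induced_dist => //; first exact: level_lattice.
  by move=> x; apply: lattice_stable; apply: level_lattice.
exact: induced_norm.
Qed.

Lemma level_step_sub x y L z :
  level_step x (level_step y L) z -> level_step y (level_step x L) z.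
Proof.
case: x y => p [] [q []]; rewrite /level_step /=.
- move=> [_ [_ [[x [y [Lx Ly ->]]] [x' [y' [Lx' Ly' ->]]] ->]]].
  exists (orbsum tau (H p) * #|H p|%:R * x +
          (#|H p|%:R - orbsum tau (H p) + h p * orbsum tau (H p)) * x').
  exists (orbsum tau (H p) * #|H p|%:R * y +
          (#|H p|%:R - orbsum tau (H p) + h p * orbsum tau (H p)) * y').
  split; [by exists x, x' | by exists y, y' |].
  move: (orbsum _ _) (orbsum _ _) (_%:R) (_%:R) (h p) (h q) => ? ? ? ? ? ?; ring.
- move=> [_ [_ [[x Lx ->] [y Ly ->] ->]]].
  exists (orbsum tau (H p) * #|H p|%:R * x +
          (#|H p|%:R - orbsum tau (H p) + h p * orbsum tau (H p)) * y).
    by exists x, y.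
  move: (orbsum _ _) (orbsum _ _) (_%:R) (h p) => ? ? ? ?; ring.
- move=> [_ [x [y [Lx Ly ->]]] ->].
  exists (orbsum tau (H p) * x), (orbsum tau (H p) * y).
  split; [by exists x | by exists y |].
  move: (orbsum _ _) (orbsum _ _) (_%:R) (h q) => ? ? ? ?; ring.
move=> [_ [x Lx ->] ->].
by exists (orbsum tau (H p) * x); [exists x | rewrite mulrCA].
Qed.

Lemma level_stepC x y L :
  level_step x (level_step y L) = level_step y (level_step x L).
Proof. by apply/funext => z; apply/propext; split; apply: level_step_sub. Qed.

Lemma level_front s1 x s2 : level (s1 ++ x :: s2) = level (x :: s1 ++ s2).
Proof. by elim: s1 => //= y s1 ->; rewrite /= level_stepC. Qed.

Definition sign_unit (e : R) := e = 1 \/ e = -1.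

Lemma level_acyclic s p e y :
    uniq (unzip1 s) -> {subset unzip1 s <= P} -> p \in P -> p \notin unzip1 s ->
    sign_unit e -> level s y -> e * tau c * y = y ->
  exists2 x, level s x & y = x + e * tau c * x.
Proof.
move=> us sP pP ps e1 Ly; have c1 : c != 1%g.
  by apply: contraNneq (cQ pP) => ->; apply: group1.
apply: (induced_cyc_acyclic tau1 tauM c1 cc e1 _ Ly).
apply: level_induced => // k kc kQ.
have kcp : k \in Q p by apply: kQ.
move: kcp; have /cycleP[i ->] := kc.
have c2 : (c ^+ 2 = 1)%g by rewrite expgS expg1.
rewrite -(expg_mod i c2) modn2.
by case: (odd i) => //; rewrite expg1 (negbTE (cQ pP)).
Qed.

Definition full (s : seq (T * bool)) : Prop := perm_eq (unzip1 s) P.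

Lemma level_step_trivial p b s t e z :
    uniq (p :: unzip1 s) -> {subset p :: unzip1 s <= P} -> t \in H p ->
    sign_unit e -> level ((p, b) :: s) z -> e * tau c * z = z ->
  exists2 x, level ((p, b) :: s) x & tau t * z - z = x + e * tau c * x.
Proof.
move=> us sP tH e1 Lz cz; have lL := level_lattice s.
have [L00 LB Lt] := lL; have sL := lattice_subgroup lL.
have tN := tau_orbsum tauM tH; set N := orbsum tau (H p) in tN.
case: b Lz => Lz; last first.
  have [y Ly zE] := Lz; exists 0.
    by have [] := level_lattice ((p, false) :: s).
  by rewrite zE -/N mulrA tN; ring.
have [x [y [Lx Ly]]] := Lz; rewrite -/N /=.
set n : R := #|H p|%:R; set b := n - N + h p * N => zE.
have n_gt0 : (0 < #|H p|)%N by exact: cardG_gt0.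
have NN : N * N = N * n by exact: orbsum_sqr.
(* y itself may fail to be fixed, but the defect d is invariant under [H p], which makes [t y - y]
   fixed. *)
pose d := y - e * tau c * y.
have Nd : N * d = n * d.
  apply/eqP; rewrite eq_sym -subr_eq0; apply/eqP; apply: (tfR_natl tfR n_gt0).
  rewrite -/n; transitivity ((n - N) * (z - e * tau c * z) +
     (N * N - N * n) * (n * (x - e * tau c * x) - d + h p * d)).
    by rewrite zE /b /d; ring.
  by rewrite cz NN; ring.
have td : tau t * d = d by apply: (orbsum_inv tfR tauM Nd).
pose v := tau t * y - y.
have Lv : level s v by apply: LB => //; apply: Lt.
have cv : e * tau c * v = v.
  apply/eqP; rewrite eq_sym -subr_eq0; apply/eqP.
  transitivity (tau t * d - d); first by rewrite /v /d; ring.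
  by rewrite td subrr.
have [us' ps] : uniq (unzip1 s) /\ p \notin unzip1 s.
  by move: us => /= /andP[].
have [w Lw vE] := level_acyclic us'
  (fun q qs => sP q (mem_behead (s := p :: unzip1 s) qs))
  (sP p (mem_head _ _)) ps e1 Lv cv.
exists (b * w).
  by exists 0, w; split=> //; rewrite -/N -/n -/b /=; ring.
transitivity (b * v + n * x * (tau t * N - N)); first by rewrite zE /v; ring.
by rewrite tN vE; ring.
Qed.

(** The g with this property are closed under products, so generators in the groups [H p] suffice;
    [level_front] brings the prime of a generator to the head of s. *)
Lemma level_trivial s e g z :
    full s -> sign_unit e -> level s z -> e * tau c * z = z ->
  exists2 x, level s x & tau g * z - z = x + e * tau c * x.
Proof.
move=> fs e1; have us : uniq (unzip1 s) by rewrite (perm_uniq fs).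
have lL := level_lattice s; have sL := lattice_subgroup lL.
have [L00 LB Lt] := lL.
pose good g := forall z, level s z -> e * tau c * z = z ->
  exists2 x, level s x & tau g * z - z = x + e * tau c * x.
have goodM g1 g2 : good g1 -> good g2 -> good (g1 * g2)%g.
  move=> G1 G2 {}z Lz cz.
  have [x1 Lx1 E1] := G1 z Lz cz; have [x2 Lx2 E2] := G2 z Lz cz.
  exists (x1 + tau g1 * x2); first by apply: subgroup_predD => //; apply: Lt.
  transitivity (tau g1 * (tau g2 * z - z) + (tau g1 * z - z)).
    by rewrite tauM; ring.
  by rewrite E1 E2; ring.
have good1 : good 1%g.
  by move=> {}z _ _; exists 0 => //; rewrite tau1; ring.
suff goodH p t : p \in P -> t \in H p -> good t.
  move=> Lz cz; apply: (_ : good g) => //; have [u uH ->] := genH g.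
  rewrite big_seq; elim/big_ind: _ => // p pP.
  by apply: (goodH p) => //; apply: uH.
move=> pP tH {}z; have : p \in unzip1 s by rewrite (perm_mem fs).
case/mapP=> -[q b] /= + pq; rewrite -{q}pq => /path.splitPr sE.
have {sE} [s1 [s2 sE]] : exists s1 s2, s = s1 ++ (p, b) :: s2.
  by case: sE => s1 s2; exists s1, s2.
have fs' : perm_eq (p :: unzip1 (s1 ++ s2)) P.
  apply: perm_trans fs; rewrite sE /unzip1 !map_cat /=.
  by rewrite perm_sym perm_catC /= perm_cons perm_catC.
rewrite sE level_front; apply: level_step_trivial => //.
  by rewrite (perm_uniq fs').
by move=> q; rewrite (perm_mem fs').
Qed.

Lemma level_trivial_h s e p z :
    full s -> sign_unit e -> level s z -> e * tau c * z = z ->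
  exists2 x, level s x & h p * z = x + e * tau c * x.
Proof.
move=> fs e1 Lz cz.
have [x1 Lx1 E1] := level_trivial (f p) fs e1 Lz cz.
have [x2 Lx2 E2] := level_trivial (f' p) fs e1 Lz cz.
exists (x1 - x2); first by have [_ LB _] := level_lattice s; apply: LB.
transitivity ((tau (f p) * z - z) - (tau (f' p) * z - z)).
  by rewrite /h; ring.
by rewrite E1 E2; ring.
Qed.

(* The dimensions of H^2 and H^1 over F_2 for a product over k primes. *)
Definition even_rank k : nat := if k is k'.+1 then (2 ^ k')%N else 1%N.
Definition odd_rank k : nat := if k is k'.+1 then (2 ^ k')%N else 0%N.

Definition dist_level (s : seq T) := [seq (p, true) | p <- s].
Definition norm_level (s : seq T) := [seq (p, false) | p <- s].

Hypothesis span_L0 : forall x, L0 x ->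
  exists a : gT -> int, x = \sum_g tau g *~ a g.
Hypothesis L0_1 : L0 1.
Variable aug : {rmorphism R -> int}.
Hypothesis aug_tau : forall g, aug (tau g) = 1.

Lemma norm_levelE s z : level (norm_level s) z <->
  exists2 x, L0 x & z = \prod_(p <- s) orbsum tau (H p) * x.
Proof.
elim: s z => [|p s IH] z /=.
  split=> [Lz | [x Lx ->]]; last by rewrite big_nil mul1r.
  by exists z; rewrite // big_nil mul1r.
split=> [[_ /IH[x Lx ->] ->] | [x Lx ->]].
  by exists x; rewrite // big_cons mulrA.
exists (\prod_(p <- s) orbsum tau (H p) * x); last by rewrite big_cons mulrA.
by apply/IH; exists x.
Qed.

Lemma tau_prod_orbsum s g : perm_eq s P ->
  tau g * \prod_(p <- s) orbsum tau (H p) = \prod_(p <- s) orbsum tau (H p).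
Proof.
move=> sP; rewrite (perm_big _ sP) /=; set N := \prod_(p <- P) _.
have [u uH ->] := genH g; rewrite big_seq.
elim/big_ind: _ => [|x y xN yN|p pP]; first by rewrite tau1 mul1r.
  by rewrite tauM -mulrA yN.
by rewrite /N (big_rem p) //= mulrA tau_orbsum //; apply: uH.
Qed.

(** The augmentation maps the product of norms to the product of the orders of the groups, which is
    nonzero. *)
Lemma prod_orbsum_neq0 s n : \prod_(p <- s) orbsum tau (H p) *~ n = 0 -> n = 0.
Proof.
move/(congr1 aug); rewrite rmorph0 rmorphMz rmorph_prod /= => /eqP.
rewrite -mulrzr mulf_eq0 intz => /orP[|/eqP //].
rewrite (eq_bigr (fun p => #|H p|%:R)) => [|p _].
  rewrite prodf_seq_eq0 => /hasP[p _].
  by rewrite /= Num.Theory.pnatr_eq0 eqn0Ngt cardG_gt0.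
rewrite rmorph_sum /= -sumr_const; apply: eq_bigr => g _; exact: aug_tau.
Qed.

(** When every prime contributes its norm, the lattice is Z N with trivial action: N generates the
    fixed elements modulo doubles, and -c fixes only 0. *)
Lemma level_tate_basis0 s : perm_eq s P ->
  tate_basis (fun x => 1 * tau c * x) (level (norm_level s)) unit /\
  tate_basis (fun x => -1 * tau c * x) (level (norm_level s)) void.
Proof.
move=> sP; set N := \prod_(p <- s) orbsum tau (H p).
have LE z : level (norm_level s) z -> exists n : int, z = N *~ n.
  case/norm_levelE => x /span_L0[a ->] ->; exists (\sum_g a g).
  rewrite big_distrr /= -/N -mulrzr raddf_sum big_distrr /=.
  by apply: eq_bigr => g _; rewrite mulrzAr mulrC tau_prod_orbsum // mulrzr.
have sL := lattice_subgroup (level_lattice (norm_level s)).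
have LNz n : level (norm_level s) (N *~ n).
  apply: subgroup_predMz => //.
  by apply/norm_levelE; exists 1; rewrite ?mulr1.
have cN n : tau c * (N *~ n) = N *~ n by rewrite mulrzAr tau_prod_orbsum.
have N1 : level (norm_level s) N by rewrite -[N]mulr1z.
have cN1 : tau c * N = N by rewrite -[N]mulr1z.
split.
  exists (fun=> N); split=> [_ | z /LE[n ->] _ | A x /LE[n ->]].
  - by rewrite mul1r.
  - have [k [b ->]] : exists (k : int) (b : bool), n = k + k + b%:Z.
      exists (n %/ 2)%Z, (n %% 2 == 1)%Z; lia.
    exists [set _ | b], (N *~ k); split=> //.
    rewrite mul1r cN mulrzDr addrC mulrzDr; congr (_ + _).
    case: b; last by rewrite big_pred0 // => i; rewrite inE.
    by rewrite (big_pred1 tt) // => -[]; rewrite inE.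
  rewrite mul1r cN; have [tA | tA] := boolP (tt \in A); last first.
    by move=> _; apply/setP => -[]; rewrite (negbTE tA) inE.
  rewrite (big_pred1 tt) => [NE | []//]; exfalso.
  have /prod_orbsum_neq0 : N *~ (1 - (n + n)) = 0.
    by rewrite mulrzBr mulrzDr mulr1z -NE subrr.
  lia.
have v0 : void -> R by case.
exists v0; split=> [[] | z /LE[n ->] | A x _ _]; last by apply/setP=> -[].
rewrite mulN1r mulNr cN => Nn; exists set0, 0; split; first by case: sL.
rewrite big_pred0 => [|[]//]; rewrite mulr0 !addr0.
by apply: (@tfR _ 2) => //; rewrite mulr2n -[X in X + _]Nn addNr.
Qed.

Lemma tate_basis_eq (V : zmodType) (s s' : V -> V) L I :
  s =1 s' -> tate_basis s L I -> tate_basis s' L I.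
Proof. by move=> /funext ->. Qed.

(** Norm factors are turned into full ones, one at a time. The ranks required by [tate_basis_dist]
    are those of N L, the same product with p moved from s to t; hence the generality in t. *)
Lemma level_tate_basis s t : perm_eq (s ++ t) P ->
  exists I J : finType,
    [/\ tate_basis (fun x => 1 * tau c * x) (level (dist_level s ++ norm_level t)) I,
        tate_basis (fun x => -1 * tau c * x) (level (dist_level s ++ norm_level t)) J,
        #|I| = even_rank (size s) & #|J| = odd_rank (size s)].
Proof.
elim: s t => [|p s IH] t stP /=.
  exists unit, void; have [? ?] := level_tate_basis0 stP.
  by rewrite card_unit card_void.
have [|I [J [tI tJ cI cJ]]] := IH (p :: t).
  apply: perm_trans stP; rewrite perm_sym /=.
  by rewrite -cat1s perm_catCA.
move: tI tJ; rewrite /= level_front => tI tJ.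
pose L := level (dist_level s ++ norm_level t).
have lL : lattice tau L by exact: level_lattice.
have [L00 LB Lt] := lL; have sL := lattice_subgroup lL.
have keys : unzip1 (dist_level s ++ norm_level t) = s ++ t.
  by rewrite /unzip1 map_cat -!map_comp !map_id.
have [pst ust] : p \notin s ++ t /\ uniq (s ++ t).
  by have := perm_uniq stP; rewrite uniqP /= => /andP.
have stS : {subset p :: s ++ t <= P} by move=> q; rewrite -(perm_mem stP).
have pP : p \in P by apply: stS; rewrite inE eqxx.
have stS' : {subset s ++ t <= P} by move=> q qst; apply: stS; rewrite inE qst orbT.
have iL : induced tau (H p) L.
  apply: level_induced; rewrite ?keys // => k kH kQ.
  apply/eqP; rewrite -in_set1 -[[set 1%g]](tiHQ pP) inE kH.
  by apply: kQ; rewrite ?keys.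
have step e K K' : sign_unit e ->
    tate_basis (fun x => e * tau c * x) (norm_lattice tau (H p) L) K ->
    tate_basis (fun x => - e * tau c * x) (norm_lattice tau (H p) L) K' ->
  tate_basis (fun x => e * tau c * x) (dist_lattice tau (H p) (h p) L) (K + K')%type.
  move=> e1 tK tK'.
  have ne1 : sign_unit (- e) by case: e1 => ->; [right | left; rewrite opprK].
  have full' : full ((p, false) :: dist_level s ++ norm_level t).
    by rewrite /full /= keys.
  apply: tate_basis_dist => //.
  - by move=> x; apply: lattice_stable.
  - move=> x Lx; case: e1 => ->; rewrite ?mul1r ?mulN1r; first exact: Lt.
    by rewrite mulNr; apply: subgroup_predN => //; apply: Lt.
  - transitivity (e * e * (tau c * tau c)); first by ring.
    by rewrite -tauM cc tau1; case: e1 => ->; ring.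
  - by move=> y; apply: (level_acyclic (p := p)); rewrite ?keys.
  - by move=> y; rewrite -mulNr; apply: (level_acyclic (p := p)); rewrite ?keys.
  - by move=> z; apply: (level_trivial_h (s := (p, false) :: _)).
  - by move=> z; rewrite -mulNr; apply: (level_trivial_h (s := (p, false) :: _)).
  by apply: tate_basis_eq tK' => x; rewrite mulNr.
exists (I + J)%type, (J + I)%type; split.
- by apply: step => //; left.
- apply: step => //; first by right.
  by apply: tate_basis_eq tI => x; rewrite opprK.
- rewrite card_sum cI cJ; case: (size s) => [|k] //=.
  by rewrite addnn -mul2n expnS.
rewrite card_sum cI cJ; case: (size s) => [|k] //=.
by rewrite addnn -mul2n expnS.
Qed.

End Levels.

(** * Presentation of the products *)

Section Presentation.
Variables (R : comNzRingType) (gT : finGroupType) (tau : gT -> R).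
Hypothesis tfR : forall (x : R) n, (0 < n)%N -> x *+ n = 0 -> x = 0.
Hypothesis cgT : forall g h : gT, commute g h.
Hypothesis tau1 : tau 1%g = 1.
Hypothesis tauM : forall g h, tau (g * h)%g = tau g * tau h.
Variables (T : eqType) (P : seq T) (H Q : T -> {group gT}) (f f' : T -> gT).
Hypothesis HQ : forall p q, p \in P -> q \in P -> q != p -> H p \subset Q q.
Hypothesis tiHQ : forall p, p \in P -> (H p :&: Q p = 1)%g.
Variable L0 : R -> Prop.
Hypothesis lattice_L0 : lattice tau L0.
Hypothesis induced_L0 : forall K : {group gT}, induced tau K L0.
Hypothesis span_L0 : forall x, L0 x ->
  exists a : gT -> int, x = \sum_g tau g *~ a g.
(** In the application [o p] is the symbol of the idempotent that is 0 at p and 1 elsewhere, and [W]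
    is the span of the distribution relations; [rel_W] then says that N agrees with [h o] modulo [W]
    on symbols that are units at p. *)
Variables (o : T -> R) (W : R -> Prop).
Hypothesis subgroup_W : subgroup_pred W.
Hypothesis o_tau : forall p t, p \in P -> t \in H p -> o p * tau t = o p.

Let h p : R := tau (f p) - tau (f' p).
Let N p : R := orbsum tau (H p).
Let n p : R := #|H p|%:R.
Let b p : R := n p - N p + h p * N p.

Hypothesis rel_W : forall p g (s : seq T), p \in P -> p \notin s ->
  {subset s <= P} -> W ((N p - h p * o p) * (tau g * \prod_(q <- s) o q)).

Notation level := (level tau H f f' L0).

(* The pairs (x, v) where v is a combination of the symbols with components 0 or
   a unit at the primes of s and a unit elsewhere, and x its image. *)
Fixpoint symlift (s : seq T) (x v : R) : Prop :=
  if s is p :: s' then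
    exists x1 v1 x2 v2, [/\ symlift s' x1 v1, symlift s' x2 v2,
      x = N p * n p * x1 + b p * x2 & v = o p * v1 + v2]
  else L0 x /\ x = v.

Lemma symlift0 s : symlift s 0 0.
Proof.
elim: s => [|p s IH] /=; first by case: lattice_L0.
by exists 0, 0, 0, 0; split; rewrite // !mulr0 addr0.
Qed.

Lemma symliftB s x v y w : symlift s x v -> symlift s y w -> symlift s (x - y) (v - w).
Proof.
elim: s x v y w => [|p s IH] x v y w /=.
  by move=> [Lx <-] [Ly <-]; split=> //; case: lattice_L0 => _ LB _; apply: LB.
move=> [x1 [v1 [x2 [v2 [l1 l2 -> ->]]]]] [y1 [w1 [y2 [w2 [k1 k2 -> ->]]]]].
exists (x1 - y1), (v1 - w1), (x2 - y2), (v2 - w2).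
by split; [exact: IH | exact: IH | ring | ring].
Qed.

Lemma symliftN s x v : symlift s x v -> symlift s (- x) (- v).
Proof. by move=> l; rewrite -[- x]sub0r -[- v]sub0r; apply: symliftB (symlift0 s) l. Qed.

Lemma symliftD s x v y w : symlift s x v -> symlift s y w -> symlift s (x + y) (v + w).
Proof.
by move=> lx /symliftN ly; rewrite -[y]opprK -[w]opprK; apply: symliftB.
Qed.

Lemma symlift_sum s (I : finType) (A : pred I) (x v : I -> R) :
  (forall i, A i -> symlift s (x i) (v i)) ->
  symlift s (\sum_(i | A i) x i) (\sum_(i | A i) v i).
Proof.
move=> l; elim/big_ind2: _ => //; first exact: symlift0.
by move=> ? ? ? ?; apply: symliftD.
Qed.

Lemma symlift_tau s g x v : symlift s x v -> symlift s (tau g * x) (tau g * v).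
Proof.
elim: s x v => [|p s IH] x v /=.
  by move=> [Lx <-]; split=> //; case: lattice_L0 => _ _; apply.
move=> [x1 [v1 [x2 [v2 [l1 l2 -> ->]]]]].
exists (tau g * x1), (tau g * v1), (tau g * x2), (tau g * v2).
by split; [exact: IH | exact: IH | ring | ring].
Qed.

Lemma symlift_h s p x v : symlift s x v -> symlift s (h p * x) (h p * v).
Proof.
move=> l; rewrite /h !mulrBl.
by apply: symliftB; apply: symlift_tau.
Qed.

Lemma symlift_N s p x v : symlift s x v -> symlift s (N p * x) (N p * v).
Proof.
move=> l; rewrite /N /orbsum !big_distrl /=; apply: symlift_sum => t _.
exact: symlift_tau.
Qed.

Lemma symlift_level s x : level (dist_level s) x <-> exists v, symlift s x v.
Proof.
elim: s x => [|p s IH] x /=.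
  by split=> [Lx | [v []//]]; exists x.
split=> [[x1 [x2 [/IH[v1 l1] /IH[v2 l2] ->]]] | ].
  by exists (o p * v1 + v2), x1, v1, x2, v2.
move=> [v [x1 [v1 [x2 [v2 [l1 l2 -> _]]]]]]; exists x1, x2.
by split; [apply/IH; exists v1 | apply/IH; exists v2 |].
Qed.

(** [rel_W] extends by linearity from units to all combinations in [symlift]; t collects the primes
    whose factor [o] has been split off. *)
Lemma symlift_rel_W s p x v (t : seq T) :
    symlift s x v -> p \in P -> p \notin s -> p \notin t ->
    {subset s <= P} -> {subset t <= P} ->
  W ((N p - h p * o p) * (v * \prod_(q <- t) o q)).
Proof.
move=> + pP; elim: s x v t => [|q s IH] x v t /=.
  move=> [/span_L0[a ->] <-] _ pt _ tP.
  rewrite big_distrl big_distrr /=; apply: subgroup_pred_sum => // g _.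
  by rewrite mulrzAl mulrzAr; apply: subgroup_predMz => //; apply: rel_W.
move=> [x1 [v1 [x2 [v2 [l1 l2 _ ->]]]]]; rewrite inE negb_or => /andP[pq ps] pt.
move=> sP tP; have sP' : {subset s <= P}.
  by move=> r rs; apply: sP; rewrite inE rs orbT.
rewrite [(_ + v2) * _]mulrDl mulrDr.
apply: subgroup_predD => //; last exact: (IH x2).
rewrite [o q * v1]mulrC -mulrA; have := IH x1 v1 (q :: t) l1.
rewrite big_cons; apply=> //; first by rewrite inE negb_or pq.
by move=> r; rewrite inE => /orP[/eqP->|/tP//]; apply: sP; rewrite inE eqxx.
Qed.

(** Injectivity, prime by prime. The two exactness properties of the norm on an induced module trace
    a vanishing image back to relations over fewer primes, to the elements [tau g - 1] killed by
    [o p], and to the relation equating N with [h o]. The list t carries the factors [o] already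
    split off. *)
Lemma symlift_ker s v (t : seq T) : symlift s 0 v -> uniq s -> {subset s <= P} ->
    {subset t <= P} -> (forall p, p \in s -> p \notin t) ->
  W (v * \prod_(q <- t) o q).
Proof.
elim: s v t => [|p s IH] v t /=.
  by move=> [_ <-] *; rewrite mul0r; case: subgroup_W.
move=> [x1 [v1 [x2 [v2 [l1 l2 /esym xE ->]]]]] /andP[ps us] sP tP st.
have pP : p \in P by apply: sP; rewrite inE eqxx.
have sP' : {subset s <= P} by move=> r rs; apply: sP; rewrite inE rs orbT.
have pt : p \notin t by apply: st; rewrite inE eqxx.
have st' r : r \in s -> r \notin t by move=> rs; apply: st; rewrite inE rs orbT.
have NN : N p * N p = N p * n p by exact: orbsum_sqr.
have n_gt0 : (0 < #|H p|)%N by exact: cardG_gt0.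
have iL : induced tau (H p) (level (dist_level s)).
  have ks : unzip1 (dist_level s) = s by rewrite /unzip1 -map_comp map_id.
  apply: (level_induced tfR cgT tau1 tauM f f' HQ tiHQ lattice_L0 induced_L0);
    rewrite ?ks // => k kH kQ.
  apply/eqP; rewrite -in_set1 -[[set 1%g]](tiHQ pP) inE kH.
  by apply: kQ; rewrite ?ks.
(* Multiplying the vanishing image by [n - N] shows that x2 is invariant under [H p], hence a norm
   [N y]. *)
have Nx2 : N p * x2 = n p * x2.
  apply/eqP; rewrite eq_sym -subr_eq0; apply/eqP; apply: (tfR_natl tfR n_gt0).
  rewrite -[RHS](mulr0 (n p - N p)) -xE -/(n p).
  apply/eqP; rewrite -subr_eq0; apply/eqP.
  transitivity ((N p * n p - N p * N p) * (x2 - n p * x1 - h p * x2)).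
    by rewrite /b; ring.
  by rewrite NN subrr mul0r.
have Lx2 : level (dist_level s) x2 by apply/symlift_level; exists v2.
have [y Ly yE] := induced_inv tau1 tauM iL Lx2 (orbsum_inv tfR tauM Nx2).
have [w lw] := (symlift_level s y).1 Ly.
have W1 : W ((v2 - N p * w) * \prod_(q <- t) o q).
  apply: IH => //; rewrite -[0](subrr x2) {2}yE.
  by apply: symliftB => //; apply: symlift_N.
(* On the norm [N y] the factor b acts as [n h], so the vanishing image is n times the norm of
   [x1 + h y]; [induced_ker] then applies. *)
have Nz : N p * (x1 + h p * y) = 0.
  apply: (tfR_natl tfR n_gt0); rewrite -/(n p) -[RHS]xE {1}yE -/(N p) /b.
  apply/eqP; rewrite -subr_eq0; apply/eqP.
  transitivity ((N p * N p - N p * n p) * (1 - h p) * y); first by ring.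
  by rewrite NN subrr !mul0r.
have lz : symlift s (x1 + h p * y) (v1 + h p * w).
  by apply: symliftD => //; apply: symlift_h.
have Lz : level (dist_level s) (x1 + h p * y) by apply/symlift_level; eexists; exact: lz.
have [z [Lzt zE]] := induced_ker tauM iL Lz Nz.
have /choice[u lu] : forall g, exists u, symlift s (z g) u.
  by move=> g; apply/symlift_level.
have lS : symlift s 0 (v1 + h p * w - \sum_(g in H p) (tau g - 1) * u g).
  rewrite -[X in symlift s X](subrr (x1 + h p * y)) [X in _ - X]zE.
  apply: symliftB => //; apply: symlift_sum => g _; rewrite !mulrBl !mul1r.
  by apply: symliftB => //; apply: symlift_tau.
have W2 : W ((v1 + h p * w - \sum_(g in H p) (tau g - 1) * u g)
             * \prod_(q <- p :: t) o q).
  apply: (IH _ (p :: t) lS) => //.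
  - by move=> r; rewrite inE => /orP[/eqP->|/tP].
  move=> r rs; rewrite inE negb_or st' // andbT.
  by apply: contraNneq ps => <-.
have W3 := symlift_rel_W lw pP ps pt sP' tP.
have o0 : o p * \sum_(g in H p) (tau g - 1) * u g = 0.
  rewrite big_distrr big1 //= => g gH.
  by rewrite mulrA mulrBr mulr1 o_tau // subrr mul0r.
(* The first two terms lie in [W] by induction, the third by [rel_W]; they add up because [o p]
   kills the sum over [tau g - 1]. *)
have -> : (o p * v1 + v2) * \prod_(q <- t) o q =
   (v1 + h p * w - \sum_(g in H p) (tau g - 1) * u g) * \prod_(q <- p :: t) o q
   + (v2 - N p * w) * \prod_(q <- t) o q
   + (N p - h p * o p) * (w * \prod_(q <- t) o q).
  rewrite big_cons; set O := \prod_(q <- t) o q; set S := \sum_(g in _) _ in o0 *.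
  apply/eqP; rewrite -subr_eq0; apply/eqP.
  by transitivity (o p * S * O); [ring | rewrite o0 mul0r].
by apply: subgroup_predD => //; apply: subgroup_predD.
Qed.

Variable E : {additive R -> R}.
Hypothesis E_tau : forall g x, E (tau g * x) = tau g * E x.
Hypothesis E_o : forall s t, perm_eq (s ++ t) P ->
  E (\prod_(p <- s) o p) = \prod_(p <- s) (N p * n p) * \prod_(p <- t) b p.

(** Stated for a splitting of the primes outside s: at those of t the component is 0 and the factor
    is [N n], at those of u it is a unit and the factor is [b]. The case of interest has t and u
    empty. *)
Lemma symlift_E s t u x v : symlift s x v -> perm_eq (s ++ t ++ u) P ->
  E (v * \prod_(p <- t) o p) =
    x * (\prod_(p <- t) (N p * n p) * \prod_(p <- u) b p).
Proof.
elim: s t u x v => [|p s IH] t u x v /=.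
  move=> [/span_L0[a ->] <-] tu; rewrite !big_distrl /= raddf_sum.
  apply: eq_bigr => g _; by rewrite !mulrzAl raddfMz /= E_tau (E_o tu).
move=> [x1 [v1 [x2 [v2 [l1 l2 -> ->]]]]] stu.
rewrite [(_ + v2) * _]mulrDl raddfD /= (IH t (p :: u) x2 v2 l2); last first.
  apply: perm_trans stu; apply/seq.permP => a.
  by rewrite /= !count_cat /= ?count_cat; lia.
have := IH (p :: t) u x1 v1 l1; rewrite !big_cons mulrA [v1 * _]mulrC => ->.
  by ring.
by apply: perm_trans stu; apply/seq.permP => a; rewrite /= !count_cat /= ?count_cat; lia.
Qed.

End Presentation.

(** * The monoid ring of the multiplicative monoid Z/m *)

Section MonoidRing.
Variable m : nat.

(** The same functions as [symbols m], now with the product induced by the whole multiplicative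
    monoid of Z/m. Zero divisors matter: setting a component of a symbol to 0 is multiplication by
    the symbol of an idempotent. *)
Definition mring := {ffun 'Z_m -> int}.
HB.instance Definition _ := GRing.Zmodule.on mring.

Definition mring_mul (x y : mring) : mring :=
  [ffun k => \sum_i \sum_j x i * y j * (i * j == k)%:R].
Definition mring_one : mring := [ffun k => (k == 1)%:R].

Lemma sum_delta (F : 'Z_m -> int) (k : 'Z_m) : \sum_i F i * (i == k)%:R = F k.
Proof.
rewrite (bigD1 k) //= eqxx mulr1 big1 ?addr0 // => i /negbTE->.
by rewrite mulr0.
Qed.

Lemma mring_mulC : commutative mring_mul.
Proof.
move=> x y; apply/ffunP => k; rewrite !ffunE exchange_big /=.
by apply: eq_bigr => i _; apply: eq_bigr => j _; rewrite [y i * _]mulrC [i * _]mulrC.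
Qed.

Lemma mring_mul3E (x y z : mring) k : mring_mul x (mring_mul y z) k =
  \sum_i \sum_j \sum_l x i * y j * z l * (i * j * l == k)%:R.
Proof.
rewrite ffunE; apply: eq_bigr => i _.
under eq_bigr do rewrite ffunE.
transitivity (\sum_a \sum_j \sum_l
    x i * y j * z l * (i * a == k)%:R * (j * l == a)%:R).
  apply: eq_bigr => a _; rewrite big_distrr big_distrl /=.
  apply: eq_bigr => j _; rewrite big_distrr big_distrl /=.
  by apply: eq_bigr => l _; ring.
rewrite exchange_big /=; apply: eq_bigr => j _.
rewrite exchange_big /=; apply: eq_bigr => l _.
under eq_bigr do rewrite [j * l == _]eq_sym.
by rewrite (sum_delta (fun a => _ * (i * a == k)%:R)) mulrA.
Qed.

Lemma mring_mulA : associative mring_mul.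
Proof.
move=> x y z; rewrite [RHS]mring_mulC; apply/ffunP => k.
rewrite !mring_mul3E [RHS]exchange_big /=; apply: eq_bigr => i _.
rewrite [RHS]exchange_big /=; apply: eq_bigr => j _; apply: eq_bigr => l _.
rewrite (_ : l * i * j = i * j * l); last by rewrite -mulrA mulrC.
by ring.
Qed.

Lemma mring_mul1 : left_id mring_one mring_mul.
Proof.
move=> x; apply/ffunP => k; rewrite ffunE (bigD1 1) //=.
rewrite [X in _ + X]big1 => [|i /negbTE i1].
  rewrite addr0 -[RHS]sum_delta; apply: eq_bigr => j _.
  by rewrite ffunE eqxx !mul1r.
by rewrite big1 // => j _; rewrite ffunE i1 !mul0r.
Qed.

Lemma mring_mulDl : left_distributive mring_mul +%R.
Proof.
move=> x y z; apply/ffunP => k; rewrite !ffunE -big_split; apply: eq_bigr => i _.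
rewrite -big_split; apply: eq_bigr => j _.
by rewrite ffunE /= !mulrDl.
Qed.

Lemma mring_one_neq0 : mring_one != 0.
Proof.
by apply/eqP => /ffunP/(_ 1); rewrite !ffunE eqxx.
Qed.

HB.instance Definition _ := GRing.Zmodule_isComNzRing.Build mring
  mring_mulA mring_mulC mring_mul1 mring_mulDl mring_one_neq0.

Definition bas (a : 'Z_m) : mring := symbol a.

Lemma mringM (x y : mring) k :
  (x * y) k = \sum_i \sum_j x i * y j * (i * j == k)%:R.
Proof. by rewrite ffunE. Qed.

Lemma mring_torsion_free (x : mring) n : (0 < n)%N -> x *+ n = 0 -> x = 0.
Proof.
move=> n0 /ffunP xn; apply/ffunP => k; have := xn k.
rewrite ffunMnE !ffunE => /eqP.
by rewrite Num.Theory.mulrn_eq0 eqn0Ngt n0 => /eqP.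
Qed.

Lemma bas1 : bas 1 = 1.
Proof. by apply/ffunP => k; rewrite !ffunE. Qed.

Lemma basM a b : bas (a * b) = bas a * bas b.
Proof.
apply/ffunP => k; rewrite mringM (bigD1 a) //= [X in _ + X]big1 => [|i /negbTE ia].
  rewrite addr0 (bigD1 b) //= big1 => [|j /negbTE jb].
    by rewrite addr0 !ffunE !eqxx mul1r eq_sym.
  by rewrite !ffunE jb mulr0 mul0r.
by rewrite big1 // => j _; rewrite !ffunE ia !mul0r.
Qed.

Lemma bas_sum (x : mring) : x = \sum_a bas a *~ x a.
Proof.
apply/ffunP => k; rewrite sum_ffunE -[LHS]sum_delta; apply: eq_bigr => a _.
by rewrite ffunMzE ffunE [in RHS]eq_sym -mulrzr intz mulrC.
Qed.

Definition mring_aug (x : mring) : int := \sum_k x k.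

Lemma mring_aug_is_zmod_morphism : zmod_morphism mring_aug.
Proof.
by move=> x y; rewrite /mring_aug -sumrB; apply: eq_bigr => i _; rewrite !ffunE.
Qed.
HB.instance Definition _ :=
  GRing.isZmodMorphism.Build mring int mring_aug mring_aug_is_zmod_morphism.

Lemma mring_aug_is_monoid_morphism : monoid_morphism mring_aug.
Proof.
split=> [|x y]; rewrite /mring_aug.
  by under eq_bigr do rewrite ffunE -[_%:R]mul1r; rewrite (sum_delta (fun=> 1)).
under eq_bigr do rewrite mringM.
rewrite exchange_big big_distrl /=; apply: eq_bigr => i _.
rewrite exchange_big big_distrr /=; apply: eq_bigr => j _.
under eq_bigr do rewrite eq_sym.
by rewrite (sum_delta (fun=> _)).
Qed.
HB.instance Definition _ :=
  GRing.isMonoidMorphism.Build mring int mring_aug mring_aug_is_monoid_morphism.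

Lemma mring_aug_bas a : mring_aug (bas a) = 1.
Proof.
rewrite /mring_aug; under eq_bigr do rewrite ffunE -[_%:R]mul1r.
by rewrite (sum_delta (fun=> 1)).
Qed.

End MonoidRing.

(** * Idempotents of Z/m *)

Section Idempotents.
Variable m : nat.
Hypothesis m_gt1 : (1 < m)%N.

Let m_gt0 : (0 < m)%N. Proof. exact: ltnW. Qed.

Lemma natr_eqZ (a b : nat) : a%:R = b%:R :> 'Z_m <-> a = b %[mod m].
Proof.
split=> [/(congr1 val) /= | ab]; first by rewrite !val_Zp_nat.
by apply: val_inj; rewrite /= !val_Zp_nat.
Qed.

Lemma eq_mod_coprime p a b : prime p ->
  a = b %[mod m] <-> a = b %[mod m`_p] /\ a = b %[mod m`_p^'].
Proof.
move=> pp; have co : coprime m`_p m`_p^' by exact: coprime_partC.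
rewrite -{1 2}(partnC p m_gt0); split=> [/eqP | [/eqP ab /eqP ab']].
  by rewrite chinese_remainder // => /andP[/eqP ? /eqP ?].
by apply/eqP; rewrite chinese_remainder // ab.
Qed.

(** 1 modulo the p-part of m and 0 modulo the rest: multiplication by it projects to the component
    at p and turns congruences modulo the p-part into equations in Z/m. *)
Definition idem (p : nat) : 'Z_m := (chinese m`_p m`_p^' 1 0)%:R.
Definition cidem (p : nat) : 'Z_m := 1 - idem p.

Lemma natr_idem p a b : prime p ->
  a%:R * idem p = b%:R * idem p <-> a = b %[mod m`_p].
Proof.
move=> pp; have co : coprime m`_p m`_p^' by exact: coprime_partC.
rewrite /idem -!natrM natr_eqZ (eq_mod_coprime _ _ pp).
set E := chinese _ _ _ _.
have E1 n : n * E = n %[mod m`_p].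
  by rewrite -modnMmr chinese_modl // modnMmr muln1.
have E0 n : n * E = 0 %[mod m`_p^'].
  by rewrite -modnMmr chinese_modr // modnMmr muln0.
by rewrite !E1 !E0; split=> [[]|].
Qed.

Lemma part_gt1 p : p \in primes m -> (1 < m`_p)%N.
Proof.
move=> pm; rewrite p_part -[1%N](expn0 p) ltn_exp2l ?logn_gt0 //.
by apply: prime_gt1; move: pm; rewrite mem_primes => /andP[].
Qed.

Lemma idemK p : prime p -> idem p * idem p = idem p.
Proof.
move=> pp; rewrite -[RHS]mul1r; apply/(natr_idem _ 1 pp).
by rewrite chinese_modl // coprime_partC.
Qed.

Lemma idem_orth p q : prime p -> prime q -> p != q -> idem p * idem q = 0.
Proof.
move=> pp pq npq; rewrite -[RHS](mul0r (idem q)); apply/(natr_idem _ 0 pq).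
apply/eqP; rewrite mod0n -/(_ %| _)%N.
have d : (m`_q %| m`_p^')%N.
  by apply: sub_in_partn => r _ /eqnP -> ; rewrite !inE eq_sym.
apply: dvdn_trans d _; apply/eqP.
by rewrite chinese_modr ?mod0n // coprime_partC.
Qed.

Lemma idem_sep (x y : 'Z_m) :
  (forall p, p \in primes m -> x * idem p = y * idem p) -> x = y.
Proof.
move=> xy; rewrite -[x]natr_Zp -[y]natr_Zp; apply/natr_eqZ.
apply/eqP; wlog le : x y xy / (y <= x)%N => [W|].
  have [/W|/ltnW /W] := leqP (y : nat) (x : nat); first by apply.
  by rewrite eq_sym; apply=> p /xy.
rewrite eqn_mod_dvd //; apply/dvdn_partP => // p pm.
rewrite -eqn_mod_dvd //; apply/eqP/natr_idem.
  by move: pm; rewrite mem_primes => /andP[].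
by rewrite !natr_Zp; apply: xy.
Qed.

Lemma pexp_idem p : prime p -> p%:R ^+ logn p m * idem p = 0.
Proof.
move=> pp; rewrite -natrX -[RHS](mul0r (idem p)).
by apply/(natr_idem _ 0 pp); rewrite p_part modnn mod0n.
Qed.

Lemma pexp_idem_neq0 p : p \in primes m -> p%:R ^+ (logn p m).-1 * idem p != 0.
Proof.
move=> pm; have pp : prime p by move: pm; rewrite mem_primes => /andP[].
apply/eqP; rewrite -natrX -[RHS](mul0r (idem p)) => /(natr_idem _ 0 pp) /eqP.
rewrite p_part mod0n -/(_ %| _)%N pfactor_dvdn ?expn_gt0 ?prime_gt0 //.
rewrite pfactorK //.
have : (0 < logn p m)%N by rewrite logn_gt0.
by case: (logn p m) => //= k _; rewrite ltnn.
Qed.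

(** With e the exponent of p in m, the power p^(e-1) tests divisibility by p: its product with x
    vanishes at p exactly when p divides x, and otherwise x is a unit at p. *)
Lemma idem_dvd p (x : 'Z_m) : p \in primes m ->
  p%:R ^+ (logn p m).-1 * x * idem p = 0 -> exists y, x = p%:R * y.
Proof.
move=> pm; have pp : prime p by move: pm; rewrite mem_primes => /andP[].
rewrite -[x]natr_Zp -natrX -natrM -[RHS](mul0r (idem p)).
move=> /(natr_idem _ 0 pp) /eqP; rewrite p_part mod0n -/(_ %| _)%N.
have : (0 < logn p m)%N by rewrite logn_gt0.
case: (logn p m) => //= e _; rewrite expnSr dvdn_pmul2l ?expn_gt0 ?prime_gt0 //.
by case/dvdnP=> k ->; exists k%:R; rewrite natrM mulrC.
Qed.

Lemma idem_inv p (x : 'Z_m) : p \in primes m ->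
  p%:R ^+ (logn p m).-1 * x * idem p != 0 -> exists y, x * y * idem p = idem p.
Proof.
move=> pm; have pp : prime p by move: pm; rewrite mem_primes => /andP[].
rewrite -[x]natr_Zp => xn0.
have px : coprime x m`_p.
  rewrite p_part coprimeXr // coprime_sym prime_coprime //; apply/negP.
  case/dvdnP=> k xE; move/eqP: xn0; apply.
  rewrite xE natrM [k%:R * _]mulrC mulrA -exprSr prednK ?logn_gt0 //.
  by rewrite mulrAC pexp_idem // mul0r.
have [x0 | x_gt0] := posnP x.
  by move: px; rewrite x0 /coprime gcd0n => /eqP E; have := part_gt1 pm; rewrite E.
have [k l kl _] := egcdnP m`_p x_gt0; exists k%:R.
rewrite -[RHS]mul1r -natrM; apply/(natr_idem _ 1 pp).
by rewrite mulnC kl (eqP px) modnMDl.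
Qed.

Lemma cidem_inv p : prime p -> exists y, p%:R * y * cidem p = cidem p.
Proof.
move=> pp; have px : coprime p m`_p^'.
  by have := @coprime_partC p p m; rewrite (part_pnat_id _) ?pnat_id // => ->.
have [k l kl _] := egcdnP m`_p^' (prime_gt0 pp); exists k%:R.
apply: idem_sep => q qm; have pq : prime q by move: qm; rewrite mem_primes => /andP[].
have [-> | qp] := eqVneq q p.
  by rewrite /cidem -!mulrA mulrBl mul1r idemK // subrr !mulr0.
rewrite -mulrA /cidem mulrBl mul1r idem_orth 1?eq_sym // subr0 -natrM.
rewrite -[RHS]mul1r; apply/(natr_idem _ 1 pq).
have /dvdnP[d dE] : (m`_q %| m`_p^')%N.
  by apply: sub_in_partn => r _ /eqnP -> ; rewrite !inE.
by rewrite mulnC kl (eqP px) dE mulnA modnMDl.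
Qed.

Lemma idem_dec p (a : 'Z_m) : p \in primes m -> a * idem p != 0 ->
  exists k (b : 'Z_m), [/\ (k < logn p m)%N,
    exists y, b * y * idem p = idem p & a * idem p = p%:R ^+ k * b * idem p].
Proof.
move=> pm; have pp : prime p by move: pm; rewrite mem_primes => /andP[].
have e_gt0 : (0 < logn p m)%N by rewrite logn_gt0.
set e := logn p m.
(* k counts the factors p already divided out; the product of p^k with the current quotient stays
   nonzero at p, which keeps k below e. *)
suff W k : p%:R ^+ k * a * idem p != 0 -> (k < e)%N ->
   exists j (b : 'Z_m), [/\ (j < e)%N,
    exists y, b * y * idem p = idem p & a * idem p = p%:R ^+ j * b * idem p].
  by move=> an0; apply: (W 0%N); rewrite // expr0 mul1r.
have [n] := ubnP (e - k)%N; elim: n k a => // n IH k a kn an0 ke.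
have [E | E] := eqVneq (p%:R ^+ e.-1 * a * idem p) 0; last first.
  exists 0%N, a; split; [by rewrite (leq_trans _ ke) | exact: idem_inv |].
  by rewrite expr0 mul1r.
have [y aE] := idem_dvd pm E.
have an1 : p%:R ^+ k.+1 * y * idem p != 0.
  by rewrite exprSr -[_ * p%:R * y]mulrA -aE.
have ke1 : (k.+1 < e)%N.
  rewrite ltn_neqAle ke andbT; apply: contraNneq an1 => ->.
  by rewrite mulrAC pexp_idem ?mul0r.
have [|j [b [je bu yE]]] := IH k.+1 y _ an1 ke1; first by lia.
exists j.+1, b; split=> //; last by rewrite aE -mulrA yE exprS !mulrA.
rewrite ltn_neqAle je andbT; apply: contraNneq an0 => je1.
have a0 : a * idem p = 0.
  by rewrite aE -mulrA yE !mulrA -exprS je1 mulrAC pexp_idem ?mul0r.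
by rewrite -mulrA a0 mulr0.
Qed.

Lemma idem_crt (y : nat -> 'Z_m) :
  exists x, forall p, p \in primes m -> x * idem p = y p * idem p.
Proof.
exists (\sum_(q <- primes m) y q * idem q) => p pm.
have pp : prime p by move: pm; rewrite mem_primes => /andP[].
rewrite (big_rem p) //= mulrDl -mulrA idemK // big_distrl /= big1_seq ?addr0 //.
move=> q /andP[_]; rewrite mem_rem_uniq ?primes_uniq // inE => /andP[/= qp].
by rewrite mem_primes => /andP[pq _]; rewrite -mulrA idem_orth // mulr0.
Qed.

(** If -1 equals 1 at p, the p-part of m divides 2, hence is 2; then m is twice an odd number. *)
Lemma idem2_neq0 p : m <> 2 %[mod 4] -> p \in primes m -> -1 * idem p != idem p.
Proof.
move=> m2 pm; have pp : prime p by move: pm; rewrite mem_primes => /andP[].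
apply/eqP => E; apply: m2.
have /(natr_idem 2 0 pp) /eqP : 2%:R * idem p = 0%:R * idem p.
  by rewrite mul0r mulr2n mulrDl mul1r -{1}E mulN1r addNr.
rewrite mod0n -/(_ %| _)%N => p2.
have pE : (m`_p = 2)%N.
  have := part_gt1 pm; have := dvdn_leq (isT : 0 < 2)%N p2.
  by case: (m`_p)%N => [|[|[|?]]].
have p2' : p = 2%N.
  by apply/eqP; rewrite -dvdn_prime2 // -pE p_part dvdn_exp // logn_gt0.
have := partnC 2%N m_gt0; rewrite -p2' pE p2' => <-.
have : odd (m`_2%N^')%N.
  have := coprime_partC 2%N m m; rewrite -p2' pE p2'.
  by rewrite coprime2n.
move: (m`_2%N^')%N => k kodd; rewrite -(odd_double_half k) kodd -muln2 /=.
by move: (k./2) => j; lia.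
Qed.

End Idempotents.

(** * The unit group of Z/m *)

Section UnitGroup.
Variable m : nat.
Hypothesis m_gt1 : (1 < m)%N.
Notation gT := {unit 'Z_m}.
Notation idem := (@idem m).
Notation cidem := (@cidem m).

Definition tau (g : gT) : mring m := bas (val g).

Lemma unit_commute (g h : gT) : commute g h.
Proof. by apply: val_inj; rewrite /= mulrC. Qed.

Lemma tau1 : tau 1%g = 1. Proof. exact: bas1. Qed.

Lemma tauM g h : tau (g * h)%g = tau g * tau h. Proof. exact: basM. Qed.

Lemma val_unitM (g h : gT) : val (g * h)%g = val g * val h :> 'Z_m.
Proof. by []. Qed.

Lemma unit_of_inv (x y : 'Z_m) : x * y = 1 -> exists g : gT, val g = x.
Proof.
move=> xy; have ux : x \is a GRing.unit by apply/unitrP; exists y; rewrite mulrC xy.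
by exists (FinRing.unit _ ux).
Qed.

Lemma primesP p : p \in primes m -> prime p.
Proof. by rewrite mem_primes => /andP[]. Qed.

Fact idem_fix_group_set (x : 'Z_m) : group_set [set g : gT | val g * x == x].
Proof.
apply/group_setP; split=> [|g h]; first by rewrite inE mul1r.
by rewrite !inE val_unitM => /eqP gx /eqP hx; rewrite -mulrA hx gx.
Qed.
Definition fixgroup x := Group (idem_fix_group_set x).

Lemma fixgroupP x g : reflect (val g * x = x) (g \in fixgroup x).
Proof. by rewrite inE; apply: eqP. Qed.

(** Subgroups are encoded by the idempotent they fix: fixing [cidem p] means component 1 away from
    p, fixing [idem p] means component 1 at p. *)
Definition comp_group p := fixgroup (cidem p).
Definition comp_ker p := fixgroup (idem p).

Lemma comp_group_sub p q : p \in primes m -> q \in primes m -> q != p ->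
  comp_group p \subset comp_ker q.
Proof.
move=> /primesP pp /primesP pq qp; apply/subsetP => g /fixgroupP gp.
apply/fixgroupP; have qE : idem q = cidem p * idem q.
  by rewrite /cidem mulrBl mul1r idem_orth 1?eq_sym // subr0.
by rewrite qE mulrA gp.
Qed.

Lemma comp_group_ti p : p \in primes m -> (comp_group p :&: comp_ker p = 1)%g.
Proof.
move=> pm; apply/trivgP/subsetP => g /setIP[/fixgroupP gp /fixgroupP gq].
rewrite inE; apply/eqP/val_inj; rewrite /= -[LHS]mulr1.
have -> : 1 = cidem p + idem p by rewrite /cidem subrK.
by rewrite mulrDr gp gq.
Qed.

Lemma comp_unitP p (x : 'Z_m) : p \in primes m ->
  (exists y, x * y * idem p = idem p) ->
  exists2 g : gT, g \in comp_group p & val g * idem p = x * idem p.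
Proof.
move=> /primesP pp [y xy]; have ee := idemK m_gt1 pp.
have [|g gE] := @unit_of_inv (x * idem p + cidem p) (y * idem p + cidem p).
  transitivity (x * y * idem p * idem p + (1 - idem p) +
    (x + y - 1) * (idem p - idem p * idem p)).
    by rewrite /cidem; ring.
  by rewrite xy ee; ring.
exists g; [apply/fixgroupP|]; rewrite gE.
  transitivity (cidem p + (1 - x) * (idem p * idem p - idem p)).
    by rewrite /cidem; ring.
  by rewrite ee subrr mulr0 addr0.
transitivity (x * (idem p * idem p) + (idem p - idem p * idem p)).
  by rewrite /cidem; ring.
by rewrite ee subrr addr0.
Qed.

Definition unit_comp p (g : gT) : gT :=
  odflt 1%g [pick h in comp_group p | val h * idem p == val g * idem p].

Lemma compP p g : p \in primes m ->
  unit_comp p g \in comp_group p /\ val (unit_comp p g) * idem p = val g * idem p.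
Proof.
move=> pm; rewrite /unit_comp; case: pickP => [h /andP[hp /eqP hE] //|] /=.
have [|h hp hE] := @comp_unitP p (val g) pm.
  by exists (val g^-1%g); rewrite -val_unitM mulgV mul1r.
by move/(_ h); rewrite hp hE eqxx.
Qed.

Lemma prod_comp_idem (u : nat -> gT) (s : seq nat) q :
    (forall p, p \in primes m -> u p \in comp_group p) ->
    uniq s -> {subset s <= primes m} -> q \in primes m ->
  val (\prod_(p <- s) u p)%g * idem q = (if q \in s then val (u q) else 1) * idem q.
Proof.
move=> uP + + qm; elim: s => [|p s IH] /= => [_ _|/andP[ps us] sP].
  by rewrite big_nil.
have sP' : {subset s <= primes m} by move=> r rs; apply: sP; rewrite inE rs orbT.
rewrite big_cons val_unitM -mulrA IH // inE.
have [-> | qp] := eqVneq q p; first by rewrite (negbTE ps) mul1r.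
have pm : p \in primes m by apply: sP; rewrite inE eqxx.
have /fixgroupP uq := subsetP (comp_group_sub pm qm qp) _ (uP p pm).
by rewrite mulrCA uq.
Qed.

Lemma prod_comp g : (\prod_(p <- primes m) unit_comp p g)%g = g.
Proof.
apply/val_inj/(idem_sep m_gt1) => q qm.
rewrite prod_comp_idem ?primes_uniq ?qm //; first by case: (compP g qm).
by move=> p pm; case: (compP g pm).
Qed.

Lemma comp_gen g : exists2 u : nat -> gT,
  forall p, p \in primes m -> u p \in comp_group p &
  g = (\prod_(p <- primes m) u p)%g.
Proof.
exists (unit_comp^~ g); last by rewrite prod_comp.
by move=> p pm; case: (compP g pm).
Qed.

Lemma opp_unit : exists g : gT, val g = -1.
Proof. by apply: (@unit_of_inv _ (-1)); rewrite mulrNN mulr1. Qed.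
Definition opp1 : gT := odflt 1%g [pick h : gT | val h == -1].
Lemma opp1E : val opp1 = -1.
Proof.
rewrite /opp1; case: pickP => [h /eqP //|/=]; have [g gE] := opp_unit.
by move/(_ g); rewrite gE eqxx.
Qed.

Lemma opp1_sqr : (opp1 * opp1 = 1)%g.
Proof. by apply: val_inj; rewrite val_unitM opp1E mulrNN mulr1. Qed.

Lemma opp1_comp_ker p : m <> 2 %[mod 4] -> p \in primes m -> opp1 \notin comp_ker p.
Proof.
move=> m2 pm; apply/fixgroupP; rewrite opp1E; apply/eqP.
exact: idem2_neq0.
Qed.

(** The Frobenius of p, acting as p away from p, is extended by 1 at p. By [frobE] the default value
    is never taken when p divides m. *)
Definition frob p : gT := odflt 1%g [pick h : gT | val h == idem p + p%:R * cidem p].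
Lemma frobE p : p \in primes m -> val (frob p) = idem p + p%:R * cidem p.
Proof.
move=> /primesP pp; rewrite /frob; case: pickP => [h /eqP //|/=].
have [y yE] := cidem_inv m_gt1 pp; have ee := idemK m_gt1 pp.
have [|g gE] := @unit_of_inv (idem p + p%:R * cidem p) (idem p + y * cidem p).
  transitivity (idem p + p%:R * y * cidem p +
     (idem p * idem p - idem p) * (1 + p%:R * y - p%:R - y)).
    by rewrite /cidem; ring.
  by rewrite yE ee /cidem; ring.
by move/(_ g); rewrite gE eqxx.
Qed.

Lemma frob_idem p : p \in primes m -> val (frob p) * idem p = idem p.
Proof.
move=> pm; have ee := idemK m_gt1 (primesP pm); rewrite frobE //.
transitivity (idem p * idem p + p%:R * (idem p - idem p * idem p)).
  by rewrite /cidem; ring.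
by rewrite ee subrr mulr0 addr0.
Qed.

Lemma frob_cidem p : p \in primes m -> val (frob p) * cidem p = p%:R * cidem p.
Proof.
move=> pm; have ee := idemK m_gt1 (primesP pm); rewrite frobE //.
transitivity (p%:R * cidem p + (idem p - idem p * idem p) * (1 - p%:R)).
  by rewrite /cidem; ring.
by rewrite ee subrr mul0r addr0.
Qed.

Definition unit_span (x : mring m) : Prop :=
  exists a : gT -> int, x = \sum_g tau g *~ a g.

Lemma tau_coef (a : gT -> int) g : (\sum_h tau h *~ a h) (val g) = a g.
Proof.
have basE (b k : 'Z_m) : bas b k = (k == b)%:R by rewrite ffunE.
rewrite sum_ffunE (bigD1 g) //= big1 => [|h hg].
  by rewrite ffunMzE /tau basE eqxx addr0 -mulrzr intz mul1r.
by rewrite ffunMzE /tau basE (inj_eq val_inj) eq_sym (negbTE hg) mul0rz.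
Qed.

Lemma unit_span_lattice : lattice tau unit_span.
Proof.
split; first by exists (fun=> 0); rewrite big1.
  move=> _ _ [a ->] [b ->]; exists (fun g => a g - b g).
  by rewrite -sumrB; apply: eq_bigr => g _; rewrite mulrzBr.
move=> g _ [a ->]; exists (fun h => a (g^-1 * h)%g).
rewrite big_distrr /= [RHS](reindex_inj (mulgI g)) /=; apply: eq_bigr => h _.
by rewrite mulKg tauM mulrzAr.
Qed.

Lemma unit_span1 : unit_span 1.
Proof.
exists (fun g => if g == 1%g then 1 else 0); rewrite (bigD1 1%g) //=.
rewrite [X in _ + X]big1 => [|g]; first by rewrite addr0 tau1.
by move=> /= /negbTE->; rewrite mulr0z.
Qed.

Lemma sum_coset (K : {group gT}) (A : zmodType) (F : gT -> A) :
  \sum_(k in K) \sum_(g | g == repr (K :* g)%g) F (k * g)%g = \sum_u F u.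
Proof.
rewrite pair_big_dep /=.
rewrite [RHS](reindex_onto (fun p : gT * gT => (p.1 * p.2)%g)
  (fun u => (u * (repr (K :* u))^-1, repr (K :* u))%g)) /=; last first.
  by move=> u _; rewrite mulgKV.
apply: eq_bigl => -[k g] /=; apply/andP/eqP => [[kK /eqP gE] | [kE gE]].
  by rewrite rcosetM rcoset_id // -gE mulgK.
have gK : g \in (K :* (k * g))%g by rewrite -{1}gE mem_repr_rcoset.
have kK : k \in K.
  by move: gK; rewrite mem_rcoset invMg mulgA mulgV mul1g groupV.
by split=> //; rewrite rcosetM rcoset_id in gE; rewrite // gE.
Qed.

(** Representatives of the right cosets of K form a basis of Z[G] over Z[K]; the witness is their
    Z-span. *)
Lemma unit_span_induced (K : {group gT}) : induced tau K unit_span.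
Proof.
pose T (g : gT) := g == repr (K :* g)%g.
exists (fun x => exists a : gT -> int, x = \sum_(g | T g) tau g *~ a g); split.
- split; first by exists (fun=> 0); rewrite big1.
  move=> _ _ [a ->] [b ->]; exists (fun g => a g - b g).
  by rewrite -sumrB; apply: eq_bigr => g _; rewrite mulrzBr.
- move=> _ [a ->]; exists (fun g => if T g then a g else 0).
  by rewrite big_mkcond; apply: eq_bigr => g _; case: ifP.
- move=> _ [a ->]; exists (fun k => \sum_(g | T g) tau g *~ a (k * g)%g).
  split; first by move=> k; exists (fun g => a (k * g)%g).
  rewrite -(sum_coset K); apply: eq_bigr => k kK; rewrite big_distrr /=.
  by apply: eq_bigr => g _; rewrite tauM mulrzAr.
move=> a /choice[b aE] a0 k kK.
rewrite aE big1 // => g Tg; rewrite -[RHS](mulr0z (tau g)); congr (_ *~ _).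
pose B u := b (u * (repr (K :* u))^-1)%g (repr (K :* u)%g).
have BE h t : h \in K -> T t -> B (h * t)%g = b h t.
  by move=> hK /eqP tT; rewrite /B rcosetM rcoset_id // -tT mulgK.
rewrite -BE // -tau_coef -(sum_coset K).
have -> : \sum_(h in K) \sum_(t | T t) tau (h * t)%g *~ B (h * t)%g = 0.
  rewrite -[RHS]a0; apply: eq_bigr => h hK; rewrite aE big_distrr /=.
  by apply: eq_bigr => t Tt; rewrite tauM mulrzAr BE.
by rewrite ffunE.
Qed.

End UnitGroup.

Arguments comp_group : simpl never.
Arguments comp_ker : simpl never.

(** * The distribution relations *)

Section DistributionRelations.
Variable m : nat.
Hypothesis m_gt1 : (1 < m)%N.
Notation gT := {unit 'Z_m}.
Notation idem := (@idem m).
Notation cidem := (@cidem m).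
Notation tau := (@tau m).

Definition comp0 (p : nat) : mring m := bas (cidem p).
Definition frob_hi p : gT := (frob m p ^+ logn p m)%g.
Definition frob_lo p : gT := (frob m p ^+ (logn p m).-1)%g.
Definition dist_span (x : mring m) : Prop := x \in zspan (@distribution_rel m).

Lemma dist_span_subgroup : subgroup_pred dist_span.
Proof. by split=> [|x y]; [exact: rpred0 | exact: rpredB]. Qed.

Lemma dist_span_rel n (x : 'Z_m) : (n %| m)%N ->
  dist_span (bas (n%:R * x) - \sum_(b : 'Z_m | n%:R * b == n%:R * x) bas b).
Proof.
move=> nm; apply: mem_zspan; exists n, (n%:R * x); split=> //.
  by exists x; rewrite mulr_natl.
by congr (_ - _); apply: eq_bigl => b; rewrite mulr_natl.
Qed.

Lemma comp0_tau p t : t \in comp_group m p -> comp0 p * tau t = comp0 p.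
Proof. by move=> /fixgroupP tp; rewrite /comp0 /tau -basM mulrC tp. Qed.

Lemma cidem_cancel p k (x y : 'Z_m) : p \in primes m ->
  p%:R ^+ k * x * cidem p = p%:R ^+ k * y * cidem p -> x * cidem p = y * cidem p.
Proof.
move=> pm; have [z zE] := cidem_inv m_gt1 (primesP pm).
have zkE : p%:R ^+ k * z ^+ k * cidem p = cidem p.
  rewrite -exprMn; elim: k => [|k IH]; first by rewrite expr0 mul1r.
  by rewrite exprSr -mulrA zE IH.
move=> /(congr1 ( *%R (z ^+ k))) E.
transitivity (p%:R ^+ k * z ^+ k * cidem p * x); first by rewrite zkE mulrC.
transitivity (p%:R ^+ k * z ^+ k * cidem p * y); last by rewrite zkE mulrC.
transitivity (z ^+ k * (p%:R ^+ k * x * cidem p)); first by ring.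
by rewrite E; ring.
Qed.

Lemma frobX_cidem p k : p \in primes m ->
  val (frob m p ^+ k)%g * cidem p = p%:R ^+ k * cidem p.
Proof.
move=> pm; elim: k => [|k IH]; first by rewrite expr0.
by rewrite expgS val_unitM -mulrA IH mulrCA frob_cidem // mulrA -exprSr.
Qed.

(** The relations for p^e at x and for p^(e-1) at [cidem p] times x are subtracted. Both fibres
    consist of points that agree with x away from p; the component at p is arbitrary in the first
    and divisible by p in the second. As x is a unit at p, the difference is its orbit under G_p. *)
Lemma dist_span_orbsum p (x : 'Z_m) (g : gT) : p \in primes m ->
    x * idem p = val g * idem p ->
  dist_span ((orbsum tau (comp_group m p)
              - (tau (frob_hi p) - tau (frob_lo p)) * comp0 p) * bas x).
Proof.
move=> pm xg; have pp := primesP pm; have ee := idemK m_gt1 pp.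
have e_gt0 : (0 < logn p m)%N by rewrite logn_gt0.
set e := logn p m in e_gt0 *.
have ide : idem p + cidem p = 1 by rewrite /cidem addrC subrK.
have sep (u v : 'Z_m) : u * idem p = v * idem p -> u * cidem p = v * cidem p -> u = v.
  by move=> uv uv'; rewrite -[u]mulr1 -[v]mulr1 -ide [LHS]mulrDr [RHS]mulrDr uv uv'.
have oo : cidem p * cidem p = cidem p.
  transitivity (cidem p + (idem p * idem p - idem p)); first by rewrite /cidem; ring.
  by rewrite ee subrr addr0.
have eo : cidem p * idem p = 0 by rewrite /cidem mulrBl mul1r ee subrr.
have pe0 : p%:R ^+ e * idem p = 0 by exact: pexp_idem.
have hiE : tau (frob_hi p) * comp0 p * bas x = bas (p%:R ^+ e * x).
  rewrite /tau /comp0 -!basM; congr bas.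
  rewrite /frob_hi frobX_cidem // -/e -[_ * cidem p]add0r -{1}pe0 -mulrDr.
  by rewrite ide mulr1.
have loE : tau (frob_lo p) * comp0 p * bas x = bas (p%:R ^+ e.-1 * (cidem p * x)).
  by rewrite /tau /comp0 -!basM; congr bas; rewrite /frob_lo frobX_cidem // mulrA.
have d1 : (p ^ e %| m)%N by rewrite /e pfactor_dvdn // ltnW.
have d2 : (p ^ e.-1 %| m)%N by rewrite /e pfactor_dvdn ?leq_pred // ltnW.
have W1 := dist_span_rel x d1; have W2 := dist_span_rel (cidem p * x) d2.
rewrite natrX in W1; rewrite natrX in W2.
have NE : orbsum tau (comp_group m p) * bas x =
    \sum_(b : 'Z_m | p%:R ^+ e * b == p%:R ^+ e * x) bas b
    - \sum_(b : 'Z_m | p%:R ^+ e.-1 * b == p%:R ^+ e.-1 * (cidem p * x)) bas b.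
  rewrite /orbsum big_distrl /=.
  under eq_bigr do rewrite /tau -basM.
  rewrite [X in X - _](bigID (fun b => p%:R ^+ e.-1 * b ==
                                p%:R ^+ e.-1 * (cidem p * x))) /=.
  rewrite [X in _ = X + _ - _](eq_bigl (fun b => p%:R ^+ e.-1 * b ==
                                p%:R ^+ e.-1 * (cidem p * x))); last first.
    move=> b; apply: andb_idl => /eqP bE.
    rewrite -(prednK e_gt0) exprS -!mulrA bE; apply/eqP.
    transitivity (p%:R ^+ e * ((idem p + cidem p) * x) - p%:R ^+ e * idem p * x).
      by rewrite -(prednK e_gt0) exprS; ring.
    by rewrite pe0 ide mul1r mul0r subr0 -(prednK e_gt0) exprS mulrA.
  rewrite addrAC subrr add0r.
  have invP b : (p%:R ^+ e * b == p%:R ^+ e * x) &&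
      ~~ (p%:R ^+ e.-1 * b == p%:R ^+ e.-1 * (cidem p * x)) ->
      exists2 t : gT, t \in comp_group m p & val t * x = b.
    move=> /andP[/eqP b1 /eqP b2].
    have bo : b * cidem p = x * cidem p.
      by apply: (@cidem_cancel p e) => //; rewrite b1.
    have [|y yE] := @idem_inv _ m_gt1 p b pm.
      apply/eqP => b0; apply: b2; apply: sep.
        rewrite b0; transitivity (p%:R ^+ e.-1 * x * (cidem p * idem p)).
          by rewrite eo mulr0.
        by ring.
      rewrite -mulrA bo; transitivity (p%:R ^+ e.-1 * x * (cidem p * cidem p)).
        by rewrite oo mulrA.
      by ring.
    have [|t tG tE] := @comp_unitP _ m_gt1 p (b * val g^-1%g) pm.
      exists (val g * y); rewrite -[RHS]yE.
      transitivity (b * y * idem p * (val (g^-1 * g)%g)).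
        by rewrite val_unitM; ring.
      by rewrite mulVg mulr1.
    exists t => //; apply: sep.
      transitivity (val t * (x * idem p)); first by ring.
      rewrite xg; transitivity (val g * (val t * idem p)); first by ring.
      rewrite tE; transitivity (b * idem p * val (g^-1 * g)%g).
        by rewrite val_unitM; ring.
      by rewrite mulVg mulr1.
    have /fixgroupP tc := tG; rewrite mulrAC tc.
    by rewrite mulrC bo.
  have Pinv (t : gT) : t \in comp_group m p ->
      (p%:R ^+ e * (val t * x) == p%:R ^+ e * x) &&
      ~~ (p%:R ^+ e.-1 * (val t * x) == p%:R ^+ e.-1 * (cidem p * x)).
    move=> /fixgroupP tc; apply/andP; split.
      apply/eqP/sep.
        by rewrite ![p%:R ^+ e * _ * idem p]mulrAC pe0 !mul0r.
      transitivity (p%:R ^+ e * (val t * cidem p) * x); first by ring.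
      by rewrite tc; ring.
    apply/eqP => /(congr1 ( *%R (idem p))) E.
    have := pexp_idem_neq0 m_gt1 pm; rewrite -/e; apply/negP/negPn/eqP.
    have : p%:R ^+ e.-1 * val t * (x * idem p) = 0.
      transitivity (idem p * (p%:R ^+ e.-1 * (val t * x))); first by ring.
      rewrite E; transitivity (p%:R ^+ e.-1 * (cidem p * idem p) * x); first by ring.
      by rewrite eo; ring.
    rewrite xg => /(congr1 ( *%R (val (t * g)^-1%g))); rewrite mulr0 => E0.
    rewrite -[RHS]E0; transitivity (p%:R ^+ e.-1 * idem p * val ((t * g)^-1 * (t * g))%g).
      by rewrite mulVg mulr1.
    by rewrite !val_unitM; ring.
  have injx (t t' : gT) : t \in comp_group m p -> t' \in comp_group m p ->
      val t * x = val t' * x -> t = t'.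
    move=> /fixgroupP tc /fixgroupP tc' tt'; apply: val_inj.
    apply: sep; last by rewrite tc tc'.
    have E : val t * (val g * idem p) = val t' * (val g * idem p).
      by rewrite -xg !mulrA tt'.
    transitivity (val t * (val g * idem p) * val g^-1%g).
      transitivity (val t * idem p * val (g^-1 * g)%g); first by rewrite mulVg mulr1.
      by rewrite val_unitM; ring.
    rewrite E; transitivity (val t' * idem p * val (g^-1 * g)%g).
      by rewrite val_unitM; ring.
    by rewrite mulVg mulr1.
  pose inv b := odflt 1%g [pick t in comp_group m p | val t * x == b].
  rewrite [RHS](reindex_onto (fun t : gT => val t * x) inv) /=; last first.
    move=> b /invP[t tG tE]; rewrite /inv.
    by case: pickP => [? /andP[_ /eqP]//|/(_ t)]; rewrite tG tE eqxx.
  apply: eq_bigl => t; apply/idP/andP => [tG | [+ /eqP]].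
    split; first exact: Pinv.
    rewrite /inv; case: pickP => [t' /andP[t'G /eqP]|/(_ t)]; last first.
      by rewrite tG eqxx.
    by move/(injx _ _ t'G tG) ->.
  move=> /invP[t' t'G t'E]; rewrite /inv.
  by case: pickP => [u /andP[uG _] /= <-//|/(_ t')]; rewrite t'G t'E eqxx.
set S1 := \sum_(b | _) _ in W1 NE; set S2 := \sum_(b | _) _ in W2 NE.
have -> : (orbsum tau (comp_group m p) - (tau (frob_hi p) - tau (frob_lo p)) *
     comp0 p) * bas x =
   (bas (p%:R ^+ e.-1 * (cidem p * x)) - S2) - (bas (p%:R ^+ e * x) - S1).
  transitivity (orbsum tau (comp_group m p) * bas x - (tau (frob_hi p) *
    comp0 p * bas x - tau (frob_lo p) * comp0 p * bas x)); first by ring.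
  by rewrite NE hiE loE; ring.
by apply: subgroup_predB => //; exact: dist_span_subgroup.
Qed.

End DistributionRelations.

(** * The embedding of the universal distribution *)

Section Fibers.
Variable m : nat.
Hypothesis m_gt1 : (1 < m)%N.
Variables (X : zmodType) (f : 'Z_m -> X).

Lemma fiber_sum p n (a : 'Z_m) :
  \sum_(b : 'Z_m | (p * n)%:R * b == (p * n)%:R * a) f b =
  \sum_(b : 'Z_m | n%:R * b == n%:R * (p%:R * a)) \sum_(d : 'Z_m | p%:R * d == b) f d.
Proof.
rewrite (partition_big (fun b : 'Z_m => p%:R * b)
  (fun b => n%:R * b == n%:R * (p%:R * a))) /= => [|b]; last first.
  by rewrite natrM [p%:R * n%:R]mulrC -!mulrA.
apply: eq_bigr => b /eqP bE; apply: eq_bigl => d; apply: andb_idl => /eqP dE.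
by rewrite natrM [p%:R * n%:R]mulrC -!mulrA dE bE.
Qed.

(** The difference [b - p a] is killed by n, hence divisible by m / n, which is a multiple of p. *)
Lemma fiber_mul p n (a b : 'Z_m) : (p * n %| m)%N ->
  n%:R * b = n%:R * (p%:R * a) -> exists d, b = p%:R * d.
Proof.
move=> pnm /eqP; rewrite -subr_eq0 -mulrBr => /eqP.
set x := _ - _ => nx; suff [y xE] : exists y, x = p%:R * y.
  by exists (y + a); rewrite mulrDr -xE subrK.
have n_gt0 : (0 < n)%N.
  by case: n pnm {nx} => //; rewrite muln0 dvd0n; case: m m_gt1.
move: nx; rewrite -[x]natr_Zp -natrM -[RHS]/(0%:R) => /(natr_eqZ m_gt1) /eqP.
rewrite mod0n -/(_ %| _)%N => d.
have : (p %| x)%N.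
  by rewrite -(dvdn_pmul2l n_gt0) mulnC; apply: dvdn_trans pnm d.
by case/dvdnP=> k ->; exists k%:R; rewrite natrM mulrC.
Qed.

(** A prime p is split off n = p n'. The relation for n' at [p a] runs over a fibre consisting of
    multiples of p, and the relation for p expands each of its terms. *)
Lemma dist_from_primes :
    (forall p, p \in primes m -> forall a : 'Z_m,
       f (p%:R * a) = \sum_(b : 'Z_m | p%:R * b == p%:R * a) f b) ->
  forall n, (n %| m)%N -> forall a : 'Z_m,
    f (n%:R * a) = \sum_(b : 'Z_m | n%:R * b == n%:R * a) f b.
Proof.
move=> fp n; have [k] := ubnP n; elim: k n => // k IH n nk nm a.
have m_gt0 := ltnW m_gt1; have n_gt0 := dvdn_gt0 m_gt0 nm.
have [n1 | n_gt1] := leqP n 1.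
  have -> : n = 1%N by apply/eqP; rewrite eqn_leq n1.
  by rewrite mul1r; under eq_bigl do rewrite !mul1r; rewrite big_pred1_eq.
have pp := pdiv_prime n_gt1; have /dvdnP[n' nE] := pdiv_dvd n.
set p := pdiv n in pp nE; rewrite mulnC in nE.
have n'_gt0 : (0 < n')%N by move: n_gt0; rewrite nE muln_gt0 => /andP[].
have pm : p \in primes m.
  by rewrite mem_primes pp m_gt0 (dvdn_trans _ nm) // nE dvdn_mulr.
rewrite nE fiber_sum natrM [p%:R * n'%:R]mulrC -mulrA.
rewrite IH; last first.
- by apply: dvdn_trans nm; rewrite nE dvdn_mull.
- by rewrite -ltnS; apply: leq_trans nk; rewrite ltnS nE ltn_Pmull // prime_gt1.
apply: eq_bigr => b /eqP bE; have [|d ->] := @fiber_mul p n' a b _ bE.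
  by rewrite -nE.
exact: fp.
Qed.

Lemma predist_from_primes :
    (forall p, p \in primes m -> forall a : 'Z_m,
       \sum_(b : 'Z_m | p%:R * b == p%:R * a) f b = 0) ->
  forall n, (n %| m)%N -> (1 < n)%N -> forall a : 'Z_m,
    \sum_(b : 'Z_m | n%:R * b == n%:R * a) f b = 0.
Proof.
move=> fp n nm n_gt1 a; have m_gt0 := ltnW m_gt1.
have pp := pdiv_prime n_gt1; have /dvdnP[n' nE] := pdiv_dvd n.
set p := pdiv n in pp nE; rewrite mulnC in nE.
have pm : p \in primes m.
  by rewrite mem_primes pp m_gt0 (dvdn_trans _ nm) // nE dvdn_mulr.
rewrite nE fiber_sum big1 // => b /eqP bE.
have [|d ->] := @fiber_mul p n' a b _ bE; first by rewrite -nE.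
exact: fp.
Qed.

End Fibers.

(** * The Stickelberger map on symbols *)

Section Stickelberger.
Variable m : nat.
Hypothesis m_gt1 : (1 < m)%N.
Notation gT := {unit 'Z_m}.
Notation idem := (@idem m).
Notation cidem := (@cidem m).
Notation tau := (@tau m).
Notation G := (@comp_group m).
Notation N p := (orbsum tau (G p)).
Notation n p := (#|G p|%:R : mring m).
Notation h p := (tau (frob_hi m p) - tau (frob_lo m p)).
Notation b p := (n p - N p + h p * N p).

(* The factor at p of the image of [a]: it is N_p n_p if a has component 0 at p;
   otherwise only the p-adic valuation k of that component contributes. *)
Definition local_factor p (a : 'Z_m) : mring m :=
  (a * idem p == 0)%:R * (N p * n p) +
  b p * \sum_(g in G p) \sum_(k < logn p m)
    (p%:R ^+ k * val g * idem p == a * idem p)%:R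
      * (tau (frob m p)^-1%g ^+ k * tau g).

Lemma local_factor_ext p (a a' : 'Z_m) : a * idem p = a' * idem p ->
  local_factor p a = local_factor p a'.
Proof. by rewrite /local_factor => ->. Qed.

Lemma unit_mul_eq (g : gT) (x y : 'Z_m) : (val g * x == val g * y) = (x == y).
Proof.
apply/eqP/eqP => [|->//] /(congr1 ( *%R (val g^-1%g))).
by rewrite !mulrA -!val_unitM mulVg !mul1r.
Qed.

Lemma local_factor_unit p g a : p \in primes m ->
  local_factor p (val g * a) = tau (unit_comp p g) * local_factor p a.
Proof.
move=> pm; have [cG cE] := compP m_gt1 g pm.
rewrite /local_factor mulrDr; congr (_ + _).
  rewrite -mulrA -(unit_mul_eq g (a * idem p) 0) mulr0 mulrCA.
  by rewrite [tau _ * (_ * _)]mulrA (tau_orbsum (@tauM m) cG).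
rewrite mulrCA; congr (_ * _); rewrite (reindex_inj (mulgI (unit_comp p g))) /=.
rewrite big_distrr /=; apply: eq_big => [t|t _]; first exact: (groupMl t cG).
rewrite big_distrr /=; apply: eq_bigr => k _.
rewrite (_ : (_ == _) = (p%:R ^+ k * val t * idem p == a * idem p)).
  by rewrite tauM; ring.
rewrite -[RHS](unit_mul_eq g); congr (_ == _); last by rewrite mulrA.
rewrite -[val t]/(FinRing.uval t) -[val g]/(FinRing.uval g).
transitivity (p%:R ^+ k * FinRing.uval t * (FinRing.uval (unit_comp p g) * idem p)).
  by ring.
by rewrite [_ * idem p]cE -[val g]/(FinRing.uval g); ring.
Qed.

Lemma torsion_idem p (x : 'Z_m) : p \in primes m -> p%:R * x = 0 ->
  x = x * idem p.
Proof.
move=> pm px; have -> : x * idem p = x - x * cidem p by rewrite /cidem; ring.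
have -> : x * cidem p = 0 * cidem p.
  by apply: (@cidem_cancel m m_gt1 p 1) => //; rewrite expr1 px mulr0.
by rewrite mul0r subr0.
Qed.

Lemma sum_torsion p (a y : 'Z_m) : p \in primes m -> y * idem p = y ->
  \sum_(x : 'Z_m | p%:R * x == 0) ((y == (a + x) * idem p)%:R : mring m)
    = (p%:R * y == p%:R * a * idem p)%:R.
Proof.
move=> pm yE; have ee := idemK m_gt1 (primesP pm).
have [E | E] := eqVneq (p%:R * y) (p%:R * a * idem p).
  rewrite (bigD1 (y - a * idem p)) /=; last by rewrite mulrBr E mulrA subrr.
  rewrite mulrDl mulrBl yE -mulrA ee [a * _ + _]addrC subrK eqxx big1 ?addr0 //.
  move=> x /andP[/eqP px xy]; case: eqP => // yax; case/eqP: xy.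
  by rewrite yax mulrDl [X in X - _]addrC addrK -torsion_idem.
rewrite big1 // => x /eqP px; case: eqP => // yax; case/eqP: E.
by rewrite yax mulrA mulrDr px addr0.
Qed.

(** Summing over the p-torsion x turns the condition [p^k g = a + x] at p into [p^(k+1) g = p a], so
    [S k.+1] stands on the left where [S k] stands on the right. The sums differ by a Frobenius
    factor and the boundary terms [S 0] and [S e]: the first vanishes because [p a] is no unit at p,
    the second is N if [p a] is 0 at p and 0 otherwise. *)
Lemma local_factor_dist p (a : 'Z_m) : p \in primes m ->
  \sum_(x : 'Z_m | p%:R * x == 0) local_factor p (a + x)
    = tau (frob m p) * local_factor p (p%:R * a).
Proof.
move=> pm; have pp := primesP pm; have ee := idemK m_gt1 pp.
have e_gt0 : (0 < logn p m)%N by rewrite logn_gt0.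
set e := logn p m in e_gt0 *; set phi := tau (frob m p)^-1%g.
pose S k : mring m :=
  \sum_(g in G p) (p%:R ^+ k * val g * idem p == p%:R * a * idem p)%:R * tau g.
have SE : local_factor p (p%:R * a) = (p%:R * a * idem p == 0)%:R * (N p * n p)
    + b p * \sum_(k < e) phi ^+ k * S k.
  rewrite /local_factor; congr (_ + _ * _); rewrite exchange_big /=.
  apply: eq_bigr => k _; rewrite big_distrr /=; apply: eq_bigr => g _.
  by rewrite mulrCA.
have yE (k : nat) (g : gT) :
    p%:R ^+ k * val g * idem p * idem p = p%:R ^+ k * val g * idem p.
  by rewrite -mulrA ee.
have SE' : \sum_(x : 'Z_m | p%:R * x == 0) local_factor p (a + x) =
    (p%:R * a * idem p == 0)%:R * (N p * n p)
    + b p * \sum_(k < e) phi ^+ k * S k.+1.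
  rewrite /local_factor big_split /= -big_distrl -big_distrr /=; congr (_ * _ + _ * _).
    under eq_bigr do rewrite eq_sym.
    by rewrite sum_torsion ?mul0r // mulr0 [0 == _]eq_sym.
  rewrite exchange_big /=; under [RHS]eq_bigr do rewrite /S big_distrr /=.
  rewrite [RHS]exchange_big /=; apply: eq_bigr => g _.
  rewrite exchange_big /=; apply: eq_bigr => k _; rewrite -big_distrl.
  rewrite (sum_torsion _ pm (yE k g)).
  by rewrite /= -/phi exprS !mulrA; ring.
have S0 : S 0%N = 0.
  rewrite /S big1 // => g _; rewrite expr0 mul1r.
  case: eqP => [E|]; last by rewrite mul0r.
  have := pexp_idem_neq0 m_gt1 pm; rewrite -/e -(unit_mul_eq g) mulr0.
  case/eqP; transitivity (p%:R ^+ e.-1 * (val g * idem p)); first by ring.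
  rewrite E; transitivity (p%:R ^+ e.-1.+1 * idem p * a); first by rewrite exprSr; ring.
  by rewrite prednK // pexp_idem // mul0r.
have Se : S e = (p%:R * a * idem p == 0)%:R * N p.
  rewrite /S /orbsum big_distrr /=; apply: eq_bigr => g _.
  by rewrite mulrAC pexp_idem // mul0r eq_sym.
have [e' eE] : exists e', e = e'.+1 by exists e.-1; rewrite prednK.
have NN : N p * N p = N p * n p by apply: orbsum_sqr; exact: tauM.
have tauX g k : tau (g ^+ k)%g = tau g ^+ k.
  elim: k => [|k IH]; first by rewrite expg0 tau1 expr0.
  by rewrite expgS tauM IH exprS.
have Fphi : tau (frob m p) * phi = 1 by rewrite -tauM mulgV tau1.
have FphiX k : tau (frob m p) ^+ k * phi ^+ k = 1 by rewrite -exprMn Fphi expr1n.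
(* This identity dictates the form of h: since b acts on N as [n h], the boundary term [S e] has to
   contribute [Fr - 1] times [N n]. *)
have hphi : h p * phi ^+ e' = tau (frob m p) - 1.
  rewrite /frob_hi /frob_lo -/e eE /= !tauX mulrBl FphiX exprS -mulrA FphiX.
  by rewrite mulr1.
rewrite SE SE' {}eE in Se *.
rewrite big_ord_recr [in RHS]big_ord_recl /= S0 mulr0 add0r Se.
have -> : \sum_(i < e') phi ^+ bump 0 i * S (bump 0 i) =
    phi * \sum_(i < e') phi ^+ i * S i.+1.
  by rewrite big_distrr /=; apply: eq_bigr => i _; rewrite /bump exprS mulrA.
set v := (_ == _)%:R; set T := \sum_(i < e') _.
apply/eqP; rewrite -subr_eq0; apply/eqP.
transitivity (b p * T * (1 - tau (frob m p) * phi)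
   + v * (N p * n p * (h p * phi ^+ e' - (tau (frob m p) - 1))
          + (h p - 1) * phi ^+ e' * (N p * N p - N p * n p))).
  by ring.
by rewrite Fphi hphi NN; ring.
Qed.

Definition stick (a : 'Z_m) : mring m := \prod_(p <- primes m) local_factor p a.

Lemma stick_unit g a : stick (val g * a) = tau g * stick a.
Proof.
rewrite -[in RHS](prod_comp m_gt1 g) (big_morph tau (@tauM m) (@tau1 m)).
rewrite -big_split /= /stick !big_seq; apply: eq_bigr => p pm.
exact: local_factor_unit.
Qed.

(** A p-torsion element changes only the component at p, where [local_factor_dist] applies. At the
    other primes p acts as its Frobenius, a unit whose component at p is 1. *)
Lemma stick_dist p (a : 'Z_m) : p \in primes m ->
  stick (p%:R * a) = \sum_(b : 'Z_m | p%:R * b == p%:R * a) stick b.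
Proof.
move=> pm; rewrite (reindex_inj (addrI a)) /=.
under eq_bigl do rewrite mulrDr -subr_eq0 addrAC subrr add0r.
pose r := rem p (primes m).
have rP q : q \in r -> q \in primes m /\ q != p.
  by rewrite mem_rem_uniq ?primes_uniq // inE => /andP[].
have stickE x : stick x = local_factor p x * \prod_(q <- r) local_factor q x.
  by rewrite /stick (big_rem p).
transitivity (\sum_(x : 'Z_m | p%:R * x == 0)
   local_factor p (a + x) * \prod_(q <- r) local_factor q a).
  rewrite -big_distrl /= local_factor_dist // stickE [tau _ * _]mulrC -mulrA.
  congr (_ * _); have -> : tau (frob m p) = \prod_(q <- r) tau (unit_comp q (frob m p)).
    rewrite -[in LHS](prod_comp m_gt1 (frob m p)) (big_morph tau (@tauM m) (@tau1 m)).
    rewrite (big_rem p) //= -/r.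
    suff -> : unit_comp p (frob m p) = 1%g by rewrite tau1 mul1r.
    have [cG cE] := compP m_gt1 (frob m p) pm; apply/eqP.
    rewrite -in_set1 -[[set 1%g]](comp_group_ti pm) inE cG.
    by apply/fixgroupP; rewrite cE frob_idem.
  rewrite -big_split /= !big_seq; apply: eq_bigr => q /rP[qm qp].
  rewrite -local_factor_unit //; apply: local_factor_ext.
  rewrite frobE //; have [pp pq] := (primesP pm, primesP qm).
  have npq : p != q by rewrite eq_sym.
  transitivity (p%:R * a * idem q + (1 - p%:R) * a * (idem p * idem q)).
    by rewrite (idem_orth m_gt1 pp pq npq) mulr0 addr0.
  by rewrite /cidem; ring.
apply: eq_bigr => x /eqP px; rewrite stickE; congr (_ * _).
rewrite !big_seq; apply: eq_bigr => q /rP[qm qp]; apply: local_factor_ext.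
have npq : p != q by rewrite eq_sym.
rewrite mulrDl (torsion_idem pm px) -[x * _ * _]mulrA.
by rewrite (idem_orth m_gt1 (primesP pm) (primesP qm) npq) mulr0 addr0.
Qed.

Definition stick_sum (x : mring m) : mring m := \sum_a stick a *~ x a.

Lemma stick_sum_is_zmod_morphism : zmod_morphism stick_sum.
Proof.
move=> x y; rewrite /stick_sum -sumrB; apply: eq_bigr => a _.
by rewrite !ffunE mulrzBr.
Qed.
HB.instance Definition _ :=
  GRing.isZmodMorphism.Build (mring m) (mring m) stick_sum
    stick_sum_is_zmod_morphism.

Lemma stick_sum_bas a : stick_sum (bas a) = stick a.
Proof.
have basE (c k : 'Z_m) : bas c k = (k == c)%:R by rewrite ffunE.
rewrite /stick_sum (bigD1 a) //= basE eqxx mulr1z big1 ?addr0 // => c /negbTE ca.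
by rewrite basE ca mulr0z.
Qed.

Lemma stick_sum_tau g x : stick_sum (tau g * x) = tau g * stick_sum x.
Proof.
rewrite [x]bas_sum big_distrr /= !raddf_sum big_distrr /=; apply: eq_bigr => a _.
by rewrite mulrzAr !raddfMz /= mulrzAr -basM !stick_sum_bas stick_unit.
Qed.

Lemma stick_sum_dist_span x : dist_span x -> stick_sum x = 0.
Proof.
move=> /asboolP[s sP ->]; rewrite raddf_sum big1_seq // => q /andP[_ /sP].
case=> n [a [nm [k ak] ->]]; rewrite raddfMz raddfB /=.
have -> : stick_sum (\sum_(b : 'Z_m | b *+ n == a) symbol b)
    = \sum_(b : 'Z_m | n%:R * b == n%:R * k) stick b.
  rewrite (raddf_sum stick_sum); apply: eq_big => b *; last exact: stick_sum_bas.
  by rewrite ak !mulr_natl.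
have sd p (pm : p \in primes m) c := @stick_dist p c pm.
rewrite [stick_sum _]stick_sum_bas ak -[k *+ n]mulr_natl.
rewrite (dist_from_primes m_gt1 sd nm).
by rewrite subrr mul0rz.
Qed.

Lemma prod_cidem_idem s q : uniq s -> {subset s <= primes m} -> q \in primes m ->
  (\prod_(p <- s) cidem p) * idem q = if q \in s then 0 else idem q.
Proof.
move=> + + qm; elim: s => [|p s IH] /= => [_ _|/andP[ps us] sP].
  by rewrite big_nil mul1r.
have sP' : {subset s <= primes m} by move=> r rs; apply: sP; rewrite inE rs orbT.
have pm : p \in primes m by apply: sP; rewrite inE eqxx.
rewrite big_cons -mulrA IH // inE eq_sym.
have [pq | npq] /= := eqVneq p q.
  case: ifP; rewrite ?mulr0 // -pq /cidem mulrBl mul1r.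
  by rewrite (idemK m_gt1 (primesP pm)) subrr.
case: ifP; rewrite ?mulr0 // /cidem mulrBl mul1r.
by rewrite (idem_orth m_gt1 (primesP pm) (primesP qm) npq) subr0.
Qed.

Lemma local_factor0 p (a : 'Z_m) : p \in primes m -> a * idem p = 0 ->
  local_factor p a = N p * n p.
Proof.
move=> pm a0; rewrite /local_factor a0 eqxx mul1r big1 ?mulr0 ?addr0 // => g _.
rewrite big1 // => k _; case: eqP => [E|]; last by rewrite mul0r.
have := pexp_idem_neq0 m_gt1 pm; rewrite -(unit_mul_eq g) mulr0.
have ke : (k <= (logn p m).-1)%N by rewrite -ltnS prednK ?logn_gt0.
rewrite -(subnK ke) exprD; case/eqP.
transitivity (p%:R ^+ ((logn p m).-1 - k) * (p%:R ^+ k * val g * idem p)); first by ring.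
by rewrite E mulr0.
Qed.

(** Only k = 0 and g = 1 contribute: for k > 0 the power of p is no unit at p, and for k = 0 the
    unit g of G_p would be 1 at p as well. *)
Lemma local_factor1 p (a : 'Z_m) : p \in primes m -> a * idem p = idem p ->
  local_factor p a = b p.
Proof.
move=> pm a1; have e_gt0 : (0 < logn p m)%N by rewrite logn_gt0.
have idem_n0 : idem p != 0.
  by apply: contraNneq (pexp_idem_neq0 m_gt1 pm) => ->; rewrite mulr0.
rewrite /local_factor a1 (negbTE idem_n0) mul0r add0r.
suff -> : \sum_(g in G p) \sum_(k < logn p m)
    (p%:R ^+ k * val g * idem p == idem p)%:R
      * (tau (frob m p)^-1%g ^+ k * tau g) = 1 by rewrite mulr1.
have impossible (k : nat) (g : gT) : (0 < k < logn p m)%N ->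
    p%:R ^+ k * val g * idem p != idem p.
  move=> /andP[k0 ke]; apply: contraNneq (pexp_idem_neq0 m_gt1 pm) => <-.
  have [j jE] : exists j, (k + (logn p m).-1 = j + logn p m)%N.
    by exists k.-1; lia.
  apply/eqP; transitivity (p%:R ^+ (k + (logn p m).-1) * idem p * val g).
    by rewrite exprD; ring.
  by rewrite jE exprD -[_ * idem p]mulrA (pexp_idem m_gt1 (primesP pm)) mulr0 mul0r.
rewrite (bigD1 1%g) ?group1 //= (bigD1 (Ordinal e_gt0)) //=.
rewrite !expr0 !mul1r eqxx mul1r tau1 big1 => [|k k0]; last first.
  rewrite (negbTE (impossible k 1%g _)) ?mul0r // ltn_ord andbT lt0n.
  by apply: contraNneq k0 => k0; apply/eqP/val_inj.
rewrite addr0 big1 ?addr0 // => g /andP[gG g1]; rewrite big1 // => k _.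
have [k0 | k0] := posnP k; last first.
  by rewrite (negbTE (impossible k g _)) ?mul0r // k0 ltn_ord.
rewrite k0 expr0 mul1r; case: eqP => [E|]; last by rewrite mul0r.
case/eqP: g1; apply/eqP; rewrite -in_set1 -[[set 1%g]](comp_group_ti pm) inE gG.
exact/fixgroupP.
Qed.

Lemma stick_sum_comp0 s t : perm_eq (s ++ t) (primes m) ->
  stick_sum (\prod_(p <- s) comp0 m p) =
  \prod_(p <- s) (N p * n p) * \prod_(p <- t) b p.
Proof.
move=> stP; have := perm_uniq stP; rewrite primes_uniq cat_uniq.
move=> /and3P[us /hasPn st _].
have -> : \prod_(p <- s) comp0 m p = bas (\prod_(p <- s) cidem p).
  by rewrite (big_morph (@bas m) (@basM m) (@bas1 m)).
have sP q : q \in s -> q \in primes m.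
  by rewrite -(perm_mem stP) mem_cat => ->.
have tP q : q \in t -> q \in primes m.
  by rewrite -(perm_mem stP) mem_cat orbC => ->.
rewrite stick_sum_bas /stick -(perm_big _ stP) /= big_cat /=.
congr (_ * _); apply: eq_big_seq => q qs.
  apply: local_factor0; first exact: sP.
  by rewrite (prod_cidem_idem us sP (sP q qs)) qs.
apply: local_factor1; first exact: tP.
by rewrite (prod_cidem_idem us sP (tP q qs)) (negbTE (st q qs)).
Qed.

End Stickelberger.

(** * Cohomology of the universal distribution *)

Lemma tate_basis_transfer (V V' : zmodType) (F : {additive V -> V'})
    (s : V -> V) (s' : V' -> V') (L : V' -> Prop) (I : finType) :
    injective F -> (forall y, L y <-> exists x, F x = y) ->
    (forall x, F (s x) = s' (F x)) ->
  tate_basis s' L I -> tate_basis s (fun _ => True) I.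
Proof.
move=> Finj FL Fs [v [vP gen ind]].
have /choice[w wE] i : exists w, F w = v i by apply/FL; case: (vP i).
have FS (A : {set I}) : F (\sum_(i in A) w i) = \sum_(i in A) v i.
  by rewrite raddf_sum; apply: eq_bigr.
exists w; split=> [i | z _ sz | A x _ E].
- by split=> //; apply: Finj; rewrite Fs wE; case: (vP i).
- have [||A [_ [/FL[x <-] zE]]] := gen (F z); first by apply/FL; exists z.
    by rewrite -Fs sz.
  by exists A, x; split=> //; apply: Finj; rewrite !raddfD /= FS Fs.
apply: (ind A (F x)); first by apply/FL; exists x.
by rewrite -FS E raddfD /= Fs.
Qed.

(** * Maps out of the quotients by relations *)

Section QuotientMap.
Local Open Scope quotient_scope.
Variables (m : nat) (S : symbols m -> Prop).
Hypothesis S_opp : forall x, S x -> S (symbols_opp x).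
Notation M := (quot_gmodule S_opp).
Notation proj x := (\pi_(Quotient.quot (zspan S)) x : M).

Lemma projW (P : M -> Prop) : (forall x, P (proj x)) -> forall x, P x.
Proof. by move=> Px x; elim/quotW: x. Qed.

Lemma proj_eq x y : proj x = proj y <-> x - y \in zspan S.
Proof.
split=> [/eqP|xy]; first by rewrite -Quotient.idealrBE.
by apply/eqP; rewrite -Quotient.idealrBE.
Qed.

Lemma proj_act x : gm_act (1%R : 'Z_2) (proj x) = proj (symbols_opp x).
Proof. exact: quot_oppE. Qed.

Lemma proj_add x y : proj (x + y) = proj x + proj y.
Proof. exact: Quotient.pi_add. Qed.

Lemma proj0 : proj 0 = 0.
Proof. by apply: (@addrI _ (proj 0)); rewrite -proj_add !addr0. Qed.

Lemma quot_lift (X : zmodType) (E : {additive symbols m -> X}) :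
  (forall x, S x -> E x = 0) ->
  exists F : {additive M -> X}, forall x, F (proj x) = E x.
Proof.
move=> ES; have EZ x : x \in zspan S -> E x = 0.
  move=> /asboolP[s sS ->]; rewrite raddf_sum big1_seq // => q /andP[_ /sS qS].
  by rewrite raddfMz ES ?mul0rz.
pose f (x : M) := E (generic_quotient.repr x).
have fE x : f (proj x) = E x.
  apply/eqP; rewrite -subr_eq0 -raddfB; apply/eqP/EZ.
  by rewrite Quotient.idealrBE reprK.
have fB : zmod_morphism f.
  apply: projW => x; apply: projW => y.
  have -> : proj x - proj y = proj (x - y).
    by apply: (@addIr _ (proj y)); rewrite subrK -proj_add subrK.
  by rewrite !fE raddfB.
pose fA := GRing.isZmodMorphism.Build _ _ f fB.
by exists (HB.pack f fA : {additive M -> X}).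
Qed.

End QuotientMap.

(** * Kernel and image of the Stickelberger map *)

Section Spanning.
Variable m : nat.
Hypothesis m_gt1 : (1 < m)%N.
Hypothesis m_mod4 : m <> 2 %[mod 4].
Notation gT := {unit 'Z_m}.
Notation idem := (@idem m).
Notation cidem := (@cidem m).
Notation tau := (@tau m).
Notation symlift := (symlift tau (@comp_group m) (@frob_hi m) (@frob_lo m)
                       (@unit_span m) (@comp0 m)).

Definition unit_at (a : 'Z_m) p := exists y, a * y * idem p = idem p.
Definition good_at (a : 'Z_m) p := a * idem p = 0 \/ unit_at a p.

Lemma unit_of_unit_at a : (forall p, p \in primes m -> unit_at a p) ->
  exists g : gT, val g = a.
Proof.
move=> aP; have /choice[y yP] : forall p, exists y,
    p \in primes m -> a * y * idem p = idem p.
  move=> p; have [/aP[y yP]|np] := boolP (p \in primes m); first by exists y.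
  by exists 0.
have [x xP] := idem_crt m_gt1 y.
apply: (@unit_of_inv _ a x); apply: (idem_sep m_gt1) => p pm.
by rewrite -mulrA xP // mulrA yP // mul1r.
Qed.

Lemma lift_bas s a : uniq s -> {subset s <= primes m} ->
    (forall p, p \in primes m -> good_at a p) ->
    (forall p, p \in primes m -> p \notin s -> unit_at a p) ->
  exists x, symlift s x (bas a).
Proof.
elim: s a => [|p s IH] a /= => [_ _ _ ua|/andP[ps us] sP ga ua].
  have [g gE] := unit_of_unit_at (fun p pm => ua p pm isT).
  exists (bas a); split=> //; have [_ _ Lt] := unit_span_lattice m.
  by rewrite -gE -[bas _]mulr1; apply: Lt; exact: unit_span1.
have sP' : {subset s <= primes m} by move=> q qs; apply: sP; rewrite inE qs orbT.
have pm : p \in primes m by apply: sP; rewrite inE eqxx.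
have pp := primesP pm; have ee := idemK m_gt1 pp.
have l0 := symlift0 (@comp_group m) (@frob_hi m) (@frob_lo m)
  (unit_span_lattice m) (@comp0 m) s.
have [a0 | ap] := ga p pm; last first.
  have [|x xP] := IH a us sP' ga.
    move=> q qm qs; have [-> //|qp] := eqVneq q p.
    by apply: ua; rewrite // inE negb_or qp.
  eexists; exists 0, 0, x, (bas a); split; [exact: l0 | exact: xP | by [] |].
  by rewrite mulr0 add0r.
(* The component 0 at p is replaced by 1; the symbol of a is then [comp0 p] times that of [a'], as
   the second clause of [symlift] requires. *)
pose a' := a + idem p.
have a'p : a' * idem p = idem p by rewrite mulrDl a0 ee add0r.
have a'q q : q \in primes m -> q != p -> a' * idem q = a * idem q.
  move=> qm qp; have npq : p != q by rewrite eq_sym.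
  by rewrite mulrDl (idem_orth m_gt1 pp (primesP qm) npq) addr0.
have uaq q : q \in primes m -> q != p -> unit_at a q -> unit_at a' q.
  by move=> qm qp [y yE]; exists y; rewrite mulrAC a'q // mulrAC.
have uap : unit_at a' p by exists 1; rewrite mulr1.
have [|q qm qs|x xP] := IH a' us sP'.
- move=> q qm; have [-> | qp] := eqVneq q p; first by right.
  by have [a0q | uq] := ga q qm; [left; rewrite a'q | right; apply: uaq].
- have [-> // | qp] := eqVneq q p; apply: uaq => //.
  by apply: ua; rewrite // inE negb_or qp.
eexists; exists x, (bas a'), 0, 0; split; [exact: xP | exact: l0 | by [] |].
rewrite addr0 /comp0 -basM; congr bas.
transitivity (a - a * idem p + (idem p - idem p * idem p)).
  by rewrite a0 ee; ring.
by rewrite /cidem /a'; ring.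
Qed.

Definition liftable (v : mring m) : Prop := exists x, symlift (primes m) x v.

Lemma liftable_subgroup : subgroup_pred liftable.
Proof.
split.
  by exists 0; apply: symlift0; exact: unit_span_lattice.
move=> v w [x xv] [y yw]; exists (x - y); apply: symliftB => //.
exact: unit_span_lattice.
Qed.

(** The primes of s are those where the component of a may still be a nonzero non-unit. At such a p
    the component is p^k times a unit, and the relation for p^k replaces the symbol by symbols that
    are units at p. *)
Lemma bas_span (s : seq nat) a :
  (forall p, p \in primes m -> p \notin s -> good_at a p) ->
  {subset s <= primes m} ->
  exists2 v, liftable v & dist_span (bas a - v).
Proof.
elim: s a => [|p s IH] a ga sP.
  exists (bas a); last by rewrite subrr; case: (dist_span_subgroup m).
  by apply: lift_bas; rewrite ?primes_uniq // => p pm; [apply: ga | rewrite pm].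
have sP' : {subset s <= primes m} by move=> q qs; apply: sP; rewrite inE qs orbT.
have pm : p \in primes m by apply: sP; rewrite inE eqxx.
have pp := primesP pm; have ee := idemK m_gt1 pp.
have gaq q : q \in primes m -> q \notin s -> q != p -> good_at a q.
  by move=> qm qs qp; apply: ga; rewrite // inE negb_or qp.
have [a0 | an0] := eqVneq (a * idem p) 0.
  apply: IH => // q qm qs; have [-> | qp] := eqVneq q p; first by left.
  exact: gaq.
have [k [c [ke [y yc] aE]]] := idem_dec m_gt1 pm an0.
have [z zE] := cidem_inv m_gt1 pp.
have zkE : p%:R ^+ k * z ^+ k * cidem p = cidem p.
  rewrite -exprMn; elim: (k) => [|j IHj]; first by rewrite expr0 mul1r.
  by rewrite exprSr -mulrA zE IHj.
(* A quotient of a by p^k: the unit c at p, and division by the invertible p^k elsewhere. *)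
pose x := c * idem p + z ^+ k * a * cidem p.
have xE : p%:R ^+ k * x = a.
  transitivity (p%:R ^+ k * c * idem p + (p%:R ^+ k * z ^+ k * cidem p) * a).
    by rewrite /x; ring.
  by rewrite -aE zkE /cidem; ring.
have W1 : dist_span (bas a - \sum_(b : 'Z_m | p%:R ^+ k * b == a) bas b).
  have := @dist_span_rel m (p ^ k) x; rewrite natrX xE; apply.
  by rewrite pfactor_dvdn // ltnW // ltnW.
have /choice[v vP] : forall b, exists v, p%:R ^+ k * b = a ->
    liftable v /\ dist_span (bas b - v).
  move=> b; have [bE | nb] := eqVneq (p%:R ^+ k * b) a; last first.
    by exists 0 => bE; rewrite bE eqxx in nb.
  have [||v lv Wv] := IH b; last by exists v.
  (* At p, b is a unit because [p^k b] and [p^k c] agree there, c is a unit and k < e: otherwise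
     multiplication by p^(e-1-k) would make p^(e-1) vanish at p. At the other primes p is
     invertible, so b is 0 or a unit along with a. *)
  - move=> q qm qs; have [-> | qp] := eqVneq q p.
      right; apply: (idem_inv m_gt1 pm).
      apply: contraNneq (pexp_idem_neq0 m_gt1 pm) => b0.
      have ke' : (k <= (logn p m).-1)%N by rewrite -ltnS prednK ?logn_gt0.
      move: b0; rewrite -(subnK ke') exprD; set P := p%:R ^+ (_ - k) => b0.
      apply/eqP; rewrite -yc.
      transitivity (P * (p%:R ^+ k * c * idem p) * y); first by ring.
      rewrite -aE -bE; transitivity (P * p%:R ^+ k * b * idem p * y); first by ring.
      by rewrite b0 mul0r.
    have npq : p != q by rewrite eq_sym.
    have co : cidem p * idem q = idem q.
      by rewrite /cidem mulrBl mul1r (idem_orth m_gt1 pp (primesP qm) npq) subr0.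
    have [a0q | [w wE]] := gaq q qm qs qp.
      left; transitivity ((p%:R ^+ k * z ^+ k * cidem p) * idem q * b).
        by rewrite zkE co mulrC.
      transitivity (z ^+ k * cidem p * (p%:R ^+ k * b * idem q)); first by ring.
      by rewrite bE a0q mulr0.
    right; exists (p%:R ^+ k * w); rewrite -[RHS]wE -bE; ring.
  exact: sP'.
exists (\sum_(b : 'Z_m | p%:R ^+ k * b == a) v b).
  by apply: subgroup_pred_sum => [|b /eqP /vP[]]; first exact: liftable_subgroup.
rewrite -[_ - _](subrKA (\sum_(b : 'Z_m | p%:R ^+ k * b == a) bas b)).
apply: subgroup_predD => //; first exact: dist_span_subgroup.
rewrite -sumrB; apply: subgroup_pred_sum => [|b /eqP /vP[]//].
exact: dist_span_subgroup.
Qed.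

Lemma sym_span (x : mring m) : exists2 v, liftable v & dist_span (x - v).
Proof.
have /choice[v vP] : forall a : 'Z_m, exists v, liftable v /\ dist_span (bas a - v).
  move=> a; have [|v lv Wv] := @bas_span (primes m) a _ (fun _ => id).
    by move=> p ->.
  by exists v.
exists (\sum_a v a *~ x a).
  apply: subgroup_pred_sum => [|a _]; first exact: liftable_subgroup.
  by apply: subgroup_predMz; [exact: liftable_subgroup | case: (vP a)].
rewrite {1}[x]bas_sum -sumrB; apply: subgroup_pred_sum => [|a _].
  exact: dist_span_subgroup.
rewrite -mulrzBl; apply: subgroup_predMz; first exact: dist_span_subgroup.
by case: (vP a).
Qed.

Lemma stick_sum_lift x v : symlift (primes m) x v -> stick_sum v = x.
Proof.
move=> xv; have := symlift_E (fun x ux => ux)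
  (stick_sum_tau m_gt1) (stick_sum_comp0 m_gt1) (t := [::]) (u := [::]) xv.
by rewrite !cats0 !big_nil !mulr1; apply.
Qed.

(** Since p is not in s, the product of idempotents has component 1 at p; the symbol is thus the
    unit g at p and [dist_span_orbsum] applies. *)
Lemma dist_span_comp0 p (g : gT) (s : seq nat) : p \in primes m -> p \notin s ->
    {subset s <= primes m} ->
  dist_span ((orbsum tau (comp_group m p)
              - (tau (frob_hi m p) - tau (frob_lo m p)) * comp0 m p)
             * (tau g * \prod_(q <- s) comp0 m q)).
Proof.
move=> pm ps sP.
have -> : \prod_(q <- s) comp0 m q = bas (\prod_(q <- s) cidem q).
  by rewrite (big_morph (@bas m) (@basM m) (@bas1 m)).
rewrite -basM; apply: (dist_span_orbsum m_gt1 (g := g)) => //.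
rewrite -mulrA; congr (_ * _); elim: s ps sP => [|q s IH] ps sP.
  by rewrite big_nil mul1r.
move: ps; rewrite inE negb_or => /andP[pq ps].
have qm : q \in primes m by apply: sP; rewrite inE eqxx.
have sP' : {subset s <= primes m} by move=> r rs; apply: sP; rewrite inE rs orbT.
have nqp : q != p by rewrite eq_sym.
rewrite big_cons -mulrA IH // /cidem mulrBl mul1r.
by rewrite (idem_orth m_gt1 (primesP qm) (primesP pm) nqp) subr0.
Qed.

(** Modulo relations x is some v lifted by [symlift]; its image is then 0 and [symlift_ker] puts v
    among the relations. *)
Lemma stick_sum_eq0 (x : mring m) : stick_sum x = 0 <-> dist_span x.
Proof.
split=> [Ex|]; last exact: stick_sum_dist_span.
have [v [y yv] Wv] := sym_span x.
have Ev : stick_sum v = 0.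
  rewrite -[LHS]add0r -{1}(stick_sum_dist_span m_gt1 Wv) raddfB /= Ex sub0r.
  exact: addNr.
have y0 : y = 0 by rewrite -(stick_sum_lift yv).
rewrite y0 in yv.
have := symlift_ker (@mring_torsion_free m) (@unit_commute m) (@tau1 m) (@tauM m)
  (@comp_group_sub m m_gt1) (@comp_group_ti m) (unit_span_lattice m)
  (@unit_span_induced m) (fun x ux => ux) (dist_span_subgroup m)
  (fun p t _ => @comp0_tau m p t) dist_span_comp0 (t := [::]) yv
  (primes_uniq m) (fun _ => id).
rewrite big_nil mulr1 => Wv'.
rewrite -[x](subrK v); apply: subgroup_predD => //; first exact: dist_span_subgroup.
exact: Wv'.
Qed.

Lemma stick_sum_image (y : mring m) :
  level tau (@comp_group m) (@frob_hi m) (@frob_lo m) (@unit_span m)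
    (dist_level (primes m)) y <-> exists x, stick_sum x = y.
Proof.
split=> [/(symlift_level _ _ _ _ _ (@comp0 m))[v] | [x <-]].
  by move=> /stick_sum_lift; exists v.
have [v [z zv] Wv] := sym_span x.
apply/(symlift_level _ _ _ _ _ (@comp0 m)); exists v.
suff -> : stick_sum x = z by [].
rewrite -(stick_sum_lift zv); apply/eqP; rewrite -subr_eq0 -raddfB; apply/eqP.
exact: stick_sum_dist_span.
Qed.

Lemma symbols_oppM (x : mring m) : symbols_opp x = tau (opp1 m) * x :> mring m.
Proof.
rewrite {2}[x]bas_sum {1}[x]bas_sum [LHS]raddf_sum big_distrr /=.
apply: eq_bigr => a _; rewrite [LHS]raddfMz /= [symbols_opp _]symbols_oppE.
by rewrite mulrzAr -basM opp1E // mulN1r.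
Qed.

Lemma univ_distribution_tate_basis :
  exists I J : finType,
    [/\ tate_basis (@gm_act 'Z_2 (univ_distribution m) 1%R) (fun _ => True) I,
        tate_basis (fun x : univ_distribution m => - gm_act (1%R : 'Z_2) x)
          (fun _ => True) J,
        #|I| = (2 ^ (size (primes m) - 1))%N
      & #|J| = (2 ^ (size (primes m) - 1))%N].
Proof.
have [|I [J [tI tJ cI cJ]]] := level_tate_basis (@mring_torsion_free m)
  (@unit_commute m) (@tau1 m) (@tauM m) (@frob_hi m) (@frob_lo m) (primes_uniq m)
  (@comp_group_sub m m_gt1) (@comp_group_ti m) (comp_gen m_gt1)
  (unit_span_lattice m) (@unit_span_induced m) (opp1_sqr m)
  (@opp1_comp_ker m m_gt1 ^~ m_mod4) (fun x ux => ux) (unit_span1 m)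
  (fun g => mring_aug_bas (val g)) (s := primes m) (t := [::]).
  by rewrite cats0.
move: tI tJ; rewrite cats0 => tI tJ.
have [F FE] := quot_lift (@distribution_rel_opp m)
  (E := (@stick_sum m : {additive symbols m -> mring m}))
  (fun x xR => stick_sum_dist_span m_gt1 (mem_zspan xR)).
have Finj : injective F.
  apply: raddf_inj; apply: projW => x; rewrite FE => /stick_sum_eq0 x0.
  by rewrite -(proj0 (@distribution_rel_opp m)); apply/proj_eq; rewrite subr0.
have FL y : level tau (@comp_group m) (@frob_hi m) (@frob_lo m) (@unit_span m)
    (dist_level (primes m)) y <-> exists x, F x = y.
  split=> [/stick_sum_image[x <-] | [x <-]].
    by rewrite -FE; eexists.
  by move: x; apply: projW => x; rewrite FE; apply/stick_sum_image; exists x.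
have Fc x : F (gm_act (1%R : 'Z_2) x) = tau (opp1 m) * F x.
  move: x; apply: projW => x; rewrite proj_act !FE -[RHS](stick_sum_tau m_gt1).
  by rewrite -symbols_oppM.
(* [even_rank] and [odd_rank] agree only from one prime on. *)
have sP : (0 < size (primes m))%N.
  rewrite lt0n size_eq0; apply/eqP => P0; have := pdiv_prime m_gt1.
  move=> pp; have : pdiv m \in primes m by rewrite mem_primes pp ltnW // pdiv_dvd.
  by rewrite P0.
exists I, J; split.
- apply: tate_basis_transfer Finj FL _ tI => x; rewrite mul1r; exact: Fc.
- by apply: tate_basis_transfer Finj FL _ tJ => x; rewrite raddfN /= Fc mulN1r mulNr.
- by rewrite cI; case: (size _) sP => // k _; rewrite subSS subn0.
by rewrite cJ; case: (size _) sP => // k _; rewrite subSS subn0.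
Qed.

End Spanning.

(** * Cohomology of the universal predistribution *)

Section Predistribution.
Variable m : nat.
Hypothesis m_gt1 : (1 < m)%N.
Notation O := (univ_predistribution m).
Notation idem := (@idem m).
Notation c := (@gm_act 'Z_2 O 1%R).

Definition osym (a : 'Z_m) : O :=
  (\pi_(Quotient.quot (zspan (@predistribution_rel m))) (symbol a))%qT.

Lemma fiber_shift (X : zmodType) (f : 'Z_m -> X) n (a : 'Z_m) :
  \sum_(b : 'Z_m | n%:R * b == n%:R * a) f b =
  \sum_(x : 'Z_m | n%:R * x == 0) f (a + x).
Proof.
rewrite (reindex_inj (addrI a)) /=; apply: eq_bigl => x.
by rewrite mulrDr -subr_eq0 addrAC subrr add0r.
Qed.

Lemma osym_lift (X : zmodType) (f : 'Z_m -> X) :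
    (forall p, p \in primes m -> forall a : 'Z_m,
       \sum_(x : 'Z_m | p%:R * x == 0) f (a + x) = 0) ->
  exists F : {additive O -> X}, forall a, F (osym a) = f a.
Proof.
move=> fp; pose E (x : symbols m) := \sum_a f a *~ x a.
have EB : zmod_morphism E.
  move=> x y; rewrite /E -sumrB; apply: eq_bigr => a _.
  by rewrite !ffunE mulrzBr.
pose EA := GRing.isZmodMorphism.Build _ _ E EB.
pose E' : {additive symbols m -> X} := HB.pack E EA.
have Es a : E (symbol a) = f a.
  rewrite /E (bigD1 a) //= ffunE eqxx mulr1z big1 ?addr0 // => b /negbTE ba.
  by rewrite ffunE ba mulr0z.
have [|F FE] := quot_lift (@predistribution_rel_opp m) (E := E').
  move=> _ [n [a [nm n1 [k ak] ->]]]; rewrite raddf_sum /=.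
  rewrite (eq_bigr f) => [|b _]; last exact: Es.
  rewrite (eq_bigl (fun b => n%:R * b == n%:R * k)); last first.
    by move=> b; rewrite ak !mulr_natl.
  apply: (predist_from_primes m_gt1) => // p pm d.
  by rewrite fiber_shift fp.
by exists F => a; rewrite FE /= Es.
Qed.

Lemma osym_rel p (a : 'Z_m) : p \in primes m ->
  \sum_(x : 'Z_m | p%:R * x == 0) osym (a + x) = 0.
Proof.
move=> pm; have pp := primesP pm.
rewrite -(fiber_shift osym) -[RHS](proj0 (@predistribution_rel_opp m)).
rewrite -(big_morph _ (proj_add (@predistribution_rel_opp m))
                      (proj0 (@predistribution_rel_opp m))).
apply/proj_eq; rewrite subr0; apply: mem_zspan.
exists p, (p%:R * a); split.
- by move: pm; rewrite mem_primes => /and3P[].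
- exact: prime_gt1.
- by exists a; rewrite mulr_natl.
by apply: eq_bigl => b; rewrite mulr_natl.
Qed.

Lemma osym_opp a : c (osym a) = osym (- a).
Proof. by rewrite /osym [LHS]proj_act symbols_oppE. Qed.

Lemma osym_ind (P : O -> Prop) : P 0 -> (forall x y, P x -> P y -> P (x - y)) ->
  (forall a, P (osym a)) -> forall x, P x.
Proof.
move=> P0 PB Ps; apply: projW => x.
have PN y : P y -> P (- y) by move=> Py; rewrite -sub0r; apply: PB.
have PD y z : P y -> P z -> P (y + z).
  by move=> Py Pz; rewrite -[z]opprK; apply/PB/PN.
have PM (y : O) n : P y -> P (y *~ n).
  move=> Py; have Pn k : P (y *+ k) by elim: k => // k IH; rewrite mulrS; apply: PD.
  by case: n => n; rewrite ?NegzE ?mulrNz -pmulrn //; apply: PN.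
pose pr (z : symbols m) : O :=
  (\pi_(Quotient.quot (zspan (@predistribution_rel m))) z)%qT.
have prB : zmod_morphism pr.
  move=> y z; apply: (@addIr _ (pr z)); rewrite subrK /pr.
  by rewrite -(proj_add (@predistribution_rel_opp m)) subrK.
pose prA := GRing.isZmodMorphism.Build _ _ pr prB.
pose pr' : {additive symbols m -> O} := HB.pack pr prA.
rewrite -/(pr x) [x](bas_sum x) -[pr]/(pr' : _ -> _) raddf_sum.
elim/big_ind: _ => // a _; rewrite raddfMz; apply: PM; exact: Ps.
Qed.

(** A choice of one of y and -y by comparing representatives below m; it selects neither when y =
    -y. *)
Definition half (y : 'Z_m) : bool := ((y : nat) < (- y : 'Z_m))%N.

Lemma half0 : half 0 = false.
Proof. by rewrite /half oppr0 ltnn. Qed.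

Lemma half_opp y : y != - y -> half (- y) = ~~ half y.
Proof.
move=> yN; rewrite /half opprK -leqNgt [RHS]leq_eqVlt; case: eqP => //= E.
by case/eqP: yN; apply/val_inj; rewrite /= E.
Qed.

Lemma odd_part_opp p (y : 'Z_m) : p \in primes m -> odd p -> y * idem p = y ->
  y != 0 -> y != - y.
Proof.
move=> pm podd yE; apply: contra_neq => yN; have pp := primesP pm.
have y2 : y + y = 0 by rewrite {1}yN addNr.
have : p%:R ^+ logn p m * y = 0.
  by rewrite -yE mulrCA (pexp_idem m_gt1 pp) mulr0.
rewrite -natrX -(odd_double_half (p ^ _)) oddX podd orbT -addnn.
by rewrite mulr_natl !mulrnDr -mulrnDl y2 mul0rn addr0 mulr1n.
Qed.

(** The choice of half must respect the relations. Those at other primes leave the component at p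
    unchanged. Those at p add p-torsion, so the choice depends on p times the component whenever
    this is nonzero. *)
Lemma predistribution_split p : p \in primes m -> odd p ->
  exists h : {additive O -> O}, forall z, h z + c (h (c z)) = z.
Proof.
move=> pm podd; have pp := primesP pm; have ee := idemK m_gt1 pp.
pose key (b : 'Z_m) := if p%:R * (b * idem p) == 0 then b * idem p
                       else p%:R * (b * idem p).
(* A symbol with component 0 at p cannot be assigned to a half; the relation at p rewrites it by the
   symbols with nonzero p-torsion component, of which the chosen half is taken. *)
pose f (b : 'Z_m) : O := if b * idem p == 0
  then - \sum_(x : 'Z_m | (p%:R * x == 0) && half x) osym (b + x)
  else if half (key b) then osym b else 0.
have keyE b : key b * idem p = key b.
  by rewrite /key; case: ifP => _; rewrite -?mulrA ee.
have key0 b : b * idem p != 0 -> key b != 0.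
  by move=> b0; rewrite /key; case: ifP => [_ //|/negbT].
have key_opp b : b * idem p != 0 -> half (key (- b)) = ~~ half (key b).
  move=> b0; have -> : key (- b) = - key b.
    by rewrite /key !mulNr mulrN oppr_eq0; case: ifP.
  by apply/half_opp/(odd_part_opp pm podd (keyE b))/key0.
have [q qm a|h hE] := @osym_lift _ f.
  have [qp | npq] := eqVneq p q; last first.
    have ax x : q%:R * x = 0 -> (a + x) * idem p = a * idem p.
      move=> /(torsion_idem m_gt1 qm) ->; rewrite mulrDl -mulrA.
      have nqp : q != p by rewrite eq_sym.
      by rewrite (idem_orth m_gt1 (primesP qm) pp nqp) mulr0 addr0.
    have fE x : q%:R * x == 0 -> f (a + x) = if a * idem p == 0
        then - \sum_(y : 'Z_m | (p%:R * y == 0) && half y) osym (a + y + x)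
        else if half (key a) then osym (a + x) else 0.
      move=> /eqP /ax axE; rewrite /f /key axE; case: ifP => // _; congr (- _).
      by apply: eq_bigr => y _; rewrite addrAC.
    case: (a * idem p == 0) fE => fE; rewrite (eq_bigr _ fE).
      rewrite sumrN exchange_big /= big1 ?oppr0 // => y _.
      exact: osym_rel.
    by case: (half (key a)); [exact: osym_rel | rewrite big1].
  rewrite -{q qm}qp; have [pa0 | pa0] := eqVneq (p%:R * (a * idem p)) 0; last first.
    have fE x : p%:R * x == 0 -> f (a + x) = if half (key a) then osym (a + x) else 0.
      move=> /eqP px; have E : p%:R * ((a + x) * idem p) = p%:R * (a * idem p).
        by rewrite mulrDl mulrDr [p%:R * (x * _)]mulrA px mul0r addr0.
      rewrite /f /key E (negbTE pa0); case: eqP => // ax0.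
      by move: pa0; rewrite -E ax0 mulr0 eqxx.
    by rewrite (eq_bigr _ fE); case: (half (key a)); [exact: osym_rel | rewrite big1].
  (* The member of the p-torsion coset of a with component 0 at p; its value under f is the one that
     makes the sum over this coset vanish. *)
  pose a0 := a - a * idem p.
  have a00 : a0 * idem p = 0 by rewrite mulrBl -mulrA ee subrr.
  have a0x x : p%:R * x == 0 -> (a0 + x) * idem p = x.
    by move=> /eqP px; rewrite mulrDl a00 add0r -(torsion_idem m_gt1 pm px).
  rewrite (reindex_inj (addrI (- (a * idem p)))) /=.
  rewrite (eq_big (fun x : 'Z_m => p%:R * x == 0) (fun x => f (a0 + x))) => [|x|x _].
  - rewrite (bigD1 0) /=; last by rewrite mulr0.
    rewrite {1}/f addr0 a00 eqxx addrC; apply/eqP; rewrite subr_eq0; apply/eqP.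
    rewrite big_mkcond [RHS]big_mkcond /=; apply: eq_bigr => x _.
    have [-> | x0] := eqVneq x 0; first by rewrite andbF half0 andbF.
    rewrite andbT; case: ifP => //= px.
    rewrite /f /key a0x // (negbTE x0).
    by rewrite (eqP px) eqxx; case: ifP.
  - by rewrite mulrDr mulrN pa0 oppr0 add0r.
  by rewrite addrA.
exists h; apply: osym_ind => [|x y hx hy|b].
- by rewrite (raddf0 (gm_act (1%R : 'Z_2))) !raddf0 addr0.
- by rewrite !raddfB addrACA -opprD hx hy.
have bE : osym b = - \sum_(x : 'Z_m | (p%:R * x == 0) && (x != 0)) osym (b + x).
  apply/eqP; rewrite -addr_eq0; apply/eqP; rewrite -[RHS](osym_rel b pm).
  by rewrite [RHS](bigD1 0) ?mulr0 //= addr0.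
rewrite osym_opp !hE.
have [b0 | b0] := eqVneq (b * idem p) 0; last first.
  have -> : f (- b) = if half (key b) then 0 else osym (- b).
    by rewrite /f mulNr oppr_eq0 (negbTE b0) key_opp // if_neg.
  rewrite /f (negbTE b0); case: ifP => hb; rewrite ?ifT ?ifF ?hb //.
    by rewrite (raddf0 (gm_act (1%R : 'Z_2))) addr0.
  by rewrite osym_opp opprK add0r.
rewrite /f mulNr b0 oppr0 eqxx bE.
rewrite (raddfN (gm_act (1%R : 'Z_2))) (raddf_sum (gm_act (1%R : 'Z_2))) -opprD.
congr (- _); rewrite [RHS](bigID (@half)); congr (_ + _).
  apply: eq_bigl => x; rewrite -andbA; congr (_ && _).
  by have [-> | x0] := eqVneq x 0; rewrite ?half0.
rewrite (reindex_inj (@oppr_inj _)); apply: eq_big => [x | x _].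
  rewrite mulrN oppr_eq0; case: eqP => //= px.
  have [-> | x0] := eqVneq x 0; first by rewrite oppr0 half0.
  by rewrite half_opp // (odd_part_opp pm podd) // -torsion_idem.
by transitivity (osym (- (- b + - x))); [exact: osym_opp | rewrite opprD !opprK].
Qed.

(** The splitting is a contraction: if c z = z or c z = -z, the identity [h z + c (h (c z)) = z]
    exhibits z as the norm of [h z] for the corresponding sign. *)
Lemma predistribution_odd p : p \in primes m -> odd p ->
  tate_basis c (fun _ => True) void /\
  tate_basis (fun x => - c x) (fun _ => True) void.
Proof.
move=> pm /(predistribution_split pm)[h hE].
have v0 : void -> O by case.
split; exists v0; split=> [[] | z _ cz | A x _ _];
  try (by apply/setP=> -[]); exists set0, (h z); split => //;
  rewrite big_set0 add0r.
  by rewrite -{1}[z]hE cz.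
have {}cz : c z = - z by rewrite -{2}cz opprK.
by rewrite -{1}[z]hE cz !raddfN.
Qed.

(** * The predistribution for powers of two *)

Section TwoPower.
Variable k : nat.
Hypothesis mE : m = (2 ^ k.+2)%N.

Let primes_m : primes m = [:: 2%N].
Proof. by rewrite mE primesX // . Qed.

(** As m is 4 times 2^k, this residue stands for 1/4, and its double t below for 1/2. *)
Definition quarter : 'Z_m := (2 ^ k)%:R.

Lemma two_torsion (x : 'Z_m) : (2%:R * x == 0) = (x == 0) || (x == 2%:R * quarter).
Proof.
rewrite /quarter -natrM -[x]natr_Zp -natrM.
have eqE (a b : nat) : (a%:R == b%:R :> 'Z_m) = (a == b %[mod m])%N.
  by apply/eqP/eqP => /natr_eqZ; apply.
rewrite -[0]/(0%:R) !eqE.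
have xm : (x < m)%N by rewrite -[X in (_ < X)%N](Zp_cast m_gt1).
have k_gt0 : (0 < 2 ^ k)%N by rewrite expn_gt0.
have m4 : m = (4 * 2 ^ k)%N by rewrite mE !expnS mulnA.
rewrite !mod0n [in RHS]modn_small // [(2 * 2 ^ k %% m)%N]modn_small; last by lia.
move: (x : nat) (2 ^ k)%N xm k_gt0 m4 => {}x j xm j_gt0 m4.
have [lt | ge] := ltnP (2 * x) m; first by rewrite modn_small //; lia.
have -> : (2 * x = m + (2 * x - m))%N by lia.
by rewrite modnDl modn_small; lia.
Qed.

Let t : 'Z_m := 2%:R * quarter.
Let t2 : 2%:R * t = 0. Proof. by apply/eqP; rewrite two_torsion eqxx orbT. Qed.
Let tt : t + t = 0. Proof. by rewrite -t2 mulr_natl mulr2n. Qed.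
Let tN : - t = t. Proof. by apply/eqP; rewrite eq_sym -addr_eq0 tt. Qed.

Let t_neq0 : t != 0.
Proof.
rewrite /t /quarter -natrM; apply/eqP => /(natr_eqZ m_gt1 _ 0).
have k_gt0 : (0 < 2 ^ k)%N by rewrite expn_gt0.
by rewrite mod0n modn_small => [|]; [lia | rewrite mE !expnS; lia].
Qed.

Let q2 : 2%:R * (quarter + t) = t. Proof. by rewrite mulrDr t2 addr0. Qed.
Let qN : - quarter = quarter + t.
Proof.
apply/eqP; rewrite -subr_eq0 -opprD oppr_eq0 addrA -mulr2n -mulr_natl -/t.
by rewrite tt.
Qed.

Lemma sum_two_torsion (X : zmodType) (F : 'Z_m -> X) :
  \sum_(x : 'Z_m | 2%:R * x == 0) F x = F 0 + F t.
Proof.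
rewrite (bigD1 0) ?mulr0 //= (bigD1 t) /=; last by rewrite t2 eqxx.
rewrite big1 ?addr0 // => x /andP[/andP[]].
by rewrite two_torsion -/t => /orP[] ->.
Qed.

Lemma osym_t b : osym (b + t) = - osym b.
Proof.
apply/eqP; rewrite -addr_eq0 addrC; apply/eqP.
have := @osym_rel 2 b; rewrite primes_m sum_two_torsion addr0; apply.
by rewrite inE.
Qed.

(** Subtracting the coefficient of [a + 1/2] makes the coefficient of [a] compatible with the
    relations [[b + 1/2] = - [b]]. *)
Lemma osym_coef (a : 'Z_m) : exists F : {additive O -> int},
  forall b, F (osym b) = (b == a)%:R - (b == a + t)%:R.
Proof.
apply: osym_lift => p; rewrite primes_m inE => /eqP-> b.
rewrite sum_two_torsion addr0 (inj_eq (@addIr _ t)).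
have -> : (b + t == a) = (b == a + t).
  by rewrite -(inj_eq (@addIr _ t)) -addrA tt addr0.
by rewrite addrA subrK subrr.
Qed.

Lemma four_torsion b : 2%:R * (2%:R * b) = 0 ->
  [\/ b = 0, b = t, b = quarter | b = quarter + t].
Proof.
move=> /eqP; rewrite two_torsion -/t => /orP[|/eqP bt].
  by rewrite two_torsion -/t => /orP[] /eqP ->; [constructor 1 | constructor 2].
have : 2%:R * (b - quarter) == 0 by rewrite mulrBr bt -/t subrr.
rewrite two_torsion -/t => /orP[]; rewrite subr_eq => /eqP ->.
  by rewrite add0r; constructor 3.
by rewrite addrC; constructor 4.
Qed.

(** The choice of half is made on 2b, shared by b and b + 1/2. It fails when 2b = -2b, that is for b
    = 0, 1/2, 1/4, 3/4; up to sign these give [0] and [1/4], whose coefficients are [F0] and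
    [F1]. *)
Lemma predistribution_two : exists (h : {additive O -> O}) (F0 F1 : {additive O -> int}),
  [/\ forall z, z = h z + c (h (c z)) + (osym 0 *~ F0 z + osym quarter *~ F1 z),
      F0 (osym 0) = 1, F1 (osym quarter) = 1,
      forall z, F0 (c z) = F0 z & forall z, F1 (c z) = - F1 z].
Proof.
pose f b := if 2%:R * (2%:R * b) == 0 then 0
            else if half (2%:R * b) then osym b else 0.
have [|h hE] := @osym_lift _ f.
  move=> p; rewrite primes_m inE => /eqP-> b; rewrite sum_two_torsion addr0.
  rewrite /f !mulrDr t2 mulr0 !addr0; case: ifP => _; first by rewrite addr0.
  by case: ifP => _; rewrite ?addr0 // osym_t subrr.
have [F0 F0E] := osym_coef 0; have [F1 F1E] := osym_coef quarter.
have q_neq b : 2%:R * b = 0 -> (b == quarter) = false /\ (b == quarter + t) = false.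
  by move=> b2; split; apply/eqP => bE; move: b2; rewrite bE ?q2 => /eqP;
     rewrite (negbTE t_neq0).
have cA := raddf0 (gm_act (1%R : 'Z_2)) : c 0 = 0.
have cB x y : c (x - y) = c x - c y := raddfB (gm_act (1%R : 'Z_2)) x y.
exists h, F0, F1; split.
- apply: osym_ind => [|x y hx hy|b].
  + by rewrite cA !raddf0 ?cA ?mulr0z ?addr0.
  + rewrite {1}hx {1}hy cB !raddfB ?mulrzBr ?cB !opprD !addrA.
    by rewrite [LHS](ACl (1*5*2*6*3*7*4*8)%AC).
  rewrite osym_opp !hE F0E F1E add0r.
  have [b4 | b4] := eqVneq (2%:R * (2%:R * b)) 0.
    have -> : f b = 0 by rewrite /f b4 eqxx.
    have -> : f (- b) = 0 by rewrite /f !mulrN b4 oppr0 eqxx.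
    rewrite cA !add0r; have [q0 q0'] := q_neq 0 (mulr0 _).
    have [qt qt'] := q_neq t t2; have ntt : (t == 0) = false by apply: negbTE.
    have [-> | -> | -> | ->] := four_torsion b4.
    + by rewrite q0 q0' eqxx eq_sym ntt subr0 subrr mulr1z mulr0z addr0.
    + rewrite qt qt' eqxx ntt sub0r subrr mulr0z addr0 mulrN1z -osym_t.
      by rewrite add0r.
    + rewrite eqxx [_ == 0]eq_sym q0 [_ == t]eq_sym qt subrr mulr0z add0r.
      by rewrite -[X in X == _]addr0 (inj_eq (@addrI _ _)) eq_sym ntt subr0 mulr1z.
    rewrite [_ == 0]eq_sym q0' [_ == t]eq_sym qt' subrr mulr0z add0r eqxx.
    rewrite -[X in _ == X]addr0 (inj_eq (@addrI _ _)) ntt sub0r mulrN1z.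
    exact: osym_t.
  have neq a : 2%:R * (2%:R * a) = 0 -> (b == a) = false.
    by move=> a4; apply/eqP => ba; move: b4; rewrite ba a4 eqxx.
  have q4 : 2%:R * (2%:R * quarter) = 0 by rewrite -/t t2.
  rewrite !neq ?q2 ?t2 ?mulr0 // !subrr !mulr0z !addr0.
  have hN : half (2%:R * - b) = ~~ half (2%:R * b).
    by rewrite mulrN half_opp // -addr_eq0 -mulr2n -[X in X != 0]mulr_natl.
  have -> : f (- b) = if half (2%:R * b) then 0 else osym (- b).
    by rewrite /f hN !mulrN oppr_eq0 (negbTE b4) if_neg.
  rewrite /f (negbTE b4); case: ifP => _; first by rewrite cA addr0.
  by rewrite osym_opp opprK add0r.
- by rewrite F0E add0r eqxx eq_sym (negbTE t_neq0) subr0.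
- by rewrite F1E eqxx -[X in X == _]addr0 (inj_eq (@addrI _ _)) eq_sym
     (negbTE t_neq0) subr0.
- apply: osym_ind => [|x y hx hy|b]; first by rewrite cA.
    by rewrite cB !raddfB /= hx hy.
  by rewrite osym_opp !F0E add0r !eqr_oppLR oppr0 tN.
apply: osym_ind => [|x y hx hy|b]; first by rewrite cA raddf0 oppr0.
  by rewrite cB !(raddfB F1) hx hy; move: (F1 x) (F1 y) => i j; ring.
by rewrite osym_opp !F1E !eqr_oppLR -!qN opprK opprB.
Qed.

(** [F1] vanishes on elements fixed by c and [F0] on those negated, so one coefficient remains in
    each parity. Its even part is absorbed into a norm, and norms have even coefficient. *)
Lemma predistribution_two_tate :
  tate_basis c (fun _ => True) unit /\
  tate_basis (fun x => - c x) (fun _ => True) unit.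
Proof.
have [h [F0 [F1 [zE F00 F11 F0c F1c]]]] := predistribution_two.
have c0 : c (osym 0) = osym 0 by rewrite osym_opp oppr0.
have cq : c (osym quarter) = - osym quarter by rewrite osym_opp qN osym_t.
have cA : {morph c : x y / x + y} := raddfD (gm_act (1%R : 'Z_2)).
have cN x : c (- x) = - c x := raddfN (gm_act (1%R : 'Z_2)) x.
have cM x n : c (x *~ n) = c x *~ n := raddfMz (gm_act (1%R : 'Z_2)) n x.
have intE (n : int) : exists (j : int) (b : bool), n = j + j + b%:Z.
  by exists (n %/ 2)%Z, (n %% 2 == 1)%Z; lia.
have sumE (x : O) (b : bool) : \sum_(i in [set _ : unit | b]) x = x *~ b%:Z.
  case: b; last by rewrite big_pred0 // => i; rewrite inE.
  by rewrite (big_pred1 Datatypes.tt) // => -[]; rewrite inE.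
split.
  exists (fun _ => osym 0); split=> [_ // | z _ cz | A x _].
    have Fz : F1 z = 0.
      by have := F1c z; rewrite cz; lia.
    have [j [b jE]] := intE (F0 z).
    exists [set _ | b], (h z + osym 0 *~ j); split=> //.
    rewrite sumE {1}[z]zE Fz mulr0z addr0 cz cA cM c0 jE !mulrzDr.
    by rewrite !addrA [LHS](ACl (5*1*3*2*4)%AC).
  have [tA | tA] := boolP (Datatypes.tt \in A); last first.
    by move=> _; apply/setP => -[]; rewrite (negbTE tA) inE.
  rewrite (big_pred1 Datatypes.tt) => [E|[]//]; exfalso.
  by move: (congr1 F0 E); rewrite raddfD F0c F00; move: (F0 x) => n; lia.
exists (fun _ => osym quarter); split=> [_ | z _ cz | A x _].
- by rewrite cq opprK.
- have {}cz : c z = - z by rewrite -[in RHS]cz opprK.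
  have Fz : F0 z = 0.
    by have := F0c z; rewrite cz (raddfN F0); move: (F0 z) => n; lia.
  have [j [b jE]] := intE (F1 z).
  exists [set _ | b], (h z + osym quarter *~ j); split=> //.
  rewrite sumE {1}[z]zE Fz mulr0z add0r cz cA cM cq (raddfN h) !cN jE !mulrzDr.
  rewrite mulNrz opprD opprK.
  by rewrite !addrA [LHS](ACl (5*1*3*2*4)%AC).
have [tA | tA] := boolP (Datatypes.tt \in A); last first.
  by move=> _; apply/setP => -[]; rewrite (negbTE tA) inE.
rewrite (big_pred1 Datatypes.tt) => [E|[]//]; exfalso.
by move: (congr1 F1 E); rewrite raddfB F1c F11; move: (F1 x) => n; lia.
Qed.

End TwoPower.

End Predistribution.

Lemma odd_prime_divisor m : (0 < m)%N -> ~ (exists k, m = (2 ^ k)%N) ->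
  exists2 p, p \in primes m & odd p.
Proof.
move=> m_gt0 m2; have [/p_natP[k mE] | ] := boolP (2.-nat m)%N.
  by case: m2; exists k.
rewrite /pnat m_gt0 /= => /allPn[p pm p2]; exists p => //.
by have [pE | //] := even_prime (primesP pm); rewrite pE in p2.
Qed.

Local Close Scope ring_scope.

Theorem theorem7p1 (m : nat) (m_gt1 : 1 < m) (m_neq2 : m <> 2 %[mod 4]) :
  let O := univ_predistribution m in
  let U := univ_distribution m in
  let r := size (primes m) in
  [/\ forall (i : nat), i = 1 \/ i = 2 ->
        (forall (g : 'Z_2) (x : cohomology O i), coh_act g x = x)
        /\ (forall (g : 'Z_2) (x : cohomology U i), coh_act g x = x),
      zmod_iso (cohomology O 1) (cohomology O 2),
      (exists k : nat, m = 2 ^ k) ->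
        zmod_iso (cohomology O 1) 'Z_2 /\ zmod_iso (cohomology O 2) 'Z_2,
      ~ (exists k : nat, m = 2 ^ k) ->
        zmod_iso (cohomology O 1) 'rV['Z_2]_0
        /\ zmod_iso (cohomology O 2) 'rV['Z_2]_0
    & zmod_iso (cohomology U 1) (cohomology U 2)
      /\ zmod_iso (cohomology U 1) 'rV['Z_2]_(2 ^ (r - 1))
      /\ zmod_iso (cohomology U 2) 'rV['Z_2]_(2 ^ (r - 1)) ].
Proof.
move=> O U r.
have Otwo : (exists k : nat, m = 2 ^ k) ->
    zmod_iso (cohomology O 1) 'Z_2 /\ zmod_iso (cohomology O 2) 'Z_2.
  (* The exponents 0 and 1 are excluded by 1 < m and by the condition modulo 4. *)
  case=> -[|[|k]] mE; [by rewrite mE in m_gt1 | by case: m_neq2; rewrite mE |].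
  have [t2 t1] := predistribution_two_tate m_gt1 mE.
  split; apply: zmod_iso_Z2.
    by have := cohomology1_iso t1; rewrite card_unit.
  by have := cohomology2_iso t2; rewrite card_unit.
have Oodd : ~ (exists k : nat, m = 2 ^ k) ->
    zmod_iso (cohomology O 1) 'rV['Z_2]_0 /\ zmod_iso (cohomology O 2) 'rV['Z_2]_0.
  move=> /(odd_prime_divisor (ltnW m_gt1))[p pm podd].
  have [t2 t1] := predistribution_odd m_gt1 pm podd.
  split; first by have := cohomology1_iso t1; rewrite card_void.
  by have := cohomology2_iso t2; rewrite card_void.
have [I [J [t2 t1 cI cJ]]] := univ_distribution_tate_basis m_gt1 m_neq2.
have U1 : zmod_iso (cohomology U 1) 'rV['Z_2]_(2 ^ (r - 1)).
  by have := cohomology1_iso t1; rewrite cJ.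
have U2 : zmod_iso (cohomology U 2) 'rV['Z_2]_(2 ^ (r - 1)).
  by have := cohomology2_iso t2; rewrite cI.
split=> //.
- by move=> i i12; split; apply: coh_act_trivial.
- by have [/Otwo[o1 o2] | /Oodd[o1 o2]] := pselect (exists k, m = 2 ^ k);
    apply: zmod_iso_trans o1 (zmod_iso_sym o2).
by split=> //; apply: zmod_iso_trans U1 (zmod_iso_sym U2).
Qed.
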